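(* Let $\mathbb{k}$ be an algebraically closed field, let $V=\bigoplus_{i\in\mathbb{Z}}V_i$ be a finite dimensional graded $\mathbb{k}$-vector space, and let $A$ and $B$ be graded associative $\mathbb{k}$-algebras regarded as points of the variety $\mathsf{GrAss}_{\mathbb{k}}(V)$ of graded associative algebra structures on $V$. The algebra $B$ is a graded degeneration of $A$ (that is, $\mathcal{O}_B\subseteq\overline{\mathcal{O}_A}$ in $\mathsf{GrAss}_{\mathbb{k}}(V)$) if and only if there exists a graded Gerstenhaber formal deformation $\mathcal{X}$ of $B$ such that $\mathcal{X}\otimes_{\mathbb{k}[[t]]}\mathbb{k}((t))$ is isomorphic to $A\otimes_{\mathbb{k}}\mathbb{k}((t))$ as graded algebras over $\mathbb{k}((t))$.
   Context: $\mathsf{GrAss}_{\mathbb{k}}(V)$ is the affine variety of graded associative algebra structures on $V$, i.e. of associative products $\varphi:V\otimes V\to V$ with $\varphi(V_i\otimes V_j)\subseteq V_{i+j}$ for all $i,j$. Algebras are not required to have a unit. The algebraic group $\operatorname{GL}_0(V)$ of linear automorphisms of $V$ of degree $0$ acts on it by $g\cdot\varphi=g\circ\varphi\circ(g^{-1}\otimes g^{-1})$; orbits correspond to isomorphism classes of finite dimensional graded algebras with Hilbert series $\sum_{i\in\mathbb{Z}}\dim_{\mathbb{k}}(V_i)\,t^i$. $\mathcal{O}_A$ is the orbit of $A$ and $\overline{\mathcal{O}_A}$ its Zariski closure in $\mathsf{GrAss}_{\mathbb{k}}(V)$. $B$ is called a graded degeneration of $A$ if $\mathcal{O}_B\subseteq\overline{\mathcal{O}_A}$.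 $\mathbb{k}[[t]]$ is the algebra of formal power series and $\mathbb{k}((t))$ its fraction field, both concentrated in degree $0$. A formal deformation of an associative algebra $B$ is a pair $(\mathcal{X},\Phi)$ where $\mathcal{X}$ is a ($t$-adically) complete and torsion-free associative $\mathbb{k}[[t]]$-algebra and $\Phi:\mathcal{X}\otimes_{\mathbb{k}[[t]]}\mathbb{k}\to B$ is an isomorphism of $\mathbb{k}$-algebras ($\mathbb{k}$ being a $\mathbb{k}[[t]]$-algebra via $t\mapsto0$). If $B$ is graded, a graded formal deformation of $B$ is a formal deformation $(\mathcal{X},\Phi)$ where $\mathcal{X}$ is a graded $\mathbb{k}[[t]]$-algebra and $\Phi$ is an isomorphism of degree zero. *)

(* Defs.v *)
From HB Require Import structures.
From mathcomp Require Import all_boot all_order all_algebra.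
From mathcomp Require Import boolp classical_sets.
From mathcomp Require Import mpoly.

Set Implicit Arguments.
Unset Strict Implicit.
Unset Printing Implicit Defensive.

Import GRing.Theory.
Local Open Scope ring_scope.
Local Open Scope quotient_scope.

Record fps (R : Type) := Fps { fps_coef : nat -> R }.

HB.instance Definition _ (R : Type) := gen_eqMixin (fps R).
HB.instance Definition _ (R : Type) := gen_choiceMixin (fps R).

Lemma fpsP (R : Type) (a b : fps R) :
  (forall n, fps_coef a n = fps_coef b n) -> a = b.
Proof. by case: a b => [a] [b] /= ab; congr Fps; apply/funext. Qed.

Section FpsRing.
Variable R : comNzRingType.
Implicit Types a b c : fps R.

Definition fps_zero : fps R := Fps (fun=> 0).
Definition fps_opp a : fps R := Fps (fun n => - fps_coef a n).
Definition fps_add a b : fps R := Fps (fun n => fps_coef a n + fps_coef b n).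

Fact fps_addA : associative fps_add.
Proof. by move=> a b c; apply: fpsP => n /=; rewrite addrA. Qed.
Fact fps_addC : commutative fps_add.
Proof. by move=> a b; apply: fpsP => n /=; rewrite addrC. Qed.
Fact fps_add0 : left_id fps_zero fps_add.
Proof. by move=> a; apply: fpsP => n /=; rewrite add0r. Qed.
Fact fps_addN : left_inverse fps_zero fps_opp fps_add.
Proof. by move=> a; apply: fpsP => n /=; rewrite addNr. Qed.

HB.instance Definition _ :=
  GRing.isZmodule.Build (fps R) fps_addA fps_addC fps_add0 fps_addN.

Definition fps_const (x : R) : fps R := Fps (fun n => if n == 0%N then x else 0).
Definition fps_t : fps R := Fps (fun n => (n == 1%N)%:R).
Definition fps_mul a b : fps R :=
  Fps (fun n => \sum_(j < n.+1) fps_coef a j * fps_coef b (n - j)).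

Fact fps_mulC : commutative fps_mul.
Proof.
move=> a b; apply: fpsP => n /=; rewrite (reindex_inj rev_ord_inj) /=.
by apply: eq_bigr => j _; rewrite (sub_ordK j) mulrC.
Qed.

Fact fps_coef_mul_rev a b n :
  fps_coef (fps_mul a b) n = \sum_(j < n.+1) fps_coef a (n - j) * fps_coef b j.
Proof.
by rewrite fps_mulC /=; apply: eq_bigr => j _; rewrite mulrC.
Qed.

Fact fps_mulA : associative fps_mul.
Proof.
move=> a b c; apply: fpsP => i; rewrite [RHS]fps_coef_mul_rev.
pose coef3 j k := fps_coef a j * (fps_coef b (i - j - k) * fps_coef c k).
transitivity (\sum_(j < i.+1) \sum_(k < i.+1 | (k <= i - j)%N) coef3 j k).
  rewrite {1}/fps_mul [LHS]/fps_coef -/(fps_coef _).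
  apply: eq_bigr => j _; rewrite fps_coef_mul_rev big_distrr /=.
  by rewrite (big_ord_narrow_leq (leq_subr _ _)).
rewrite (exchange_big_dep predT) //=; apply: eq_bigr => k _.
transitivity (\sum_(j < i.+1 | (j <= i - k)%N) coef3 j k).
  apply: eq_bigl => j; rewrite -ltnS -(ltnS j) -!subSn ?leq_ord //.
  by rewrite -subn_gt0 -(subn_gt0 j) -!subnDA addnC.
rewrite (big_ord_narrow_leq (leq_subr _ _)) big_distrl /=.
by apply: eq_bigr => j _; rewrite /coef3 -!subnDA addnC mulrA.
Qed.

Fact fps_constM x a n : fps_coef (fps_mul (fps_const x) a) n = x * fps_coef a n.
Proof.
by rewrite /= big_ord_recl /= subn0 big1 ?addr0 // => j _; rewrite mul0r.
Qed.

Fact fps_mul1 : left_id (fps_const 1) fps_mul.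
Proof. by move=> a; apply: fpsP => n; rewrite fps_constM mul1r. Qed.

Fact fps_mulDl : left_distributive fps_mul fps_add.
Proof.
move=> a b c; apply: fpsP => n /=; rewrite -big_split /=.
by apply: eq_bigr => j _; rewrite mulrDl.
Qed.

Fact fps_one_neq0 : fps_const 1 != 0.
Proof.
apply/eqP => /(congr1 (fun a => fps_coef a 0%N)) /= /eqP.
by rewrite oner_eq0.
Qed.

HB.instance Definition _ := GRing.Zmodule_isComNzRing.Build (fps R)
  fps_mulA fps_mulC fps_mul1 fps_mulDl fps_one_neq0.

Definition fps_eval0 a : R := fps_coef a 0%N.

Fact fps_eval0_zmod : zmod_morphism fps_eval0.
Proof. by []. Qed.
Fact fps_eval0_monoid : monoid_morphism fps_eval0.
Proof. by split=> // a b; rewrite /fps_eval0 /= big_ord1. Qed.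
HB.instance Definition _ :=
  GRing.isZmodMorphism.Build (fps R) R fps_eval0 fps_eval0_zmod.
HB.instance Definition _ :=
  GRing.isMonoidMorphism.Build (fps R) R fps_eval0 fps_eval0_monoid.

Fact fps_const_zmod : zmod_morphism fps_const.
Proof. by move=> x y; apply: fpsP => -[|n] /=; rewrite ?subrr. Qed.
Fact fps_const_monoid : monoid_morphism fps_const.
Proof.
split=> // x y; apply: fpsP => n.
by rewrite fps_constM /=; case: eqP; rewrite ?mulr0.
Qed.
HB.instance Definition _ :=
  GRing.isZmodMorphism.Build R (fps R) fps_const fps_const_zmod.
HB.instance Definition _ :=
  GRing.isMonoidMorphism.Build R (fps R) fps_const fps_const_monoid.

Definition fps_unit : pred (fps R) := fun a => `[< exists b, b * a = 1 >].
Definition fps_inv a : fps R :=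
  if pselect (exists b, b * a = 1) is left ex then projT1 (cid ex) else a.

Fact fps_mulV : {in fps_unit, left_inverse 1 fps_inv *%R}.
Proof.
move=> a /asboolP ua; rewrite /fps_inv; case: pselect => // ex.
by case: (cid ex).
Qed.
Fact fps_unitP a b : b * a = 1 -> fps_unit a.
Proof. by move=> ba; apply/asboolP; exists b. Qed.
Fact fps_inv_out : {in [predC fps_unit], fps_inv =1 id}.
Proof.
by move=> a /asboolP ua; rewrite /fps_inv; case: pselect.
Qed.

HB.instance Definition _ := GRing.ComNzRing_hasMulInverse.Build (fps R)
  fps_mulV fps_unitP fps_inv_out.

End FpsRing.

Section FpsDomain.
Variable R : idomainType.

Fact fps_low (a : fps R) : a != 0 ->
  exists2 m, fps_coef a m != 0 & forall j, (j < m)%N -> fps_coef a j = 0.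
Proof.
move=> a0; have ex : exists n, fps_coef a n != 0.
  apply: contrapT => nex; move/eqP: a0; apply; apply: fpsP => n.
  by apply/eqP; apply: contrapT => /negP an; apply: nex; exists n.
exists (ex_minn ex); case: ex_minnP => // m am lem j jm.
by apply/eqP; apply: contraLR jm => aj; rewrite -leqNgt lem.
Qed.

Fact fps_integral (a b : fps R) : a * b = 0 -> (a == 0) || (b == 0).
Proof.
move=> ab0; apply: contraT; rewrite negb_or => /andP[].
move=> /fps_low[m am la] /fps_low[n bn lb].
have : fps_coef (a * b) (m + n) = 0 by rewrite ab0.
have lt_m : (m < (m + n).+1)%N by rewrite ltnS leq_addr.
rewrite /= (bigD1 (Ordinal lt_m)) //= addKn big1 ?addr0 => [|j].
  by move/eqP; rewrite mulf_eq0 (negbTE am) (negbTE bn).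
rewrite -val_eqE /= neq_ltn => /orP[/la->|mj]; first by rewrite mul0r.
by rewrite lb ?mulr0 // ltn_subLR ?leq_ord // ltn_add2r.
Qed.

HB.instance Definition _ := GRing.ComUnitRing_isIntegral.Build (fps R)
  fps_integral.

Definition laurent := {fraction fps R}.
HB.instance Definition _ := GRing.Field.on laurent.

Definition fps_laurent : {rmorphism fps R -> laurent} := @tofrac (fps R).
Definition const_laurent : {rmorphism R -> laurent} :=
  (@tofrac (fps R) \o @fps_const R)%FUN.

End FpsDomain.

Section Grading.
Variables (R : comNzRingType) (M : lmodType R) (d : int -> set M).

Definition decomposition (x : M) (c : int -> M) :=
  (forall i, d i (c i)) /\
  exists s : seq int, [/\ uniq s, forall i, i \notin s -> c i = 0
                        & x = \sum_(i <- s) c i].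

Record grading : Prop := Grading {
  grading0 : forall i, d i 0;
  gradingZD : forall i a x y, d i x -> d i y -> d i (a *: x + y);
  grading_decomp : forall x, exists! c, decomposition x c }.

Lemma big_uniq_extend (U : nmodType) (c : int -> U) (s s' : seq int) :
  uniq s -> uniq s' -> {subset s <= s'} -> (forall i, i \notin s -> c i = 0) ->
  \sum_(i <- s') c i = \sum_(i <- s) c i.
Proof.
move=> us us' ss c0; rewrite (bigID (mem s)) /= [X in _ + X]big1 => [|i]; last exact: c0.
rewrite addr0 -big_filter; apply: perm_big; apply: uniq_perm => //.
  exact: filter_uniq.
by move=> i; rewrite mem_filter andb_idr // => /ss.
Qed.

Lemma decompositionZD a x y c c' : grading ->
  decomposition x c -> decomposition y c' ->
  decomposition (a *: x + y) (fun i => a *: c i + c' i).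
Proof.
move=> gr [dc [s [us c0 ->]]] [dc' [s' [us' c0' ->]]].
split=> [i|]; first exact: gradingZD.
exists (undup (s ++ s')); split; first exact: undup_uniq.
  move=> i; rewrite mem_undup mem_cat negb_or => /andP[/c0-> /c0'->].
  by rewrite scaler0 addr0.
rewrite big_split /= -scaler_sumr; congr (_ *: _ + _); apply/esym;
  by apply: big_uniq_extend; rewrite ?undup_uniq // => i is_;
    rewrite mem_undup mem_cat is_ ?orbT.
Qed.

Lemma decomposition_hom i x : grading -> d i x ->
  decomposition x (fun j => if j == i then x else 0).
Proof.
move=> gr dx; split=> [j|]; first by case: eqP => [->//|_]; apply: grading0.
exists [:: i]; split=> //; last by rewrite big_seq1 eqxx.
by move=> j; rewrite inE => /negbTE->.
Qed.

Lemma grading_proj : grading -> exists p : M -> int -> M,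
  [/\ forall x, decomposition x (p x), forall i, linear (p^~ i)
    & forall i j x, d i x -> p x j = if j == i then x else 0].
Proof.
move=> gr; pose p x := projT1 (cid (grading_decomp gr x)); exists p.
have pP x : decomposition x (p x) /\ forall c, decomposition x c -> p x = c.
  by rewrite /p; case: cid => c [].
split=> [x|i a x y|i j x dx]; first by case: (pP x).
  rewrite (proj2 (pP _) (fun i => a *: p x i + p y i)) //.
  by apply: decompositionZD => //; case: (pP x); case: (pP y).
by rewrite (proj2 (pP x) _ (decomposition_hom gr dx)).
Qed.

End Grading.

(** There is no unit: [gralg_mul] is only bilinear and associative. *)
Record gralg (R : comNzRingType) := GrAlg {
  gralg_mod :> lmodType R;
  gralg_mul : gralg_mod -> gralg_mod -> gralg_mod;
  gralg_deg : int -> set gralg_mod;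
  gralg_linl : forall y, linear (gralg_mul^~ y);
  gralg_linr : forall x, linear (gralg_mul x);
  gralg_mulA : associative gralg_mul;
  gralg_degP : grading gralg_deg;
  gralg_mul_deg : forall i j x y, gralg_deg i x -> gralg_deg j y ->
                  gralg_deg (i + j) (gralg_mul x y) }.

(** For a bijective linear map, mapping each component into the component of
    the same degree forces equality, so the inverse also has degree 0. *)
Record gralg_isom (R : comNzRingType) (X Y : gralg R) (f : X -> Y) : Prop :=
  GrAlgIsom {
    isom_linear : linear f;
    isom_bij : bijective f;
    isom_mul : {morph f : x y / gralg_mul x y};
    isom_deg : forall i x, gralg_deg i x -> gralg_deg i (f x) }.

Definition gralg_isomorphic (R : comNzRingType) (X Y : gralg R) :=
  exists f : X -> Y, gralg_isom f.

Section Tensor.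
Variables (R S : comNzRingType) (f : {rmorphism R -> S}) (M : lmodType R).

(** A formal sum [[:: (x1, s1); ..]] stands for [x1 (x) s1 + ..]; [S] is an
    [R]-module through [f]. The congruence below has additive inverses, since
    [(x, s)] and [(- x, s)] add up to [(0, s)]. *)
Inductive tensor_rel : seq (M * S) -> seq (M * S) -> Prop :=
| TensorRefl u : tensor_rel u u
| TensorSym u v : tensor_rel u v -> tensor_rel v u
| TensorTrans u v w : tensor_rel u v -> tensor_rel v w -> tensor_rel u w
| TensorCat u u' v v' :
    tensor_rel u u' -> tensor_rel v v' -> tensor_rel (u ++ v) (u' ++ v')
| TensorComm u v : tensor_rel (u ++ v) (v ++ u)
| TensorZero s : tensor_rel [:: (0, s)] [::]
| TensorAddl x y s : tensor_rel [:: (x + y, s)] [:: (x, s); (y, s)]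
| TensorAddr x s s' : tensor_rel [:: (x, s + s')] [:: (x, s); (x, s')]
| TensorBalanced r x s : tensor_rel [:: (r *: x, s)] [:: (x, f r * s)].

Definition tensor_relb u v := `[< tensor_rel u v >].

Fact tensor_rel_refl : reflexive tensor_relb.
Proof. by move=> u; apply/asboolP; apply: TensorRefl. Qed.
Fact tensor_rel_sym : ssrbool.symmetric tensor_relb.
Proof. by move=> u v; apply/asboolP/asboolP; apply: TensorSym. Qed.
Fact tensor_rel_trans : transitive tensor_relb.
Proof.
by move=> v u w /asboolP uv /asboolP vw; apply/asboolP; apply: TensorTrans vw.
Qed.

Canonical tensor_equiv :=
  EquivRel tensor_relb tensor_rel_refl tensor_rel_sym tensor_rel_trans.

Definition tensor := {eq_quot tensor_relb}.
HB.instance Definition _ : EqQuotient _ tensor_relb tensor :=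
  EqQuotient.on tensor.
HB.instance Definition _ := Choice.on tensor.

Definition tensor_of (u : seq (M * S)) : tensor := \pi_tensor u.

Lemma tensor_ofP u v : tensor_of u = tensor_of v <-> tensor_rel u v.
Proof.
split=> [/eqmodP/asboolP//|uv]; apply/eqmodP; exact/asboolP.
Qed.

Lemma tensor_ofK t : tensor_of (repr t) = t.
Proof. by rewrite /tensor_of reprK. Qed.

Definition tens (x : M) (s : S) : tensor := tensor_of [:: (x, s)].
Definition tensor_add (t t' : tensor) := tensor_of (repr t ++ repr t').
Definition tensor_opp (t : tensor) :=
  tensor_of [seq (- p.1, p.2) | p <- repr t].
Definition tensor_scale (a : S) (t : tensor) :=
  tensor_of [seq (p.1, a * p.2) | p <- repr t].

Fact tensor_of_cat u v :
  tensor_of (u ++ v) = tensor_add (tensor_of u) (tensor_of v).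
Proof.
by apply/tensor_ofP; apply: TensorCat; apply/tensor_ofP; rewrite tensor_ofK.
Qed.

Fact tensor_rel_opp u v : tensor_rel u v ->
  tensor_rel [seq (- p.1, p.2) | p <- u] [seq (- p.1, p.2) | p <- v].
Proof.
elim=> {u v} /=.
- by move=> u; apply: TensorRefl.
- by move=> u v _; apply: TensorSym.
- by move=> u v w _ uv _; apply: TensorTrans.
- by move=> u u' v v' _ uu' _ vv'; rewrite !map_cat; apply: TensorCat.
- by move=> u v; rewrite !map_cat; apply: TensorComm.
- by move=> s; rewrite oppr0; apply: TensorZero.
- by move=> x y s; rewrite opprD; apply: TensorAddl.
- by move=> x s s'; apply: TensorAddr.
- by move=> r x s; rewrite -scalerN; apply: TensorBalanced.
Qed.

Fact tensor_of_opp u :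
  tensor_opp (tensor_of u) = tensor_of [seq (- p.1, p.2) | p <- u].
Proof.
by apply/tensor_ofP; apply: tensor_rel_opp; apply/tensor_ofP; rewrite tensor_ofK.
Qed.

Fact tensor_rel_scale a u v : tensor_rel u v ->
  tensor_rel [seq (p.1, a * p.2) | p <- u] [seq (p.1, a * p.2) | p <- v].
Proof.
elim=> {u v} /=.
- by move=> u; apply: TensorRefl.
- by move=> u v _; apply: TensorSym.
- by move=> u v w _ uv _; apply: TensorTrans.
- by move=> u u' v v' _ uu' _ vv'; rewrite !map_cat; apply: TensorCat.
- by move=> u v; rewrite !map_cat; apply: TensorComm.
- by move=> s; apply: TensorZero.
- by move=> x y s; apply: TensorAddl.
- by move=> x s s'; rewrite mulrDr; apply: TensorAddr.
- by move=> r x s; rewrite mulrCA; apply: TensorBalanced.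
Qed.

Fact tensor_of_scale a u :
  tensor_scale a (tensor_of u) = tensor_of [seq (p.1, a * p.2) | p <- u].
Proof.
by apply/tensor_ofP; apply: tensor_rel_scale; apply/tensor_ofP; rewrite tensor_ofK.
Qed.

Fact tensor_addA : associative tensor_add.
Proof.
move=> t t' t''; rewrite -(tensor_ofK t) -(tensor_ofK t') -(tensor_ofK t'').
by rewrite -!tensor_of_cat catA.
Qed.
Fact tensor_addC : commutative tensor_add.
Proof. by move=> t t'; apply/tensor_ofP; apply: TensorComm. Qed.
Fact tensor_add0 : left_id (tensor_of [::]) tensor_add.
Proof. by move=> t; rewrite -(tensor_ofK t) -tensor_of_cat. Qed.
Fact tensor_addN : left_inverse (tensor_of [::]) tensor_opp tensor_add.
Proof.
move=> t; rewrite -(tensor_ofK t); elim: (repr t) => [|[x s] u IHu].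
  by rewrite tensor_of_opp tensor_add0.
move: IHu; rewrite !tensor_of_opp -cat1s map_cat !tensor_of_cat /= => IHu.
rewrite -tensor_addA (tensor_addC (tensor_of [:: (x, s)])).
rewrite [X in tensor_add _ X]tensor_addA IHu tensor_add0.
rewrite -tensor_of_cat; apply/tensor_ofP => /=.
apply: TensorTrans (TensorZero s).
by apply: TensorSym; rewrite -(addNr x); apply: TensorAddl.
Qed.

HB.instance Definition _ := GRing.isZmodule.Build tensor
  tensor_addA tensor_addC tensor_add0 tensor_addN.

Lemma tensor_ofD u v : tensor_of (u ++ v) = tensor_of u + tensor_of v.
Proof. exact: tensor_of_cat. Qed.

Lemma tensor_of_cons p u : tensor_of (p :: u) = tens p.1 p.2 + tensor_of u.
Proof. by case: p => x s; rewrite -tensor_ofD. Qed.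

Fact tensor_scaleA a b t :
  tensor_scale a (tensor_scale b t) = tensor_scale (a * b) t.
Proof.
rewrite -(tensor_ofK t) !tensor_of_scale -map_comp; congr tensor_of.
by apply: eq_map => p /=; rewrite mulrA.
Qed.
Fact tensor_scale1 : left_id 1 tensor_scale.
Proof.
move=> t; rewrite -(tensor_ofK t) tensor_of_scale; congr tensor_of.
by rewrite -[RHS]map_id; apply: eq_map => -[x s] /=; rewrite mul1r.
Qed.
Fact tensor_scaleDr : right_distributive tensor_scale +%R.
Proof.
move=> a t t'; rewrite -(tensor_ofK t) -(tensor_ofK t').
by rewrite -tensor_ofD !tensor_of_scale map_cat tensor_ofD.
Qed.
Fact tensor_scaleDl t : {morph tensor_scale^~ t : a b / a + b}.
Proof.
move=> a b; rewrite -(tensor_ofK t) !tensor_of_scale.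
elim: (repr t) => [|[x s] u IHu] /=; first by rewrite -tensor_ofD.
rewrite !tensor_of_cons IHu addrACA; congr (_ + _).
by rewrite /= -tensor_ofD mulrDl; apply/tensor_ofP; apply: TensorAddr.
Qed.

HB.instance Definition _ := GRing.Zmodule_isLmodule.Build S tensor
  tensor_scaleA tensor_scale1 tensor_scaleDr tensor_scaleDl.

Lemma tensDl x y s : tens (x + y) s = tens x s + tens y s.
Proof. by rewrite -tensor_ofD; apply/tensor_ofP; apply: TensorAddl. Qed.
Lemma tensDr x s s' : tens x (s + s') = tens x s + tens x s'.
Proof. by rewrite -tensor_ofD; apply/tensor_ofP; apply: TensorAddr. Qed.
Lemma tensZ r x s : tens (r *: x) s = tens x (f r * s).
Proof. by apply/tensor_ofP; apply: TensorBalanced. Qed.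
Lemma tens_scale a x s : a *: tens x s = tens x (a * s).
Proof. exact: tensor_of_scale. Qed.
Lemma tens0l s : tens 0 s = 0.
Proof. by apply/tensor_ofP; apply: TensorZero. Qed.

Lemma tensor_ofE u : tensor_of u = \sum_(p <- u) tens p.1 p.2.
Proof.
elim: u => [|[x s] u IHu]; first by rewrite big_nil.
by rewrite big_cons -IHu tensor_of_cons.
Qed.

Lemma tensorE t : t = \sum_(p <- repr t) tens p.1 p.2.
Proof. by rewrite -tensor_ofE tensor_ofK. Qed.

Section Lift.
Variables (U : zmodType) (b : M -> S -> U).

Definition tensor_lift (t : tensor) : U := \sum_(p <- repr t) b p.1 p.2.

Hypothesis bDl : forall s, {morph b^~ s : x y / x + y}.
Hypothesis bDr : forall x, {morph b x : s s' / s + s'}.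
Hypothesis bZ : forall r x s, b (r *: x) s = b x (f r * s).

Fact tensor_rel_lift u v : tensor_rel u v ->
  \sum_(p <- u) b p.1 p.2 = \sum_(p <- v) b p.1 p.2.
Proof.
elim=> {u v}.
- by [].
- by [].
- by move=> u v w _ -> _ ->.
- by move=> u u' v v' _ uu' _ vv'; rewrite !big_cat /= uu' vv'.
- by move=> u v; rewrite !big_cat /= addrC.
- move=> s; rewrite big_nil big_seq1 /=; apply: (addIr (b 0 s)).
  by rewrite -bDl addr0 add0r.
- by move=> x y s; rewrite big_seq1 big_cons big_seq1 /= bDl.
- by move=> x s s'; rewrite big_seq1 big_cons big_seq1 /= bDr.
- by move=> r x s; rewrite !big_seq1 /= bZ.
Qed.

Lemma tensor_lift_of u : tensor_lift (tensor_of u) = \sum_(p <- u) b p.1 p.2.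
Proof. by apply: tensor_rel_lift; apply/tensor_ofP; rewrite tensor_ofK. Qed.

Lemma tensor_lift_tens x s : tensor_lift (tens x s) = b x s.
Proof. by rewrite tensor_lift_of big_seq1. Qed.

Lemma tensor_liftD : {morph tensor_lift : t t' / t + t'}.
Proof. by move=> t t'; rewrite {1}/GRing.add /= tensor_lift_of big_cat. Qed.

Lemma tensor_lift0 : tensor_lift 0 = 0.
Proof. by apply: (addIr (tensor_lift 0)); rewrite -tensor_liftD !add0r. Qed.

Lemma tensor_lift_sum I (r : seq I) (F : I -> tensor) :
  tensor_lift (\sum_(i <- r) F i) = \sum_(i <- r) tensor_lift (F i).
Proof. exact: (big_morph _ tensor_liftD tensor_lift0). Qed.

End Lift.

Lemma tensor_ind (P : tensor -> Prop) :
  (forall x s, P (tens x s)) -> (forall t t', P t -> P t' -> P (t + t')) ->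
  forall t, P t.
Proof.
move=> Pt PD t; rewrite (tensorE t).
elim: (repr t) => [|p u IHu]; first by rewrite big_nil -(tens0l 0).
by rewrite big_cons; apply: PD.
Qed.

Section TensorDeg.
Variable d : int -> set M.

(** The image of [M_i (x) S]. *)
Definition tensor_deg (i : int) : set tensor :=
  [set t | exists2 u : seq (M * S), forall p, p \in u -> d i p.1
                                  & t = \sum_(p <- u) tens p.1 p.2].

Lemma tensor_deg_tens i x s : d i x -> tensor_deg i (tens x s).
Proof.
move=> dx; exists [:: (x, s)]; last by rewrite big_seq1.
by move=> p; rewrite inE => /eqP->.
Qed.

Fact tensor_deg0 i : tensor_deg i 0.
Proof. by exists [::]; rewrite ?big_nil. Qed.

Fact tensor_degZD i a t t' :
  tensor_deg i t -> tensor_deg i t' -> tensor_deg i (a *: t + t').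
Proof.
move=> [u du ->] [u' du' ->]; exists ([seq (p.1, a * p.2) | p <- u] ++ u').
  move=> p; rewrite mem_cat => /orP[/mapP[q qu ->]|/du'//]; exact: (du q).
rewrite big_cat big_map scaler_sumr; congr (_ + _).
by apply: eq_bigr => p _; rewrite tens_scale.
Qed.

Fact tensor_degD i t t' :
  tensor_deg i t -> tensor_deg i t' -> tensor_deg i (t + t').
Proof. by move=> dt dt'; rewrite -(scale1r t); apply: tensor_degZD. Qed.

Lemma tensor_grading : grading d -> grading tensor_deg.
Proof.
move=> gr; have [p [pP plin phom]] := grading_proj gr.
have pD i : {morph p^~ i : x y / x + y}.
  by move=> x y; have := plin i 1 x y; rewrite !scale1r.
have p0 i : p 0 i = 0 by apply: (addIr (p 0 i)); rewrite -pD !add0r.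
have pZ i r x : p (r *: x) i = r *: p x i.
  by have := plin i r x 0; rewrite p0 !addr0.
pose q t i := tensor_lift (fun x s => tens (p x i) s) t.
have bDl i s : {morph (fun x => tens (p x i) s) : x y / x + y}.
  by move=> x y; rewrite pD tensDl.
have bDr i x : {morph (fun s => tens (p x i) s) : s s' / s + s'}.
  by move=> s s'; rewrite tensDr.
have bZ i r x s : tens (p (r *: x) i) s = tens (p x i) (f r * s).
  by rewrite pZ tensZ.
have qE i x s : q (tens x s) i = tens (p x i) s.
  exact: (tensor_lift_tens (bDl i) (bDr i) (bZ i)).
have qD i : {morph q^~ i : t t' / t + t'}.
  exact: (tensor_liftD (bDl i) (bDr i) (bZ i)).
have q0 i : q 0 i = 0 by exact: (tensor_lift0 (bDl i) (bDr i) (bZ i)).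
have q_hom i j t : tensor_deg i t -> q t j = if j == i then t else 0.
  move=> [u du ->]; rewrite (big_morph (q^~ j) (qD j) (q0 j)).
  case: (eqVneq j i) => [->|ji].
    apply: eq_big_seq => -[x s] /du /= dx.
    by rewrite qE (phom _ _ _ dx) eqxx.
  rewrite big_seq big1 // => -[x s] /du /= dx.
  by rewrite qE (phom _ _ _ dx) (negbTE ji) tens0l.
split=> [i|i a t t'|t]; [exact: tensor_deg0 | exact: tensor_degZD |].
exists (q t); split=> [|c [dc [s [us c0 ->]]]]; last first.
  apply/funext => j; rewrite (big_morph (q^~ j) (qD j) (q0 j)).
  rewrite (eq_bigr (fun i => if j == i then c i else 0)) => [|i _]; last exact: q_hom.
  case: (boolP (j \in s)) => [js|js].
    by rewrite (bigD1_seq j) //= eqxx big1 ?addr0 // => i; rewrite eq_sym => /negbTE->.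
  rewrite c0 // big_seq big1 // => i is_.
  by case: eqP => // ji; rewrite ji is_ in js.
elim/tensor_ind: t => [x r|t t' [dt [s [us s0 tE]]] [dt' [s' [us' s0' tE']]]].
  have [dx [s [us s0 xE]]] := pP x; split=> [i|].
    by rewrite qE; apply: tensor_deg_tens.
  exists s; split=> // [i /s0 pi0|]; first by rewrite qE pi0 tens0l.
  rewrite {1}xE (big_morph (tens^~ r) (fun x y => tensDl x y r) (tens0l r)).
  by apply: eq_bigr => i _; rewrite qE.
split=> [i|]; first by rewrite qD; apply: tensor_degD.
exists (undup (s ++ s')); split; first exact: undup_uniq.
  move=> i; rewrite mem_undup mem_cat negb_or => /andP[/s0 t0 /s0' t0'].
  by rewrite qD t0 t0' addr0.
rewrite (eq_bigr (fun i => q t i + q t' i)) => [|i _]; last exact: qD.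
rewrite {1}tE {1}tE' big_split /=; congr (_ + _); apply/esym;
  by apply: big_uniq_extend; rewrite ?undup_uniq // => i is_;
    rewrite mem_undup mem_cat is_ ?orbT.
Qed.

End TensorDeg.

End Tensor.

Section BaseChange.
Variables (R S : comNzRingType) (f : {rmorphism R -> S}) (X : gralg R).
Local Notation T := (tensor f X).
Local Notation "x ** s" := (tens f x s) (at level 40).

(** [(x (x) s) (y (x) s') = xy (x) ss'], see [tensor_mul_tens]. *)
Definition tensor_mul (t t' : T) : T :=
  tensor_lift (fun x s =>
    tensor_lift (fun y s' => gralg_mul x y ** (s * s')) t') t.

Let mulDl (y : X) : {morph (gralg_mul (g:=X))^~ y : x x' / x + x'}.
Proof. by move=> x x'; have := gralg_linl y 1 x x'; rewrite !scale1r. Qed.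
Let mulDr (x : X) : {morph gralg_mul x : y y' / y + y'}.
Proof. by move=> y y'; have := gralg_linr x 1 y y'; rewrite !scale1r. Qed.
Let mul0l (y : X) : gralg_mul 0 y = 0.
Proof. by apply: (addIr (gralg_mul 0 y)); rewrite -mulDl !add0r. Qed.
Let mul0r (x : X) : gralg_mul x 0 = 0.
Proof. by apply: (addIr (gralg_mul x 0)); rewrite -mulDr !add0r. Qed.
Let mulZl r (x y : X) : gralg_mul (r *: x) y = r *: gralg_mul x y.
Proof. by have := gralg_linl y r x 0; rewrite mul0l !addr0. Qed.
Let mulZr r (x y : X) : gralg_mul x (r *: y) = r *: gralg_mul x y.
Proof. by have := gralg_linr x r y 0; rewrite mul0r !addr0. Qed.

Let inner (x : X) (s : S) (y : X) (s' : S) : T := gralg_mul x y ** (s * s').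

Let innerDl x s s' : {morph (inner x s)^~ s' : y y' / y + y'}.
Proof. by move=> y y'; rewrite /inner mulDr tensDl. Qed.
Let innerDr x s y : {morph inner x s y : s' s'' / s' + s''}.
Proof. by move=> s' s''; rewrite /inner mulrDr tensDr. Qed.
Let innerZ x s r y s' : inner x s (r *: y) s' = inner x s y (f r * s').
Proof. by rewrite /inner mulZr tensZ mulrCA. Qed.

Let outer (t' : T) (x : X) (s : S) : T := tensor_lift (inner x s) t'.

Let outer_tens x s y s' : outer (y ** s') x s = gralg_mul x y ** (s * s').
Proof. exact: (tensor_lift_tens (innerDl x s) (innerDr x s) (innerZ x s)). Qed.
Let outerD t t' x s : outer (t + t') x s = outer t x s + outer t' x s.
Proof. exact: (tensor_liftD (innerDl x s) (innerDr x s) (innerZ x s)). Qed.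

Let outerDl t' s : {morph (outer t')^~ s : x y / x + y}.
Proof.
move=> x x'; elim/tensor_ind: t' => [y s'|t t' IH IH'].
  by rewrite !outer_tens mulDl tensDl.
by rewrite !outerD IH IH' addrACA.
Qed.
Let outerDr t' x : {morph outer t' x : s s' / s + s'}.
Proof.
move=> s s'; elim/tensor_ind: t' => [y r|t t' IH IH'].
  by rewrite !outer_tens mulrDl tensDr.
by rewrite !outerD IH IH' addrACA.
Qed.
Let outerZ t' r x s : outer t' (r *: x) s = outer t' x (f r * s).
Proof.
elim/tensor_ind: t' => [y s'|t t' IH IH'].
  by rewrite !outer_tens mulZl tensZ mulrA.
by rewrite !outerD IH IH'.
Qed.

Lemma tensor_mul_tens x s y s' :
  tensor_mul (x ** s) (y ** s') = gralg_mul x y ** (s * s').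
Proof.
rewrite -outer_tens.
exact: (tensor_lift_tens (outerDl _) (outerDr _) (outerZ _)).
Qed.

Lemma tensor_mulDl t : {morph tensor_mul^~ t : u v / u + v}.
Proof. exact: (tensor_liftD (outerDl t) (outerDr t) (outerZ t)). Qed.

Lemma tensor_mulDr t : {morph tensor_mul t : u v / u + v}.
Proof.
move=> u v; elim/tensor_ind: t => [x s|t t' IH IH'].
  rewrite ![tensor_mul (x ** s) _](tensor_lift_tens (outerDl _) (outerDr _) (outerZ _)).
  exact: outerD.
by rewrite !tensor_mulDl IH IH' addrACA.
Qed.

Fact tensor_mul_linl t : linear (tensor_mul^~ t).
Proof.
move=> a u v; rewrite tensor_mulDl; congr (_ + _).
elim/tensor_ind: u => [x s|u u' IH IH']; last first.
  by rewrite scalerDr !tensor_mulDl IH IH' scalerDr.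
elim/tensor_ind: t => [y s'|t t' IH IH']; last first.
  by rewrite !tensor_mulDr IH IH' scalerDr.
by rewrite tens_scale !tensor_mul_tens tens_scale mulrA.
Qed.

Fact tensor_mul_linr t : linear (tensor_mul t).
Proof.
move=> a u v; rewrite tensor_mulDr; congr (_ + _).
elim/tensor_ind: u => [x s|u u' IH IH']; last first.
  by rewrite scalerDr !tensor_mulDr IH IH' scalerDr.
elim/tensor_ind: t => [y s'|t t' IH IH']; last first.
  by rewrite !tensor_mulDl IH IH' scalerDr.
by rewrite tens_scale !tensor_mul_tens tens_scale mulrCA.
Qed.

Fact tensor_mulA : associative tensor_mul.
Proof.
move=> t u v; elim/tensor_ind: t => [x r|t t' IH IH']; last first.
  by rewrite !tensor_mulDl IH IH'.
elim/tensor_ind: u => [y s|u u' IH IH']; last first.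
  by rewrite !(tensor_mulDl, tensor_mulDr) IH IH'.
elim/tensor_ind: v => [z q|v v' IH IH']; last first.
  by rewrite !tensor_mulDr IH IH'.
by rewrite !tensor_mul_tens gralg_mulA mulrA.
Qed.

Local Notation td := (tensor_deg (f:=f) (gralg_deg (g:=X))).

Fact tensor_mul_deg i j t u : td i t -> td j u -> td (i + j) (tensor_mul t u).
Proof.
have m0l v : tensor_mul 0 v = 0.
  by apply: (addIr (tensor_mul 0 v)); rewrite -tensor_mulDl !add0r.
have m0r v : tensor_mul v 0 = 0.
  by apply: (addIr (tensor_mul v 0)); rewrite -tensor_mulDr !add0r.
have dD := @tensor_degD _ _ f X (gralg_deg (g:=X)).
move=> [a da ->] [b db ->].
rewrite (big_morph _ (tensor_mulDl _) (m0l _)) big_seq.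
apply: (big_ind (td (i + j))) => [|u1 u2|p /da dp]; [exact: tensor_deg0 | exact: dD |].
rewrite (big_morph _ (tensor_mulDr _) (m0r _)) big_seq.
apply: (big_ind (td (i + j))) => [|u1 u2|q /db dq]; [exact: tensor_deg0 | exact: dD |].
by rewrite tensor_mul_tens; apply: tensor_deg_tens; apply: gralg_mul_deg.
Qed.

Definition base_change : gralg S :=
  GrAlg tensor_mul_linl tensor_mul_linr tensor_mulA
        (tensor_grading f (gralg_degP X)) tensor_mul_deg.

End BaseChange.

Section Deformation.
Variable k : fieldType.

Definition torsion_free (M : lmodType (fps k)) :=
  forall (a : fps k) (x : M), a *: x = 0 -> a = 0 \/ x = 0.

Definition t_divisible (M : lmodType (fps k)) (n : nat) (x : M) :=
  exists y : M, x = fps_t k ^+ n *: y.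

(** Injectivity and surjectivity of the canonical map from [M] to the inverse
    limit of the [M / t^n M]; in particular [M] is [t]-adically separated. *)
Definition t_complete (M : lmodType (fps k)) :=
  (forall x : M, (forall n, t_divisible n x) -> x = 0) /\
  (forall u : nat -> M, (forall n, t_divisible n (u n.+1 - u n)) ->
     exists x : M, forall n, t_divisible n (x - u n)).

Record graded_deformation (B : gralg k) := GradedDeformation {
  gdef_alg :> gralg (fps k);
  gdef_complete : t_complete gdef_alg;
  gdef_torsion_free : torsion_free gdef_alg;
  gdef_map : base_change (@fps_eval0 k) gdef_alg -> B;
  gdef_isom : gralg_isom gdef_map }.

End Deformation.

Section Variety.
Variables (k : fieldType) (V : vectType k) (V_ : int -> {vspace V}).

Definition vs_deg (i : int) : set V := [set v | v \in V_ i].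

(** Linear maps [V (x) V -> V] are curried. *)
Record grAss := GrAss {
  grAss_mul :> 'Hom(V, 'Hom(V, V));
  grAss_mulA : forall x y z,
    grAss_mul x (grAss_mul y z) = grAss_mul (grAss_mul x y) z;
  grAss_deg : forall i j x y, x \in V_ i -> y \in V_ j ->
    grAss_mul x y \in V_ (i + j) }.

Local Notation dimHom := (\dim {: 'Hom(V, 'Hom(V, V))}).

(** Polynomial functions in the structure constants; the choice of the basis
    does not affect which functions are polynomial. *)
Definition grAss_eval (p : {mpoly k[dimHom]}) (A : grAss) : k :=
  p.@[fun i => coord (vbasis {: 'Hom(V, 'Hom(V, V))}) i A].

Definition zariski_closed (Z : set grAss) :=
  exists P : set {mpoly k[dimHom]},
    Z = [set A | forall p, P p -> grAss_eval p A = 0]%classic.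

Definition zariski_closure (O : set grAss) : set grAss :=
  smallest zariski_closed O.

Definition GL0 : set 'End(V) :=
  [set g | lker g == 0%VS /\ forall i, (g @: V_ i <= V_ i)%VS].

Definition transport (g : 'End(V)) (A : 'Hom(V, 'Hom(V, V))) :
    'Hom(V, 'Hom(V, V)) :=
  linfun (fun x => g \o A ((g^-1)%VF x) \o g^-1)%VF.

Definition orbit (A : grAss) : set grAss :=
  [set C | exists2 g, GL0 g & C = transport g A :> 'Hom(V, 'Hom(V, V))].

Definition graded_degeneration (B A : grAss) :=
  (orbit B `<=` zariski_closure (orbit A))%classic.

Hypothesis V_grading : grading vs_deg.
Variable A : grAss.

Fact grAss_linl (y : V) : linear (fun x : V => A x y).
Proof. by move=> a x x'; rewrite linearP add_lfunE scale_lfunE. Qed.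
Fact grAss_linr (x : V) : linear (fun y : V => A x y).
Proof. by move=> a y y'; rewrite linearP. Qed.

Definition grAss_alg : gralg k :=
  @GrAlg k V (fun x y => A x y) vs_deg grAss_linl grAss_linr
    (@grAss_mulA A) V_grading (@grAss_deg A).

End Variety.

Lemma transportE (k : fieldType) (V : vectType k) (g : 'End(V))
    (A : 'Hom(V, 'Hom(V, V))) (x y : V) :
  transport g A x y = g (A ((g^-1)%VF x) ((g^-1)%VF y)).
Proof.
have lin : linear (fun x : V => g \o A ((g^-1)%VF x) \o g^-1)%VF.
  move=> a u v; apply/lfunP => w; rewrite add_lfunE scale_lfunE !comp_lfunE.
  by rewrite !linearP add_lfunE scale_lfunE linearP.
pose h := GRing.isLinear.Build _ _ _ _ _ lin.
pose H : {linear V -> 'End(V)} := HB.pack (fun x : V => g \o A ((g^-1)%VF x) \o g^-1)%VF h.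
by rewrite /transport (lfunE H) /= !comp_lfunE.
Qed.

(* Main.v *)
Require Import Defs.
From HB Require Import structures.
From mathcomp Require Import all_boot all_order all_algebra.
From mathcomp Require Import boolp classical_sets mpoly ring.

(** In a homogeneous basis of [V], a graded algebra structure is a table of
    structure constants, and isomorphisms are invertible matrices which respect
    the degrees. The theorem follows from two equivalences. Call [B] a limit of
    [A] when there are structure constants over the power series with value [B]
    at t = 0 which are isomorphic to those of [A] over the Laurent series.

    _Limits are deformations_ ([deformation_limit]). Given such constants, the
    free module on the basis is a complete and torsion-free algebra which
    reduces to [B]. Conversely, a homogeneous basis of [B] lifts to any graded
    deformation of [B]: the lifts generate because the deformation is separated
    and the power series are complete (the argument of Nakayama's lemma), and
    they are independent because it has no torsion ([lift_hbasis]).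

    _Limits are the points of the closure_. If [B] is a limit, a polynomial
    vanishing on the orbit of [A] vanishes on the orbit over every extension of
    [k], since [k] is infinite; it vanishes on the curve, hence at t = 0
    ([limit_in_closure]). The converse ([in_closure_limit]) is the heart of the
    proof: a point of the closure of the image of a morphism is reached by a
    formal curve. Let [K] be the field of functions on the group and let [f] be
    the generic element of the orbit. As [B] is in the closure, f |-> B defines a
    homomorphism on k[f], and Chevalley's theorem extends it to a place of [K].
    In a suitable chart of the projective space of matrices, all coordinates of
    the generic matrix are finite at this place, so that [B] comes from a point
    of an affine variety in which the invertible matrices form the nonempty open
    set [h != 0]. It remains to find an arc through this point which leaves the
    closed set [h = 0] ([arc_lifting]).

    To find the arc, shrink the variety to a closed irreducible subvariety
    through the point, not contained in [h = 0], and minimal for these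
    properties. By Noether normalization it is finite over an affine space whose
    origin lies below the point. If this space had dimension at least two, a
    hypersurface through the origin could be pulled back to a smaller
    subvariety, by going down ([no_dimension_two]). In dimension one, a place
    centred at the point is discrete, because chains of divisors of the
    parameter have bounded length; expanding functions in powers of a
    uniformizer gives the arc ([place_expansion]). No completion or separability
    enters, so the characteristic of [k] is arbitrary.

    Going down rests on Gauss's lemma for minimal polynomials
    ([integral_minpoly]), obtained here from complete integral closedness, a
    property which passes to polynomial rings by looking at leading
    coefficients. *)

Set Implicit Arguments.
Unset Strict Implicit.
Unset Printing Implicit Defensive.
Import GRing.Theory.
Local Open Scope classical_set_scope.
Local Open Scope ring_scope.

(** * Places of a field with values in an algebraically closed field *)

Section Places.
Variables (K : fieldType) (k : closedFieldType).
Implicit Types (G : set (K * k)) (v : K * k).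

(** A homomorphism from a subring of [K] to [k], given by its graph, a subring
    of [K * k] which [phomF] makes single valued. With graphs, extending a
    homomorphism is an inclusion, and Zorn's lemma applies to unions. *)
Record partial_hom G : Prop := PartialHom {
  phom1 : G 1;
  phomB : forall v w, G v -> G w -> G (v - w);
  phomM : forall v w, G v -> G w -> G (v * w);
  phomF : forall c, G (0, c) -> c = 0 }.

(** The domain of such a graph is a valuation ring, and its maximal ideal
    consists of the elements with value 0. *)
Record is_place G : Prop := IsPlace {
  place_hom :> partial_hom G;
  place_inv : forall x c, G (x, c) -> c != 0 -> G (x^-1, c^-1);
  place_total : forall x, (exists c, G (x, c)) \/ G (x^-1, 0) }.

Section PartialHomTheory.
Variable G : set (K * k).
Hypothesis hG : partial_hom G.

Lemma phom0 : G 0.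
Proof. by rewrite -(subrr 1); apply: phomB => //; apply: phom1. Qed.
Lemma phomN v : G v -> G (- v).
Proof. by move=> Gv; rewrite -sub0r; apply: phomB => //; apply: phom0. Qed.
Lemma phomD v w : G v -> G w -> G (v + w).
Proof. by move=> Gv Gw; rewrite -(opprK w); apply: phomB => //; apply: phomN. Qed.
Lemma phom_sum I (r : seq I) (P : pred I) (F : I -> K * k) :
  (forall i, P i -> G (F i)) -> G (\sum_(i <- r | P i) F i).
Proof. by move=> GF; apply: big_ind => //; [apply: phom0|apply: phomD]. Qed.
Lemma phomX v n : G v -> G (v ^+ n).
Proof.
by move=> Gv; elim: n => [|n IH]; [apply: phom1|rewrite exprS; apply: phomM].
Qed.

Lemma phom_fun x c d : G (x, c) -> G (x, d) -> c = d.
Proof.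
move=> Gc Gd; apply/eqP; rewrite -subr_eq0; apply/eqP; apply: (phomF hG).
have -> : (0, c - d) = (x, c) - (x, d) :> K * k by congr pair; rewrite subrr.
exact: phomB.
Qed.

Definition adjoin v : set (K * k) :=
  [set w | exists2 p : {poly K * k}, forall i, G p`_i & w = p.[v]].

Lemma adjoin_gen v : adjoin v v.
Proof.
exists 'X; last by rewrite hornerX.
move=> i; rewrite coefX; case: (i == 1%N); [exact: phom1|exact: phom0].
Qed.

Lemma sub_adjoin v : G `<=` adjoin v.
Proof.
move=> w Gw; exists w%:P; last by rewrite hornerC.
by move=> i; rewrite coefC; case: eqP => // _; apply: phom0.
Qed.

Lemma adjoin_hom v :
  (forall p : {poly K * k}, (forall i, G p`_i) -> p.[v].1 = 0 -> p.[v].2 = 0) ->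
  partial_hom (adjoin v).
Proof.
move=> F; split.
- by apply: sub_adjoin; apply: phom1.
- move=> _ _ [p Gp ->] [q Gq ->]; exists (p - q); last by rewrite hornerD hornerN.
  by move=> i; rewrite coefB; apply: phomB.
- move=> _ _ [p Gp ->] [q Gq ->]; exists (p * q); last by rewrite hornerM.
  by move=> i; rewrite coefM; apply: phom_sum => j _; apply: phomM.
- by move=> c [p Gp cE]; have := F p Gp; rewrite -cE; apply.
Qed.
End PartialHomTheory.

Section Maximal.
Variable G : set (K * k).
Hypothesis hG : partial_hom G.
Hypothesis maxG : forall G', G `<` G' -> ~ partial_hom G'.

Lemma maximal_adjoin v :
  (forall p : {poly K * k}, (forall i, G p`_i) -> p.[v].1 = 0 -> p.[v].2 = 0) ->
  G v.
Proof.
move=> /(adjoin_hom hG) hv; apply: contrapT => nGv.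
apply: maxG hv; split; first exact: sub_adjoin.
by move=> /(_ v (adjoin_gen hG v)).
Qed.

Lemma horner_fst (p : {poly K * k}) v : p.[v].1 = (map_poly fst p).[v.1].
Proof. by rewrite horner_map. Qed.
Lemma horner_snd (p : {poly K * k}) v : p.[v].2 = (map_poly snd p).[v.2].
Proof. by rewrite horner_map. Qed.

(** A relation satisfied by the inverses becomes a relation over [G] after
    multiplication by a power of [(x, c)]. *)
Lemma maximal_inv x c : G (x, c) -> c != 0 -> G (x^-1, c^-1).
Proof.
move=> Gxc c0; have x0 : x != 0.
  by apply: contra c0 => /eqP x0; move: Gxc; rewrite x0 => /(phomF hG)->.
apply: maximal_adjoin => p Gp p0.
set n := size p.
have : G ((x, c) ^+ n * p.[(x^-1, c^-1)]).
  rewrite horner_coef mulr_sumr; apply: phom_sum => // i _.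
  have -> : (x, c) ^+ n * (p`_i * (x^-1, c^-1) ^+ i) = p`_i * (x, c) ^+ (n - i).
    rewrite mulrCA; congr (_ * _).
    have -> : (x, c) ^+ n = (x, c) ^+ (n - i) * (x, c) ^+ i.
      by rewrite -exprD subnK // ltnW.
    rewrite -mulrA -exprMn.
    have -> : (x, c) * (x^-1, c^-1) = 1.
      by congr pair; rewrite /= mulfV.
    by rewrite expr1n mulr1.
  by apply: phomM => //; apply: phomX.
have XE m : (x, c) ^+ m = (x ^+ m, c ^+ m).
  by elim: m => // m IH; rewrite !exprS IH.
rewrite XE; case: (p.[_]) p0 => [a b] /= ->.
have -> : (x ^+ n, c ^+ n) * (0, b) = (0, c ^+ n * b) by congr pair; rewrite /= mulr0.
by move=> /(phomF hG)/eqP; rewrite mulf_eq0 expf_eq0 (negbTE c0) andbF /= => /eqP.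
Qed.

Hypothesis resG : forall c, exists x, G (x, c).

(** An ideal of [{poly k}], whose common roots are the values that can be given
    to [x]. *)
Definition residue_relations x : set {poly k} := [set q | exists p : {poly K * k},
  [/\ forall i, G p`_i, (map_poly fst p).[x] = 0 & map_poly snd p = q]].

Lemma residue_relationsB x q r : residue_relations x q ->
  residue_relations x r -> residue_relations x (q - r).
Proof.
move=> [p [Gp p0 <-]] [p' [Gp' p0' <-]]; exists (p - p'); split.
- by move=> i; rewrite coefB; apply: phomB.
- by rewrite rmorphB hornerD hornerN p0 p0' subr0.
- by rewrite rmorphB.
Qed.

Lemma residue_relationsM x q r : residue_relations x q ->
  residue_relations x (r * q).
Proof.
move=> [p [Gp p0 <-]].
have [l lP] := choice resG.
pose s : {poly K * k} := \poly_(i < size r) (l r`_i, r`_i).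
exists (s * p); split.
- move=> i; rewrite coefM; apply: phom_sum => // j _; apply: phomM => //.
  by rewrite coef_poly; case: ifP => // _; apply: phom0.
- by rewrite rmorphM hornerM p0 mulr0.
- rewrite rmorphM; congr (_ * _); apply/polyP => i.
  rewrite coef_map coef_poly; case: ltnP => // /leq_sizeP -> //.
Qed.

(** Equivalently, the maximal ideal of the domain of [G] generates the unit
    ideal once [x] is adjoined. *)
Definition unit_relation x n :=
  exists a : nat -> K * k, [/\ forall i, G (a i), (a 0).2 = 1,
    forall i, (0 < i)%N -> (a i).2 = 0 & \sum_(i < n.+1) (a i).1 * x ^+ i = 0].

(** The ideal of residues of relations is principal. A root of its generator is
    a possible value of [x], attained since [G] is maximal; without roots, the
    generator is a unit. *)
Lemma unit_relation_or x : (exists c, G (x, c)) \/ exists n, unit_relation x n.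
Proof.
have [[q [Jq q0]]|nJ] := pselect (exists q, residue_relations x q /\ q != 0); last first.
  left; exists 0; apply: maximal_adjoin => p Gp; rewrite horner_fst horner_snd /=.
  move=> p0; have [->|q0] := eqVneq (map_poly snd p) 0; first by rewrite horner0.
  by case: nJ; exists (map_poly snd p); split => //; exists p.
pose Q n := `[< exists q, [/\ residue_relations x q, q != 0 & size q = n] >].
have exQ : exists n, Q n by exists (size q); apply/asboolP; exists q.
have {q Jq q0 exQ} [_ /asboolP[q [Jq q0 <-]] minq] := ex_minnP exQ.
have divJ r : residue_relations x r -> q %| r.
  move=> Jr; rewrite /dvdp; apply: contraT => rq0.
  have := minq (size (r %% q)); rewrite leqNgt ltn_modp q0 /=; apply.
  apply/asboolP; exists (r %% q); split => //.
  have -> : r %% q = r - (r %/ q) * q by rewrite {2}(divp_eq r q) addrAC subrr add0r.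
  by apply: residue_relationsB => //; apply: residue_relationsM.
have [sq|sq] := eqVneq (size q) 1%N.
  right; move/eqP/size_poly1P: sq => [c c0 qE].
  have : residue_relations x 1.
    have -> : 1 = c^-1%:P * q by rewrite qE -polyCM mulVf.
    exact: residue_relationsM.
  move=> [p [Gp p0 p1]]; exists (size p); exists (fun i => p`_i); split=> //.
  - by rewrite -coef_map p1 coefC.
  - by move=> i; rewrite -coef_map p1 coefC; case: i.
  - rewrite -[RHS]p0 (@horner_coef_wide _ (size p).+1).
      by apply: eq_bigr => i _; rewrite coef_map.
    exact: leq_trans (size_poly _ _) (leqnSn _).
left; have /closed_rootP[al /factor_theorem qal] : size q != 1%N by [].
exists al; apply: maximal_adjoin => p Gp; rewrite horner_fst horner_snd /= => p0.
apply/eqP; have /divJ : residue_relations x (map_poly snd p) by exists p.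
by case: qal => s -> /dvdpP[r ->]; rewrite !hornerM hornerXsubC subrr !mulr0.
Qed.

(** The leading term of the relation for [x] is eliminated with the relation for
    the inverse of [x], read backwards: its constant coefficient has residue 1. *)
Lemma unit_relation_pred x n m : x != 0 -> (m <= n)%N ->
  unit_relation x n.+1 -> unit_relation x^-1 m.+1 -> unit_relation x n.
Proof.
move=> x0 mn [a [Ga a0 ai aE]] [b [Gb b0 bi bE]].
pose b' i := if (n.+1 - i <= m.+1)%N then b (n.+1 - i)%N else 0.
have Gb' i : G (b' i) by rewrite /b'; case: ifP => // _; apply: phom0.
have b'E : \sum_(i < n.+2) (b' i).1 * x ^+ i = 0.
  rewrite (reindex_inj rev_ord_inj) /= -[RHS](mulr0 (x ^+ n.+1)) -[in RHS]bE mulr_sumr.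
  rewrite [RHS](big_ord_widen n.+2 (fun j => x ^+ n.+1 * ((b j).1 * x^-1 ^+ j))) //.
  rewrite [RHS]big_mkcond /=. apply: eq_bigr => i _.
  have iN : (i <= n.+1)%N by rewrite -ltnS.
  rewrite /b' subSS subKn // ltnS; case: ifP => _; last by rewrite mul0r.
  rewrite mulrCA; congr (_ * _).
  have -> : x ^+ n.+1 = x ^+ (n.+1 - i) * x ^+ i by rewrite -exprD subnK.
  by rewrite -mulrA -exprMn mulfV // expr1n mulr1.
pose c i := b 0 * a i - a n.+1 * b' i.
exists c; split.
- by move=> i; apply: phomB => //; apply: phomM.
- by rewrite /= a0 b0 mul1r ai // mul0r subr0.
- by move=> i i0; rewrite /= (ai i) // (ai n.+1) // mulr0 mul0r subr0.
have cE : \sum_(i < n.+2) (c i).1 * x ^+ i = 0.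
  rewrite (eq_bigr (fun i : 'I_n.+2 => (b 0).1 * ((a i).1 * x ^+ i) -
     (a n.+1).1 * ((b' i).1 * x ^+ i))).
    by rewrite sumrB -!mulr_sumr aE b'E !mulr0 subrr.
  by move=> i _; rewrite mulrBl !mulrA.
have b'_last : b' n.+1 = b 0 by rewrite /b' subnn.
by move: cE; rewrite big_ord_recr /= b'_last [(b 0).1 * (a _).1]mulrC subrr mul0r addr0.
Qed.

Lemma unit_relation0 x : ~ unit_relation x 0.
Proof.
move=> [a [Ga a0 _]]; rewrite big_ord1 expr0 mulr1 => a1.
have := @phomF _ hG 1; have := Ga 0%N; rewrite (surjective_pairing (a 0%N)) a1 a0.
by move=> G01 /(_ G01) /eqP; rewrite oner_eq0.
Qed.

Lemma unit_relation_contra x n m : x != 0 ->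
  unit_relation x n -> unit_relation x^-1 m -> False.
Proof.
move: {2}(n + m)%N (leqnn (n + m)) => N.
elim: N x n m => [|N IH] x [|n] [|m] // le x0 rn rm;
  do ?[exact: unit_relation0 rn|exact: unit_relation0 rm].
have [mn|/ltnW nm] := leqP m n.
  have rn' := unit_relation_pred x0 mn rn rm.
  by apply: (IH x n m.+1) => //; move: le; rewrite addSn.
have xV0 : x^-1 != 0 by rewrite invr_eq0.
rewrite -(invrK x) in rn; have rm' := unit_relation_pred xV0 nm rm rn.
by apply: (IH x n.+1 m) => //; [move: le; rewrite addnS|rewrite -(invrK x)].
Qed.

(** Unit relations cannot exist for both [x] and its inverse, as the longer one
    could always be shortened. *)
Lemma maximal_place : is_place G.
Proof.
split=> [//||x]; first exact: maximal_inv.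
have [->|x0] := eqVneq x 0; first by left; exists 0; apply: phom0.
have [|[n rn]] := unit_relation_or x; first by left.
have [[c Gc]|[m rm]] := unit_relation_or x^-1; last first.
  by have := unit_relation_contra x0 rn rm.
have [c0|c0] := eqVneq c 0; first by right; rewrite -c0.
by left; exists c^-1; rewrite -(invrK x); apply: maximal_inv.
Qed.
End Maximal.

(** Chevalley's extension theorem. The values stay in [k] because it is
    algebraically closed. *)
Lemma extend_to_place G0 : partial_hom G0 -> (forall c, exists x, G0 (x, c)) ->
  exists2 G, is_place G & G0 `<=` G.
Proof.
move=> h0 res0.
have [|G [hG maxG]] := @Zorn_bigcup _ [set G | partial_hom (G0 `|` G)].
  move=> F FP totF; have [[G1 FG1]|nF] := pselect (exists G, F G); last first.
    rewrite /=; suff -> : G0 `|` \bigcup_(X in F) X = G0 by [].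
    by apply/seteqP; split=> v; [move=> [] // [X FX _]; case: nF; exists X|left].
  have common v w : (G0 `|` \bigcup_(X in F) X) v -> (G0 `|` \bigcup_(X in F) X) w ->
     exists X, [/\ F X, (G0 `|` X) v & (G0 `|` X) w].
    move=> [v0|[X FX Xv]] [w0|[Y FY Yw]].
    - by exists G1; split=> //; left.
    - by exists Y; split=> //; [left|right].
    - by exists X; split=> //; [right|left].
    - case: (totF X Y FX FY) => [XY|YX].
        by exists Y; split=> //; right; [apply: XY|].
      by exists X; split=> //; right; [|apply: YX].
  have sub X : F X -> G0 `|` X `<=` G0 `|` \bigcup_(X in F) X.
    by move=> FX v [|Xv]; [left|right; exists X].
  split.
  - by left; apply: phom1.
  - move=> v w /common C /C [X [FX Xv Xw]]; apply: (sub X) => //.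
    exact: (phomB (FP X FX)).
  - move=> v w /common C /C [X [FX Xv Xw]]; apply: (sub X) => //.
    exact: (phomM (FP X FX)).
  - move=> c Gc; have [X [FX Xc _]] := common _ _ Gc Gc.
    exact: (phomF (FP X FX)).
exists (G0 `|` G); last by move=> v; left.
apply: maximal_place => // [H [GH nHG] hH|c]; last first.
  by have [x Gx] := res0 c; exists x; left.
apply: (maxG H) => /=.
  by split=> [v Gv|HG]; [apply: GH; right|apply: nHG => v /HG; right].
suff -> : G0 `|` H = H by [].
by apply/seteqP; split=> v; [move=> [G0v|//]; apply: GH; left|right].
Qed.
End Places.

(** * Power series expansion at a place of a field of transcendence degree one *)

Section DiscretePlace.
Variables (E : fieldType) (k : closedFieldType) (iota : {rmorphism k -> E}).
Variable G : set (E * k).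
Hypothesis hG : is_place G.
Hypothesis G_iota : forall c, G (iota c, c).
Let pG : partial_hom G := hG.

Definition val_ring (x : E) := exists c, G (x, c).
Definition val_ideal (x : E) := G (x, 0).

Lemma val_ideal_ring x : val_ideal x -> val_ring x. Proof. by exists 0. Qed.
Lemma val_ring_iota c : val_ring (iota c). Proof. by exists c. Qed.
Lemma val_ringB x y : val_ring x -> val_ring y -> val_ring (x - y).
Proof. by move=> [c Gc] [d Gd]; exists (c - d); apply: (phomB pG Gc Gd). Qed.
Lemma val_ringM x y : val_ring x -> val_ring y -> val_ring (x * y).
Proof. by move=> [c Gc] [d Gd]; exists (c * d); apply: (phomM pG Gc Gd). Qed.
Lemma val_ring1 : val_ring 1. Proof. by exists 1; apply: (phom1 pG). Qed.
Lemma val_ring0 : val_ring 0. Proof. by exists 0; apply: (phom0 pG). Qed.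
Lemma val_ringN x : val_ring x -> val_ring (- x).
Proof. by move=> Ox; rewrite -sub0r; apply: val_ringB => //; apply: val_ring0. Qed.
Lemma val_ringD x y : val_ring x -> val_ring y -> val_ring (x + y).
Proof. by move=> Ox Oy; rewrite -(opprK y); apply: val_ringB => //; apply: val_ringN. Qed.
Lemma val_ringX x n : val_ring x -> val_ring (x ^+ n).
Proof. by move=> Ox; elim: n => [|n IH]; [apply: val_ring1|rewrite exprS; apply: val_ringM]. Qed.
Lemma val_idealM x y : val_ideal x -> val_ring y -> val_ideal (x * y).
Proof.
move=> Mx [d Gd]; have := phomM pG Mx Gd.
by have -> : (x, 0) * (y, d) = (x * y, 0) by congr pair; rewrite /= mul0r.
Qed.
Lemma val_idealMr x y : val_ideal x -> val_ring y -> val_ideal (y * x).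
Proof. by rewrite mulrC; apply: val_idealM. Qed.
Lemma val_idealD x y : val_ideal x -> val_ideal y -> val_ideal (x + y).
Proof. by move=> Mx My; have := phomD pG Mx My; congr (G (_, _)); apply: addr0. Qed.
Lemma val_ring_sum I (r : seq I) (P : pred I) (F : I -> E) :
  (forall i, P i -> val_ring (F i)) -> val_ring (\sum_(i <- r | P i) F i).
Proof. by move=> OF; apply: big_ind => //; [apply: val_ring0|apply: val_ringD]. Qed.
Lemma val_ring_horner (p : {poly k}) x : val_ring x -> val_ring (map_poly iota p).[x].
Proof.
move=> Ox; rewrite horner_coef; apply: val_ring_sum => i _.
by rewrite coef_map; apply: val_ringM; [apply: val_ring_iota|apply: val_ringX].
Qed.

Lemma val_ideal_neq1 : ~ val_ideal 1.
Proof. by move=> /(phom_fun pG (phom1 pG))/eqP; rewrite oner_eq0. Qed.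

Lemma val_ring_unit x : val_ring x -> ~ val_ideal x -> val_ring x^-1.
Proof.
move=> [c Gc] nMx; exists c^-1; apply: (place_inv hG) => //.
by apply/eqP => c0; apply: nMx; rewrite /val_ideal -c0.
Qed.

Lemma val_ideal_iota c : val_ideal (iota c) -> c = 0.
Proof. by move/(phom_fun pG (G_iota c)). Qed.

Lemma val_ideal_not_unit x y : val_ideal x -> val_ring y -> x * y != 1.
Proof. by move=> Mx Oy; apply/eqP => xy; apply: val_ideal_neq1; rewrite -xy; apply: val_idealM. Qed.

Lemma val_ring_div_total x y : x != 0 -> val_ring (y / x) \/ val_ideal (x / y).
Proof.
move=> x0; have [[c Gc]|] := place_total hG (y / x); first by left; exists c.
by rewrite invf_div; right.
Qed.

Variables (z : E) (n : nat).
Hypothesis Mz : val_ideal z.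
Hypothesis z_trans : forall p : {poly k}, (map_poly iota p).[z] = 0 -> p = 0.
(* [E] has degree at most [n] over [k(z)]; denominators are cleared. *)
Hypothesis dim_le : forall a : 'I_n.+1 -> E, exists c : 'I_n.+1 -> {poly k},
  (exists i, c i != 0) /\ \sum_i (map_poly iota (c i)).[z] * a i = 0.

Lemma z_neq0 : z != 0.
Proof.
apply/eqP => z0; have := @z_trans 'X; rewrite map_polyX hornerX => /(_ z0)/eqP.
by rewrite polyX_eq0.
Qed.

(** Dividing a relation over [k[z]] by the largest possible power of [z] leaves a
    nonzero constant term; so the valuation ring modulo [z] has dimension at
    most [n] over [k]. *)
Lemma residue_dependent (a : 'I_n.+1 -> E) :
  exists c : 'I_n.+1 -> k, (exists i, c i != 0) /\
    ((forall i, val_ring (a i)) -> exists2 y, val_ring y & \sum_i iota (c i) * a i = z * y).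
Proof.
have [c [[i0 ci0] cE]] := dim_le a.
suff [d [[i1 di1] dE]] : exists d : 'I_n.+1 -> {poly k},
    (exists i, (d i)`_0 != 0) /\ \sum_i (map_poly iota (d i)).[z] * a i = 0.
  exists (fun i => (d i)`_0); split; first by exists i1.
  move=> Oa; exists (- \sum_i (map_poly iota (drop_poly 1 (d i))).[z] * a i).
    by apply: val_ringN; apply: val_ring_sum => i _; apply: val_ringM => //;
       apply: val_ring_horner; apply: val_ideal_ring.
  apply/eqP; rewrite mulrN -addr_eq0; apply/eqP; rewrite -[RHS]dE.
  rewrite mulr_sumr -big_split /=; apply: eq_bigr => i _; rewrite mulrA -mulrDl; congr (_ * _).
  rewrite -{3}(poly_take_drop 1 (d i)) rmorphD rmorphM /= hornerD hornerM.
  rewrite expr1 map_polyX hornerX mulrC; congr (_ + _).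
  have -> : take_poly 1 (d i) = ((d i)`_0)%:P.
    by apply/polyP => j; rewrite coef_take_poly coefC; case: j.
  by rewrite map_polyC hornerC.
move: {2}(size (c i0)) (leqnn (size (c i0))) => m.
elim: m c ci0 cE => [|m IH] c ci0 cE; first by rewrite leqn0 size_poly_eq0 (negbTE ci0).
have [[i ci]|nex] := pselect (exists i, (c i)`_0 != 0).
  by move=> _; exists c; split=> //; exists i.
have cX i : c i = drop_poly 1 (c i) * 'X.
  rewrite -{1}(poly_take_drop 1 (c i)) expr1; suff -> : take_poly 1 (c i) = 0 by rewrite add0r.
  apply/polyP => j; rewrite coef_take_poly coef0; case: j => //=.
  by apply/eqP; apply: contrapT => /negP ci; apply: nex; exists i.
move=> sc; apply: (IH (fun i => drop_poly 1 (c i))).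
- by apply: contra ci0 => /eqP d0; rewrite cX d0 mul0r.
- apply: (mulfI z_neq0); rewrite mulr0 -[RHS]cE mulr_sumr; apply: eq_bigr => i _.
  by rewrite [in RHS]cX rmorphM /= map_polyX hornerM hornerX mulrA [z * _]mulrC.
- by rewrite size_drop_poly leq_subLR.
Qed.

(** The first [n.+1] members of such a chain of divisors of [z] would be linearly
    independent modulo [z]: in a relation, the term of lowest index is a unit
    times its [a i], and dominates the others. *)
Lemma divisor_chain (a : nat -> E) : (forall i, a i != 0) -> a 0%N = 1 ->
  (forall i, (i <= n)%N -> val_ideal (a i.+1 / a i)) -> val_ring (z / a n.+1) -> False.
Proof.
move=> a0 aE am az.
have aO i j : (i < j)%N -> (j <= n.+1)%N -> val_ideal (a j / a i).
  move=> ij jn; elim: j ij jn => // j IH; rewrite ltnS leq_eqVlt => /orP[/eqP->|ij] jn.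
    exact: am.
  have -> : a j.+1 / a i = (a j.+1 / a j) * (a j / a i) by rewrite mulrA divfK.
  by apply: val_idealM; [apply: am|apply: val_ideal_ring; apply: IH => //; apply: ltnW].
have [c [[i0 ci0] cE]] := residue_dependent (fun i : 'I_n.+1 => a i).
have Oa (i : 'I_n.+1) : val_ring (a i).
  case: i => -[|i] ilt; first by rewrite aE; apply: val_ring1.
  by have := aO 0%N i.+1; rewrite aE divr1 => /(_ isT (ltnW ilt))/val_ideal_ring.
have {cE} [y Oy yE] := cE Oa.
case: (@arg_minnP _ i0 (fun i => c i != 0) (fun i => nat_of_ord i) ci0) => i1 ci1 imin.
have E1 : iota (c i1) = z / a i1 * y - \sum_(i | i != i1) iota (c i) * (a i / a i1).
  have : \sum_i iota (c i) * (a i / a i1) = z / a i1 * y.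
    by rewrite mulrAC -yE mulr_suml; apply: eq_bigr => i _; rewrite mulrA.
  by rewrite (bigD1 i1) //= divff // mulr1 => <-; rewrite addrK.
move/eqP: ci1; apply; apply: val_ideal_iota; rewrite E1 -mulN1r.
have i1n : (i1 < n.+1)%N by [].
apply: val_idealD.
  apply: val_idealM => //; have -> : z / a i1 = (z / a n.+1) * (a n.+1 / a i1).
    by rewrite mulrA divfK.
  by apply: val_idealMr => //; apply: aO.
apply: val_idealMr; last by apply: val_ringN; apply: val_ring1.
apply: (big_ind val_ideal) => [|x1 x2|i ii1]; [exact: (phom0 pG)|exact: val_idealD|].
have [->|ci] := eqVneq (c i) 0; first by rewrite rmorph0 mul0r; apply: (phom0 pG).
apply: val_idealMr; last exact: val_ring_iota.
apply: aO; last exact: ltnW.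
by rewrite ltn_neqAle imin // andbT eq_sym.
Qed.

(** If every nonzero element of the ideal were a proper multiple of another one,
    iterating from [z] would give an arbitrarily long chain of divisors. *)
Lemma uniformizer : exists2 s, val_ideal s /\ s != 0 & forall x, val_ideal x -> val_ring (x / s).
Proof.
apply: contrapT => nex.
have step (s : E) : exists s', val_ideal s -> s != 0 -> [/\ val_ideal s', s' != 0 & val_ideal (s / s')].
  have [[Ms s0]|ns] := pselect (val_ideal s /\ s != 0); last first.
    by exists s => Ms s0; case: ns.
  apply: contrapT => nex'; apply: nex; exists s => // x Mx.
  apply: contrapT => nOx.
  have [|Ms'] := val_ring_div_total x s0; first by [].
  case: nex'; exists x => _ _; split=> //.
  by apply/eqP => x0; apply: nOx; rewrite x0 mul0r; apply: val_ring0.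
have [f fP] := choice step.
pose s i := iter i f z.
have sP i : val_ideal (s i) /\ s i != 0.
  elim: i => [|i [Ms s0]]; first by split=> //; apply: z_neq0.
  by have [] := fP (s i) Ms s0.
apply: (@divisor_chain (fun j => if j is j'.+1 then s (n - j')%N else 1)) => //=.
- by case=> [|i]; [apply: oner_neq0|case: (sP (n - i)%N)].
- case=> [_|i ilt]; first by rewrite divr1 subn0; case: (sP n).
  rewrite subnS; case ni: (n - i)%N => [|j]; first by move: ilt; rewrite -subn_gt0 ni.
  by have [Ms s0] := sP j; have [] := fP (s j) Ms s0.
- by rewrite subnn divff ?z_neq0 //; apply: val_ring1.
Qed.

(** The powers of [s] which divide [z] are bounded by [divisor_chain]. In general
    [x] divides a nonzero polynomial in [z], the product of a power of [z] and a
    unit. *)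
Lemma nonzero_not_divisible s x : val_ideal s -> s != 0 -> val_ring x -> x != 0 ->
  exists m, ~ val_ring (x / s ^+ m).
Proof.
move=> Ms s0 Ox x0.
have [m nOz] : exists m, ~ val_ring (z / s ^+ m).
  exists n.+1 => Oz; apply: (@divisor_chain (fun i => s ^+ i)) => //.
  - by move=> i; apply: expf_neq0.
  - by move=> i _; rewrite exprS mulfK // expf_neq0.
have [p [p0 [y Oy pE]]] : exists p : {poly k}, p != 0 /\
    exists2 y, val_ring y & (map_poly iota p).[z] = x * y.
  have [c [[i0 ci0] cE]] := dim_le (fun i : 'I_n.+1 => x ^+ i).
  case: (@arg_minnP _ i0 (fun i => c i != 0) (fun i => nat_of_ord i) ci0) => i1 ci1 imin.
  exists (c i1); split=> //.
  exists (- \sum_(i | i != i1) (map_poly iota (c i)).[z] * x ^+ (i - i1.+1)).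
    apply: val_ringN; apply: val_ring_sum => i _.
    by apply: val_ringM; [apply: val_ring_horner; apply: val_ideal_ring|apply: val_ringX].
  apply: (mulIf (expf_neq0 i1 x0)); apply/eqP.
  rewrite mulrN mulNr -addr_eq0 mulr_sumr mulr_suml; apply/eqP; rewrite -[RHS]cE.
  rewrite [RHS](bigD1 i1) //=; congr (_ + _); apply: eq_bigr => i ii1.
  have [->|ci] := eqVneq (c i) 0; first by rewrite rmorph0 horner0 !(mul0r, mulr0).
  have -> : x ^+ i = x * x ^+ (i - i1.+1) * x ^+ i1.
    rewrite -exprS -exprD; congr (_ ^+ _); rewrite addSn -addnS subnK //.
    by rewrite ltn_neqAle imin // andbT eq_sym.
  by rewrite mulrCA !mulrA.
have [j [q [qz pqE]]] : exists j, exists q : {poly k}, q`_0 != 0 /\ p = q * 'X^j.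
  have := @multiplicity_XsubC _ p 0; rewrite p0 => -[j [q /= q0 pqE]].
  exists j, q; split; last by move: pqE; rewrite subr0.
  by move: q0; rewrite /root horner_coef0.
exists (m * j.+1)%N => Ox'.
have qu : val_ring (map_poly iota q).[z]^-1.
  apply: val_ring_unit => [|Mq]; first by apply: val_ring_horner; apply: val_ideal_ring.
  move/eqP: qz; apply; apply: val_ideal_iota.
  have -> : iota q`_0 = (map_poly iota q).[z] - z * (map_poly iota (drop_poly 1 q)).[z].
    rewrite -{2}(poly_take_drop 1 q) rmorphD rmorphM /= expr1 map_polyX.
    rewrite hornerD hornerM hornerX mulrC addrK.
    have -> : take_poly 1 q = (q`_0)%:P.
      by apply/polyP => i; rewrite coef_take_poly coefC; case: i.
    by rewrite map_polyC hornerC.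
  apply: val_idealD => //; rewrite -mulN1r mulrCA; apply: val_idealM => //.
  apply: val_ringM; first by apply: val_ringN; apply: val_ring1.
  by apply: val_ring_horner; apply: val_ideal_ring.
have Oz : val_ring (z ^+ j / s ^+ (m * j.+1)).
  have -> : z ^+ j = x * (y / (map_poly iota q).[z]).
    rewrite mulrA -pE pqE rmorphM /= map_polyXn hornerM hornerXn mulrAC divff ?mul1r //.
    by apply: contra qz => /eqP /z_trans->; rewrite coef0.
  by rewrite mulrAC; apply: val_ringM => //; apply: val_ringM.
have Msz : val_ideal (s ^+ m / z).
  by have [/nOz|//] := val_ring_div_total z (expf_neq0 m s0).
have := @val_ideal_not_unit (z * (s ^+ m / z) ^+ j.+1) _ _ Oz.
have sm0 : s ^+ (m * j.+1) != 0 by apply: expf_neq0.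
have -> : z * (s ^+ m / z) ^+ j.+1 * (z ^+ j / s ^+ (m * j.+1)) = 1.
  rewrite expr_div_n -exprM [z ^+ j.+1]exprS; have z0 := z_neq0.
  by field; rewrite z0 sm0 expf_neq0.
by rewrite eqxx => /(_ _)/negP; apply => //; apply: val_idealM => //; apply: val_ringX; apply: val_ideal_ring.
Qed.

Definition residue (x : E) : k := if pselect (val_ring x) is left Ox then projT1 (cid Ox) else 0.
Lemma residueP x : val_ring x -> G (x, residue x).
Proof. by move=> Ox; rewrite /residue; case: pselect => // Ox'; case: (cid Ox'). Qed.
Lemma residueE x c : G (x, c) -> residue x = c.
Proof. by move=> Gx; apply: (phom_fun pG (residueP _) Gx); exists c. Qed.

Variable s : E.
Hypotheses (Ms : val_ideal s) (s0 : s != 0).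
Hypothesis s_unif : forall x, val_ideal x -> val_ring (x / s).

Definition expansion_tail x := (x - iota (residue x)) / s.
Definition expansion x : fps k := Fps (fun m => residue (iter m expansion_tail x)).

Definition fps_trunc m (a : fps k) : {poly k} := \poly_(i < m) fps_coef a i.
Definition eval_at_s (p : {poly k}) : E := (map_poly iota p).[s].

Lemma val_ring_shift x : val_ring x -> val_ring (expansion_tail x).
Proof.
move=> Ox; apply: s_unif; have := phomB pG (residueP Ox) (G_iota (residue x)).
by congr (G (_, _)); apply: subrr.
Qed.

Lemma expansionP x m : val_ring x -> exists2 y, val_ring y & x = eval_at_s (fps_trunc m (expansion x)) + s ^+ m * y.
Proof.
move=> Ox; exists (iter m expansion_tail x); first by elim: m => //= m IH; apply: val_ring_shift.
elim: m => [|m {1}->]; first by rewrite /eval_at_s /fps_trunc poly_def big_ord0 rmorph0 horner0 add0r mul1r.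
rewrite /eval_at_s /fps_trunc !poly_def big_ord_recr /= rmorphD /= hornerD -addrA; congr (_ + _).
rewrite map_polyZ map_polyXn hornerZ hornerXn exprSr -mulrA.
set w := iter m expansion_tail x; have -> : s * expansion_tail w = w - iota (residue w) by rewrite mulrC divfK.
by ring.
Qed.

(** Reduces the compatibility of [expansion] with each operation to congruences
    modulo the powers of [s]. *)
Lemma expansion_unique x (a : fps k) :
  (forall m, exists2 y, val_ring y & x = eval_at_s (fps_trunc m a) + s ^+ m * y) -> expansion x = a.
Proof.
move=> ax; have Ox : val_ring x.
  have [y Oy ->] := ax 0%N; rewrite /eval_at_s /fps_trunc poly_def big_ord0 rmorph0 horner0 add0r mul1r.
  exact: Oy.
apply: fpsP => m; elim/ltn_ind: m => m IH.
have [y Oy xy] := expansionP m.+1 Ox; have [w Ow xw] := ax m.+1.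
have T (b : fps k) : eval_at_s (fps_trunc m.+1 b) = eval_at_s (fps_trunc m b) + iota (fps_coef b m) * s ^+ m.
  rewrite /eval_at_s /fps_trunc !poly_def big_ord_recr /= rmorphD /= hornerD; congr (_ + _).
  by rewrite map_polyZ map_polyXn hornerZ hornerXn.
have E0 : eval_at_s (fps_trunc m (expansion x)) = eval_at_s (fps_trunc m a).
  by congr eval_at_s; apply/polyP => i; rewrite !coef_poly; case: ltnP => // /IH.
move: xw; rewrite {1}xy !T E0 -!addrA => /addrI; rewrite exprSr -!mulrA ![iota _ * _]mulrC.
rewrite -!mulrDr => /(mulfI (expf_neq0 m s0)) e.
apply/eqP; rewrite -subr_eq0; apply/eqP; apply: val_ideal_iota.
rewrite [iota _](_ : _ = s * (w - y)).
  by apply: val_idealM => //; apply: val_ringB.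
rewrite rmorphB -[X in X - _](addrK (s * y)) [X in X - _ - _]e.
by rewrite mulrBr addrAC [iota _ + _]addrC addrK.
Qed.

Lemma expansion_iota c : expansion (iota c) = fps_const c.
Proof.
apply: expansion_unique => -[|m].
  exists (iota c); first exact: val_ring_iota.
  by rewrite /eval_at_s /fps_trunc poly_def big_ord0 rmorph0 horner0 add0r mul1r.
exists 0; first exact: val_ring0.
have -> : fps_trunc m.+1 (fps_const c) = c%:P.
  by apply/polyP => i; rewrite coef_poly coefC /=; case: i => //= i; case: ifP.
by rewrite mulr0 addr0 /eval_at_s map_polyC hornerC.
Qed.

Lemma expansionB x y : val_ring x -> val_ring y -> expansion (x - y) = expansion x - expansion y.
Proof.
move=> Ox Oy; apply: expansion_unique => m.
have [x' Ox' {1}->] := expansionP m Ox; have [y' Oy' {1}->] := expansionP m Oy.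
exists (x' - y'); first exact: val_ringB.
have -> : fps_trunc m (expansion x - expansion y) = fps_trunc m (expansion x) - fps_trunc m (expansion y).
  by apply/polyP => i; rewrite coefB !coef_poly /=; case: ifP => // _; rewrite subr0.
by rewrite /eval_at_s rmorphB hornerD hornerN mulrBr opprD addrACA.
Qed.

Lemma expansionM x y : val_ring x -> val_ring y -> expansion (x * y) = expansion x * expansion y.
Proof.
move=> Ox Oy; apply: expansion_unique => m.
have [x' Ox' xE] := expansionP m Ox; have [y' Oy' yE] := expansionP m Oy.
set a := fps_trunc m (expansion x) in xE; set b := fps_trunc m (expansion y) in yE.
have abE : a * b = fps_trunc m (expansion x * expansion y) + drop_poly m (a * b) * 'X^m.
  rewrite -{1}(poly_take_drop m (a * b)); congr (_ + _).
  apply/polyP => i; rewrite coef_take_poly coef_poly; case: ltnP => // im.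
  rewrite coefM /=; apply: eq_bigr => j _; rewrite !coef_poly.
  have ji : (j <= i)%N by rewrite -ltnS.
  by rewrite (leq_ltn_trans ji im) (leq_ltn_trans (leq_subr _ _) im).
exists (eval_at_s (drop_poly m (a * b)) + (eval_at_s a * y' + eval_at_s b * x' + s ^+ m * (x' * y'))).
  have Oe p : val_ring (eval_at_s p) by apply: val_ring_horner; apply: val_ideal_ring.
  have Osm : val_ring (s ^+ m) by apply: val_ringX; apply: val_ideal_ring.
  by do ![apply: val_ringD|apply: val_ringM].
rewrite {1}xE {1}yE; have : eval_at_s a * eval_at_s b = eval_at_s (fps_trunc m (expansion x * expansion y)) + eval_at_s (drop_poly m (a * b)) * s ^+ m.
  by rewrite /eval_at_s -hornerM -rmorphM {1}abE rmorphD rmorphM /= map_polyXn hornerD hornerM hornerXn.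
by move=> e; rewrite mulrDl !mulrDr e; ring.
Qed.

Lemma expansion_eq0 x : val_ring x -> expansion x = 0 -> x = 0.
Proof.
move=> Ox x0; apply: contrapT => /eqP xn0.
have [m] := nonzero_not_divisible Ms s0 Ox xn0; apply.
have [y Oy ->] := expansionP m Ox; rewrite x0.
have -> : fps_trunc m 0 = 0 by apply/polyP => i; rewrite coef_poly coef0 if_same.
by rewrite /eval_at_s rmorph0 horner0 add0r mulrC mulKf // expf_neq0.
Qed.

End DiscretePlace.

(** A place above [z = 0] of a field of finite degree over [k(z)] is discrete with
    residue field [k], and then elements of the valuation ring have unique
    expansions in powers of a uniformizer. *)
Lemma place_expansion (E : fieldType) (k : closedFieldType) (iota : {rmorphism k -> E})
  (G : set (E * k)) (z : E) (n : nat) :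
  is_place G -> (forall c, G (iota c, c)) -> G (z, 0) ->
  (forall p : {poly k}, (map_poly iota p).[z] = 0 -> p = 0) ->
  (forall a : 'I_n.+1 -> E, exists c : 'I_n.+1 -> {poly k},
    (exists i, c i != 0) /\ \sum_i (map_poly iota (c i)).[z] * a i = 0) ->
  exists th : E -> fps k,
  [/\ forall c, th (iota c) = fps_const c,
      forall x y c d, G (x, c) -> G (y, d) -> th (x - y) = th x - th y,
      forall x y c d, G (x, c) -> G (y, d) -> th (x * y) = th x * th y,
      forall x c, G (x, c) -> fps_eval0 (th x) = c
    & forall x c, G (x, c) -> th x = 0 -> x = 0].
Proof.
move=> hG Gi Gz ztr dim; have [s [Ms s0] su] := uniformizer hG Gi Gz ztr dim.
exists (expansion iota G s); split.
- exact: expansion_iota.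
- by move=> x y c d Gx Gy; apply: expansionB => //; [exists c|exists d].
- by move=> x y c d Gx Gy; apply: expansionM => //; [exists c|exists d].
- by move=> x c Gx; apply: residueE.
- by move=> x c Gx; apply: (expansion_eq0 hG Gi Gz ztr dim Ms s0 su); exists c.
Qed.

(** * Ideals maximal among those avoiding a multiplicative set *)

Lemma fraction_repr (R : idomainType) (x : {fraction R}) :
  exists a b : R, b != 0 /\ x = tofrac a / tofrac b.
Proof.
elim/quotW: x => r; exists (frac r).1, (frac r).2.
have d0 : (frac r).2 != 0 by apply: denom_ratioP.
split=> //; have fd0 : tofrac (frac r).2 != 0 :> {fraction R} by rewrite tofrac_eq0.
apply: (mulIf fd0); rewrite divfK //.
rewrite !piE; apply/eqmodP => /=.
rewrite FracField.equivfE /FracField.mulf /= !numden_Ratio ?mulf_neq0 ?oner_eq0 //.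
by rewrite !mulr1 mulrC.
Qed.

Section Ideals.
Variable U : comNzRingType.
Implicit Types (I T : set U).

Record is_ideal I : Prop := IsIdeal {
  ideal0 : I 0;
  idealB : forall u v, I u -> I v -> I (u - v);
  idealMl : forall u v, I v -> I (u * v) }.

Lemma idealD I u v : is_ideal I -> I u -> I v -> I (u + v).
Proof.
move=> hI Iu Iv; rewrite -(opprK v); apply: (idealB hI) => //.
by rewrite -sub0r; apply: (idealB hI) => //; apply: ideal0.
Qed.

Lemma maximal_ideal_avoiding I T : is_ideal I -> T 1 ->
  (forall s t, T s -> T t -> T (s * t)) -> (forall t, T t -> ~ I t) ->
  exists Q, [/\ is_ideal Q, I `<=` Q, forall t, T t -> ~ Q t
              & forall u, ~ Q u -> exists v w, Q w /\ T (u * v + w)].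
Proof.
move=> hI T1 TM TI.
have [|Q [[hQ TQ] maxQ]] :=
    @Zorn_bigcup _ [set J | is_ideal (I `|` J) /\ forall t, T t -> ~ (I `|` J) t].
  move=> F FP totF; have [[G1 FG1]|nF] := pselect (exists G, F G); last first.
    have E0 : I `|` \bigcup_(X in F) X = I.
      by apply/seteqP; split=> v; [move=> [] // [X FX _]; case: nF; exists X|left].
    by hnf; rewrite E0.
  have common v w : (I `|` \bigcup_(X in F) X) v -> (I `|` \bigcup_(X in F) X) w ->
     exists X, [/\ F X, (I `|` X) v & (I `|` X) w].
    move=> [v0|[X FX Xv]] [w0|[Y FY Yw]].
    - by exists G1; split=> //; left.
    - by exists Y; split=> //; [left|right].
    - by exists X; split=> //; [right|left].
    - case: (totF X Y FX FY) => [XY|YX].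
        by exists Y; split=> //; right; [apply: XY|].
      by exists X; split=> //; right; [|apply: YX].
  have sub X : F X -> I `|` X `<=` I `|` \bigcup_(X in F) X.
    by move=> FX v [|Xv]; [left|right; exists X].
  split; first split.
  - by left; apply: ideal0.
  - move=> v w /common C /C [X [FX Xv Xw]]; apply: (sub X) => //.
    exact: (idealB (FP X FX).1).
  - move=> v w Gw; have [X [FX Xw _]] := common _ _ Gw Gw; apply: (sub X) => //.
    exact: (idealMl (FP X FX).1).
  - move=> t Tt Gt; have [X [FX Xt _]] := common _ _ Gt Gt.
    exact: ((FP X FX).2 t Tt).
exists (I `|` Q); split=> // u nQu.
pose J : set U := [set x | exists v w, (I `|` Q) w /\ x = u * v + w].
have QJ : I `|` Q `<=` J by move=> w Qw; exists 0, w; rewrite mulr0 add0r.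
have hJ : is_ideal J.
  split.
  - by exists 0, 0; rewrite mulr0 addr0; split=> //; apply: ideal0.
  - move=> _ _ [v [w [Qw ->]]] [v' [w' [Qw' ->]]]; exists (v - v'), (w - w').
    by split; [apply: idealB|ring].
  - move=> a _ [v [w [Qw ->]]]; exists (a * v), (a * w).
    by split; [apply: idealMl|ring].
apply: contrapT => nJ.
apply: (maxQ J).
  split=> [v Qv|JQ]; first by apply: QJ; right.
  by apply: nQu; right; apply: JQ; exists 1, 0; rewrite mulr1 addr0; split=> //; apply: ideal0.
have IJ : I `|` J = J.
  by apply/seteqP; split=> v; [move=> [Iv|//]; apply: QJ; left|right].
by hnf; rewrite IJ; split=> // t Tt [v [w [Qw tE]]]; apply: nJ; exists v, w; rewrite -tE.
Qed.

(** If [u] and [v] are not in [Q], multiples of them lie in [T] modulo [Q], and so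
    does a multiple of their product. *)
Lemma avoiding_prime T Q : is_ideal Q -> (forall s t, T s -> T t -> T (s * t)) ->
  (forall t, T t -> ~ Q t) ->
  (forall u, ~ Q u -> exists v w, Q w /\ T (u * v + w)) ->
  forall u v, Q (u * v) -> Q u \/ Q v.
Proof.
move=> hQ TM TQ maxQ u v Quv; apply: contrapT => /not_orP[/maxQ + /maxQ].
move=> [a [w [Qw Ta]]] [b [w' [Qw' Tb]]]; apply: TQ (TM _ _ Ta Tb) _.
have -> : (u * a + w) * (v * b + w') = a * b * (u * v) + (v * b + w') * w + u * a * w'.
  by ring.
by do ![apply: idealD => //]; apply: idealMl.
Qed.

Section PrimeQuotient.
Local Open Scope quotient_scope.
Variable Q : set U.
Hypotheses (hQ : is_ideal Q) (Q1 : ~ Q 1)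
  (Qprime : forall u v, Q (u * v) -> Q u \/ Q v).

Definition primeb : {pred U} := fun u => `[< Q u >].

Fact primeb_zmod : zmod_closed primeb.
Proof.
split=> [|u v /asboolP Qu /asboolP Qv]; apply/asboolP; first exact: ideal0.
exact: idealB.
Qed.
Fact primeb_idealr :
  1 \notin primeb /\ forall a, {in primeb, forall u, a * u \in primeb}.
Proof.
split; first by apply/asboolP.
by move=> a u /asboolP Qu; apply/asboolP; apply: idealMl.
Qed.
Fact primeb_prime : prime_idealr_closed primeb.
Proof.
by move=> u v /asboolP/Qprime[Qu|Qv]; apply/orP; [left|right]; apply/asboolP.
Qed.
HB.instance Definition _ := GRing.isZmodClosed.Build U primeb primeb_zmod.
HB.instance Definition _ := isProperIdeal.Build U primeb primeb_idealr.
HB.instance Definition _ := isPrimeIdealrClosed.Build U primeb primeb_prime.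

Definition pquot := {ideal_quot primeb}.
HB.instance Definition _ := GRing.ComNzRing.on pquot.

(** Units are declared classically: only the field of fractions of the quotient is
    used, but its construction expects a type with inverses. *)
Definition pquot_unit : pred pquot := fun a => `[< exists b, b * a = 1 >].
Definition pquot_inv (a : pquot) : pquot :=
  if pselect (exists b, b * a = 1) is left ex then projT1 (cid ex) else a.
Fact pquot_mulV : {in pquot_unit, left_inverse 1 pquot_inv *%R}.
Proof.
by move=> a /asboolP ua; rewrite /pquot_inv; case: pselect => // ex; case: (cid ex).
Qed.
Fact pquot_unitP a b : b * a = 1 -> pquot_unit a.
Proof. by move=> ba; apply/asboolP; exists b. Qed.
Fact pquot_inv_out : {in [predC pquot_unit], pquot_inv =1 id}.
Proof. by move=> a /asboolP ua; rewrite /pquot_inv; case: pselect. Qed.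
HB.instance Definition _ := GRing.ComNzRing_hasMulInverse.Build pquot
  pquot_mulV pquot_unitP pquot_inv_out.
HB.instance Definition _ := GRing.ComUnitRing_isIntegral.Build pquot
  (@Quotient.rquot_IdomainAxiom U primeb).

Definition pquot_pi (u : U) : pquot := \pi_{ideal_quot primeb} u.
Fact pquot_pi_zmod : zmod_morphism pquot_pi.
Proof. by move=> u v; rewrite /pquot_pi !piE. Qed.
Fact pquot_pi_monoid : monoid_morphism pquot_pi.
Proof. by split=> [|u v]; rewrite /pquot_pi ?piE. Qed.
HB.instance Definition _ := GRing.isZmodMorphism.Build U pquot pquot_pi pquot_pi_zmod.
HB.instance Definition _ := GRing.isMonoidMorphism.Build U pquot pquot_pi pquot_pi_monoid.

Lemma prime_quotient_field :
  exists (E : fieldType) (ev : {rmorphism U -> E}), (forall u, ev u = 0 <-> Q u) /\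
    forall x, exists u v, ev v != 0 /\ x = ev u / ev v.
Proof.
exists {fraction pquot}, (@tofrac pquot \o pquot_pi)%FUN; split=> [u|x] /=; last first.
  have [a [b [b0 ->]]] := fraction_repr x.
  have piS y : exists u, y = pquot_pi u by exists (repr y); rewrite /pquot_pi reprK.
  have [u ->] := piS a; have [v vE] := piS b.
  by exists u, v; rewrite -vE tofrac_eq0.
have -> : tofrac (pquot_pi u) = 0 <-> pquot_pi u = 0.
  by split=> [/eqP|->]; rewrite ?tofrac0 // tofrac_eq0 => /eqP.
rewrite -(rmorph0 pquot_pi) /pquot_pi; split=> [/eqP|Qu].
  by rewrite -Quotient.idealrBE subr0 => /asboolP.
by apply/eqP; rewrite -Quotient.idealrBE subr0; apply/asboolP.
Qed.
End PrimeQuotient.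
End Ideals.

(** * Minimal polynomials over completely integrally closed domains *)

(** An element a/b of the fraction field whose powers have a common denominator
    [e] belongs to [A]. Unlike integral closedness, this passes to polynomial
    rings by an argument on leading coefficients. *)
Definition completely_integrally_closed (A : idomainType) := forall a b e : A, b != 0 -> e != 0 ->
  (forall n, exists c, e * a ^+ n = c * b ^+ n) -> exists c, a = c * b.

Lemma field_completely_integrally_closed (k : fieldType) : completely_integrally_closed k.
Proof. by move=> a b e b0 _ _; exists (a / b); rewrite divfK. Qed.

Lemma completely_integrally_closed_retract (A B : idomainType) (f : {rmorphism A -> B}) (g : {rmorphism B -> A}) :
  cancel f g -> completely_integrally_closed B -> completely_integrally_closed A.
Proof.
move=> fK cB a b e b0 e0 H.
have f0 x : x != 0 -> f x != 0.
  by apply: contra => /eqP fx; rewrite -(fK x) fx rmorph0.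
have [|c cE] := cB (f a) (f b) (f e) (f0 _ b0) (f0 _ e0).
  by move=> n; have [c cE] := H n; exists (f c); rewrite -!rmorphXn -!rmorphM cE.
by exists (g c); rewrite -(fK a) cE rmorphM fK.
Qed.

Section Extension.
Variables (A : idomainType) (K : fieldType) (iota : {rmorphism A -> K}).
Hypothesis iota_inj : forall a, iota a = 0 -> a = 0.
Hypothesis cA : completely_integrally_closed A.

Let iota_inj' : injective iota.
Proof.
move=> a b ab; apply/eqP; rewrite -subr_eq0; apply/eqP; apply: iota_inj.
by rewrite rmorphB ab subrr.
Qed.

Lemma almost_integral_mem x e : e != 0 ->
  (forall n, exists c, iota e * x ^+ n = iota c) -> exists a, x = iota a.
Proof.
move=> e0 H; have [a aE] := H 1%N.
have ie0 : iota e != 0 by apply: contra e0 => /eqP/iota_inj->.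
have [|c cE] := cA (a := a) e0 e0.
  move=> n; have [c cE] := H n; exists c; apply: iota_inj'.
  by rewrite rmorphM rmorphXn -aE expr1 exprMn mulrCA cE rmorphM rmorphXn mulrC.
by exists c; apply: (mulfI ie0); rewrite -[x]expr1 aE cE rmorphM mulrC.
Qed.

Definition coefs_in (p : {poly K}) := exists q : {poly A}, p = map_poly iota q.

Lemma coefs_inM p q : coefs_in p -> coefs_in q -> coefs_in (p * q).
Proof. by move=> [a ->] [b ->]; exists (a * b); rewrite rmorphM. Qed.
Lemma coefs_in_sum I (r : seq I) (P : pred I) (F : I -> {poly K}) :
  (forall i, P i -> coefs_in (F i)) -> coefs_in (\sum_(i <- r | P i) F i).
Proof.
move=> PF; apply: big_ind => //; first by exists 0; rewrite rmorph0.
by move=> _ _ [a ->] [b ->]; exists (a + b); rewrite rmorphD.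
Qed.

(** The leading coefficient of [p] is almost integral over [A], hence in [A];
    the difference of [p] and its leading term is again almost integral. *)
Lemma almost_integral_poly (p : {poly K}) (e : {poly A}) : e != 0 ->
  (forall n, coefs_in (map_poly iota e * p ^+ n)) -> coefs_in p.
Proof.
move: {2}(size p) (leqnn (size p)) => m; elim: m p => [|m IH] p.
  by rewrite leqn0 size_poly_eq0 => /eqP-> _ _; exists 0; rewrite rmorph0.
move=> sp e0 H; have [p0|p0] := eqVneq p 0.
  by exists 0; rewrite rmorph0.
have lE (q : {poly A}) : lead_coef (map_poly iota q) = iota (lead_coef q).
  have [->|q0] := eqVneq q 0; first by rewrite rmorph0 !lead_coef0 rmorph0.
  rewrite lead_coef_map_eq //; apply: contra q0 => /eqP/iota_inj/eqP.
  by rewrite lead_coef_eq0.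
have [|n|a aE] := @almost_integral_mem (lead_coef p) (lead_coef e).
- by rewrite lead_coef_eq0.
- have [q qE] := H n; exists (lead_coef q).
  by rewrite -!lE -qE lead_coefM lead_coef_exp.
pose t := map_poly iota (a *: 'X^((size p).-1)).
have [||q qE] := IH (p - t) _ e0.
- rewrite -ltnS (leq_trans _ sp) // /t map_polyZ map_polyXn /= -aE.
  have sp0 : (0 < size p)%N by rewrite lt0n size_poly_eq0.
  rewrite -[X in (_ < X)%N](prednK sp0) ltnS; apply/leq_sizeP => j.
  rewrite leq_eqVlt => /orP[/eqP<-|jp].
    by rewrite coefB coefZ coefXn eqxx mulr1 subrr.
  rewrite coefB coefZ coefXn (gtn_eqF jp) mulr0 subr0 nth_default //.
  by rewrite -(prednK sp0).
- move=> n; rewrite exprDn mulr_sumr; apply: coefs_in_sum => i _.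
  rewrite -mulrnAr mulrA; apply: coefs_inM; first exact: H.
  exists ((- (a *: 'X^((size p).-1))) ^+ i *+ 'C(n, i)).
  by rewrite rmorphMn rmorphXn rmorphN.
- by exists (q + a *: 'X^((size p).-1)); rewrite rmorphD /= -qE subrK.
Qed.

End Extension.

(** Once common factors are removed, all the powers of the denominator divide [e],
    so it is constant. *)
Lemma dvdp_almost_integral (F : fieldType) (a b e : {poly F}) : b != 0 -> e != 0 ->
  (forall n, b ^+ n %| e * a ^+ n) -> b %| a.
Proof.
move=> b0 e0 H; set g := gcdp a b.
have g0 : g != 0 by rewrite gcdp_eq0 negb_and b0 orbT.
have cop : coprimep (b %/ g) (a %/ g).
  by rewrite coprimep_sym coprimep_div_gcd // b0 orbT.
have aE : a = a %/ g * g by apply/eqP; rewrite -dvdp_eq dvdp_gcdl.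
have bE : b = b %/ g * g by apply/eqP; rewrite -dvdp_eq dvdp_gcdr.
have He n : (b %/ g) ^+ n %| e.
  rewrite -(@Gauss_dvdpl _ _ ((a %/ g) ^+ n)); last first.
    exact/coprimep_expl/coprimep_expr.
  have := H n; rewrite {1}bE {1}aE !exprMn mulrA dvdp_mul2r //.
  exact: expf_neq0.
have b'0 : b %/ g != 0 by rewrite dvdp_div_eq0 ?dvdp_gcdr.
have sb : size (b %/ g) = 1%N.
  apply/eqP; apply: contraT => sb.
  have := dvdp_leq e0 (He (size e)); rewrite leqNgt => /negP[].
  have sb2 : (1 < size (b %/ g)%R)%N.
    by rewrite ltn_neqAle eq_sym sb lt0n size_poly_eq0.
  have := size_exp (b %/ g) (size e); rewrite (@polySpred _ (_ ^+ _)) ?expf_neq0 //=.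
  by move=> ->; rewrite ltnS -{1}(mul1n (size e)) leq_mul2r -ltnS prednK ?sb2 ?orbT // ltnW.
suff : b %/ g * g %| a %/ g * g by rewrite -aE -bE.
rewrite dvdp_mul2r //; move/eqP/size_poly1P: sb => [c c0 ->].
by apply/dvdpP; exists (c^-1 *: (a %/ g)); rewrite mulrC mul_polyC scalerA divff // scale1r.
Qed.

(** The quotient exists over the fraction field, where the ring of polynomials is
    principal, and [almost_integral_poly] brings its coefficients back to [A]. *)
Lemma completely_integrally_closed_poly (A : idomainType) : completely_integrally_closed A -> completely_integrally_closed {poly A}.
Proof.
move=> cA a b e b0 e0 H.
pose f : {rmorphism A -> {fraction A}} := @tofrac A.
have f_inj x : f x = 0 -> x = 0 by move/eqP; rewrite tofrac_eq0 => /eqP.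
have mi : injective (map_poly f).
  apply: map_inj_poly; last exact: rmorph0.
  by move=> x y /eqP; rewrite tofrac_eq => /eqP.
have m0 p : p != 0 -> map_poly f p != 0.
  by apply: contra => /eqP p0; apply/eqP; apply: mi; rewrite p0 rmorph0.
have /dvdpP[q qE] : map_poly f b %| map_poly f a.
  apply: (dvdp_almost_integral (m0 _ b0) (m0 _ e0)) => n.
  have [c cE] := H n; apply/dvdpP; exists (map_poly f c).
  by rewrite -!rmorphXn -!rmorphM cE.
have [|c cE] := almost_integral_poly f_inj cA (p := q) e0.
  move=> n; have [c cE] := H n; exists c.
  apply: (mulIf (expf_neq0 n (m0 _ b0))).
  by rewrite -mulrA -exprMn -qE -!rmorphXn -!rmorphM cE.
by exists c; apply: mi; rewrite rmorphM /= -cE.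
Qed.

Section IntegralMinPoly.
Variables (P : idomainType) (E : fieldType) (zeta : {rmorphism P -> E}).
Hypothesis zeta_inj : forall a, zeta a = 0 -> a = 0.
Hypothesis cP : completely_integrally_closed P.
Local Notation "G ^z" := (map_poly zeta G) (at level 2, format "G ^z").

Let zeta_inj' : injective zeta.
Proof.
move=> a b ab; apply/eqP; rewrite -subr_eq0; apply/eqP; apply: zeta_inj.
by rewrite rmorphB ab subrr.
Qed.

(** Gauss's lemma for minimal polynomials. Let [C] be the companion matrix of the
    minimal polynomial of [s] over the fraction field. As [s] is integral, its
    powers are combinations of finitely many of them with a common denominator
    [e]; hence so are the entries of the powers of [C], and those of ('X - C)^n.
    The determinants of the latter are the powers of the minimal polynomial,
    which is thus almost integral over [{poly P}]. *)
Lemma integral_minpoly s : integralOver zeta s -> exists2 mu : {poly P},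
  mu \is monic /\ root mu^z s &
  forall G : {poly P}, G != 0 -> root G^z s -> (size mu <= size G)%N.
Proof.
move=> [f f_monic fs].
pose Q n := `[< exists G : {poly P}, [/\ G != 0, root G^z s & size G = n] >].
have exQ : exists n, Q n by exists (size f); apply/asboolP; exists f; rewrite monic_neq0.
have {exQ} [_ /asboolP[G [G0 Gs <-]] minG] := ex_minnP exQ.
have {}minG (H : {poly P}) : root H^z s -> (size H < size G)%N -> H = 0.
  move=> Hs sH; apply: contraTeq sH => H0; rewrite -leqNgt; apply: minG.
  by apply/asboolP; exists H.
pose g := lead_coef G; have g0 : g != 0 by rewrite lead_coef_eq0.
have zg0 : zeta g != 0 by apply: contra g0 => /eqP/zeta_inj->.
have sG : (1 < size G)%N.
  rewrite ltn_neqAle eq_sym lt0n size_poly_eq0 G0 andbT.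
  apply: contra g0 => /size_poly1P[c c0 GE]; move: Gs.
  by rewrite GE map_polyC rootC => /eqP/zeta_inj cz; rewrite cz eqxx in c0.
pose r := (size G).-2; have sGr : size G = r.+2 by rewrite /r; case: (size G) sG => [|[]].
have uniq_rep (H1 H2 : {poly P}) : (size H1 <= r.+1)%N -> (size H2 <= r.+1)%N ->
    H1^z.[s] = H2^z.[s] -> H1 = H2.
  move=> s1 s2 H12; apply/eqP; rewrite -subr_eq0; apply/eqP; apply: minG.
    by rewrite /root rmorphB /= hornerD hornerN H12 subrr.
  by rewrite (leq_ltn_trans (size_polyD _ _)) // size_polyN gtn_max sGr !ltnS s1.
have rep (H : {poly P}) : exists k (H' : {poly P}), (size H' <= r.+1)%N /\
    zeta g ^+ k * H^z.[s] = H'^z.[s].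
  exists (scalp H G), (H %% G); split.
    by rewrite -ltnS -sGr ltn_modp.
  have := congr1 (fun p : {poly P} => p^z.[s]) (Pdiv.Idomain.divp_eq H G).
  rewrite /= map_polyZ hornerZ rmorphXn rmorphD rmorphM /= hornerD hornerM.
  by move/rootP: Gs => ->; rewrite mulr0 add0r.
have [e e0 eP] : exists2 e, e != 0 & forall n, exists H' : {poly P},
    (size H' <= r.+1)%N /\ zeta e * s ^+ n = H'^z.[s].
  have [k kP] := choice (fun i : nat => rep 'X^i).
  pose N := (size f).-1; exists (g ^+ (\sum_(i < N) k i)); first exact: expf_neq0.
  have small i : (i < N)%N -> exists H' : {poly P}, (size H' <= r.+1)%N /\
      zeta (g ^+ (\sum_(i < N) k i)) * s ^+ i = H'^z.[s].
    move=> iN; have [H' [sH' HE]] := kP i.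
    exists (g ^+ (\sum_(j < N | j != Ordinal iN) k j) *: H'); split.
      by rewrite (leq_trans (size_scale_leq _ _)).
    rewrite (bigD1 (Ordinal iN)) //= exprD mulrC rmorphM mulrCA map_polyZ hornerZ -HE.
    by rewrite map_polyXn hornerXn !rmorphXn; ring.
  have [h hP] := choice (fun i : 'I_N => small i (ltn_ord i)).
  move=> n; pose rho := Pdiv.Ring.rmodp 'X^n f.
  exists (\sum_(i < N) rho`_i *: h i); split.
    apply: (leq_trans (size_sum _ _ _)); apply/bigmax_leqP => i _.
    by rewrite (leq_trans (size_scale_leq _ _)) //; case: (hP i).
  have srho : (size rho <= N)%N.
    have := Pdiv.Ring.ltn_rmodpN0 'X^n (monic_neq0 f_monic).
    by rewrite -/rho /N; case: (size f).
  have -> : s ^+ n = rho^z.[s].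
    have := congr1 (fun p : {poly P} => p^z.[s]) (Pdiv.RingMonic.rdivp_eq f_monic 'X^n).
    rewrite /= map_polyXn hornerXn => ->; rewrite rmorphD rmorphM /= hornerD hornerM.
    by move/rootP: fs => ->; rewrite mulr0 add0r.
  rewrite (@horner_coef_wide _ N); last exact: leq_trans (size_poly _ _) srho.
  rewrite mulr_sumr rmorph_sum horner_sum; apply: eq_bigr => i _.
  by rewrite coef_map mulrCA; case: (hP i) => _ ->; rewrite /= map_polyZ hornerZ.
pose muE := (zeta g)^-1 *: G^z.
have muE_monic : muE \is monic.
  by rewrite monicE lead_coefZ lead_coef_map_eq ?mulVf.
have sGz : size G^z = r.+2.
  by rewrite size_map_poly_id0 ?sGr.
have smu : size muE = r.+2 by rewrite size_scale ?invr_eq0.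
have muEs : root muE s by rewrite /root hornerZ (rootP Gs) mulr0.
(* the companion matrix, which multiplies the vector of powers of [s] by [s] *)
pose C : 'M[E]_r.+1 := \matrix_(i, j) if i == r :> nat then - muE`_j else (i.+1 == j :> nat)%:R.
have CE : char_poly C = muE.
  rewrite -[RHS](companionmxK muE_monic) /companionmx smu.
  by congr char_poly; apply/matrixP => i j; rewrite !mxE.
pose w : 'cV[E]_r.+1 := \col_i s ^+ i.
have Cw : C *m w = s *: w.
  apply/colP => i; rewrite !mxE -exprS.
  have [ir|ir] := eqVneq (i : nat) r.
    have muE_r : muE`_r.+1 = 1 by move/monicP: muE_monic; rewrite /lead_coef smu.
    move/rootP: muEs; rewrite horner_coef smu big_ord_recr /= muE_r mul1r ir.
    move/eqP; rewrite addrC addr_eq0 => /eqP ->; rewrite -sumrN; apply: eq_bigr => j _.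
    by rewrite !mxE ir eqxx mulNr.
  have ilt : (i.+1 < r.+1)%N by rewrite ltn_neqAle eqSS ir ltn_ord.
  rewrite (bigD1 (Ordinal ilt)) //= big1 ?addr0 => [|j ji].
    by rewrite !mxE (negbTE ir) eqxx mul1r.
  rewrite !mxE (negbTE ir); move: ji; rewrite -val_eqE /= eq_sym => /negbTE->.
  by rewrite mul0r.
have Cnw n : C ^+ n *m w = s ^+ n *: w.
  elim: n => [|n IH]; first by rewrite mul1mx scale1r.
  by rewrite exprSr -mulmxA Cw -scalemxAr IH scalerA exprSr mulrC.
have gC n i j : exists c, zeta g ^+ n * (C ^+ n) i j = zeta c.
  elim: n i j => [|n IH] i j.
    by exists (i == j)%:R; rewrite expr0 mul1r !mxE rmorph_nat.
  have [c cE] := choice (IH i).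
  have dP l : exists x, zeta g * C l j = zeta x.
    rewrite mxE; case: eqP => _; last by exists (g * (l.+1 == j)%:R); rewrite rmorphM rmorph_nat.
    by exists (- G`_j); rewrite coefZ coef_map mulrN mulrA mulfV // mul1r rmorphN.
  have [d dE] := choice dP.
  exists (\sum_l c l * d l); rewrite exprS [C ^+ n.+1]exprSr mxE mulr_sumr rmorph_sum.
  apply: eq_bigr => l _; rewrite rmorphM /= -cE -dE; ring.
have eC n i j : exists c, zeta e * (C ^+ n) i j = zeta c.
  have [c cE] := choice (gC n i); have [H' [sH' HE]] := eP (i + n)%N.
  have Hc : e *: \poly_(l < r.+1) c (inord l) = g ^+ n *: H'.
    apply: uniq_rep; [|by rewrite (leq_trans (size_scale_leq _ _))|].
      by rewrite (leq_trans (size_scale_leq _ _)) // size_poly.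
    rewrite !map_polyZ !hornerZ -HE exprD.
    have -> : s ^+ i * s ^+ n = ((C ^+ n) *m w) i 0 by rewrite Cnw !mxE mulrC.
    rewrite mxE (@horner_coef_wide _ r.+1); last first.
      exact: leq_trans (size_poly _ _) (size_poly _ _).
    rewrite [RHS]mulrCA; congr (_ * _); rewrite mulr_sumr; apply: eq_bigr => l _.
    by rewrite coef_map coef_poly ltn_ord inord_val mxE mulrA rmorphXn cE.
  have := congr1 (fun p : {poly P} => p`_j) Hc.
  rewrite !coefZ coef_poly ltn_ord inord_val => ecE; exists H'`_j.
  apply: (mulfI (expf_neq0 n zg0)).
  by rewrite mulrCA cE -rmorphM ecE rmorphM rmorphXn.
pose W := char_poly_mx C.
have eW n m i j : coefs_in zeta ((zeta e)%:P * (W ^+ n * map_mx polyC C ^+ m) i j).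
  elim: n m i j => [|n IH] m i j.
    rewrite expr0 mul1r -rmorphXn mxE -polyCM; have [c ->] := eC m i j.
    by exists c%:P; rewrite map_polyC.
  have -> : W ^+ n.+1 * map_mx polyC C ^+ m =
      'X *: (W ^+ n * map_mx polyC C ^+ m) - W ^+ n * map_mx polyC C ^+ m.+1.
    rewrite exprSr -mulrA /W /char_poly_mx mulrBl mulrBr -exprS; congr (_ - _).
    by rewrite [X in _ * X]mul_scalar_mx -scalerAr.
  rewrite mxE [X in _ * (X + _)]mxE [X in _ * (_ + X)]mxE mulrBr mulrCA.
  have [q ->] := IH m i j; have [q' ->] := IH m.+1 i j.
  by exists ('X * q - q'); rewrite rmorphB rmorphM /= map_polyX.
have muE_in : coefs_in zeta muE.
  apply: (almost_integral_poly zeta_inj cP (e := (e ^+ r.+1)%:P)).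
    by rewrite polyC_eq0 expf_neq0.
  move=> n; rewrite map_polyC /= -CE /char_poly -/W.
  have -> : \det W ^+ n = \det (W ^+ n).
    by elim: n => [|n IH]; rewrite ?det1 // !exprS det_mulmx IH.
  rewrite rmorphXn polyC_exp -detZ; apply: coefs_in_sum => sg _.
  have detc i j : coefs_in zeta (((zeta e)%:P *: W ^+ n) i j).
    by have := eW n 0%N i j; rewrite expr0 mulr1 mxE.
  have sgc (b : bool) : coefs_in zeta ((-1) ^+ b).
    by exists ((-1) ^+ b); rewrite rmorphXn rmorphN1.
  apply: coefs_inM; first exact: sgc.
  apply: (big_ind (coefs_in zeta)) => // [|p q]; [exact: (sgc false)|exact: coefs_inM].
have [mu muP] := muE_in.
have smu' : size mu = size G.
  by rewrite sGr -smu muP size_map_inj_poly ?rmorph0 // => x y; exact: zeta_inj'.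
exists mu; first split.
- rewrite monicE; apply/eqP; apply: zeta_inj'; rewrite rmorph1.
  by move/monicP: muE_monic; rewrite muP lead_coef_map_inj ?rmorph0.
- by rewrite -muP.
- move=> H H0 Hs; rewrite smu' leqNgt; apply: contra H0 => sH.
  by apply/eqP; apply: minG.
Qed.
End IntegralMinPoly.

(** * Noether normalization *)

Lemma rmorph_mmap n (R S T : comNzRingType) (f : R -> S) (h : 'I_n -> S)
    (phi : {rmorphism S -> T}) (p : {mpoly R[n]}) :
  phi (mmap f h p) = mmap (phi \o f) (phi \o h) p.
Proof.
rewrite /mmap rmorph_sum; apply: eq_bigr => m _; rewrite rmorphM /mmap1 rmorph_prod.
by congr (_ * _); apply: eq_bigr => i _; rewrite rmorphXn.
Qed.

Lemma eq_mmap n (R S : nzRingType) (f f' : R -> S) (h h' : 'I_n -> S) :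
  f =1 f' -> h =1 h' -> mmap f h =1 mmap f' h'.
Proof.
move=> ff hh p; rewrite /mmap; apply: eq_bigr => m _; rewrite ff /mmap1.
by congr (_ * _); apply: eq_bigr => i _; rewrite hh.
Qed.

Lemma mmap_self n (R : comNzRingType) (p : {mpoly R[n]}) :
  mmap (@mpolyC n R) (fun i => 'X_i) p = p.
Proof.
rewrite [RHS]mpolyE /mmap; apply: eq_bigr => m _; rewrite mul_mpolyC; congr (_ *: _).
by rewrite mpolyXE_id.
Qed.

Lemma rmorph_mpoly_ext n (R S : comNzRingType) (f g : {rmorphism {mpoly R[n]} -> S}) :
  (forall c, f c%:MP = g c%:MP) -> (forall i, f 'X_i = g 'X_i) -> f =1 g.
Proof.
move=> fgC fgX p; rewrite -[p]mmap_self !rmorph_mmap.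
exact: eq_mmap.
Qed.

Lemma mpoly0_const (R : nzRingType) (p : {mpoly R[0]}) : p = (p@_0%MM)%:MP.
Proof.
apply/mpolyP => m; rewrite mcoeffC; have -> : m = 0%MM by apply/mnmP => -[].
by rewrite eqxx mulr1.
Qed.

Lemma base_expansion_inj n (B : nat) (m m' : 'I_n -> nat) :
  (forall i, (m i < B)%N) -> (forall i, (m' i < B)%N) ->
  (\sum_i m i * B ^ i = \sum_i m' i * B ^ i)%N -> m =1 m'.
Proof.
elim: n m m' => [|n IH] m m' mB m'B; first by move=> _ [].
have E (u : 'I_n.+1 -> nat) : (\sum_i u i * B ^ i =
    u ord0 + (\sum_i u (lift ord0 i) * B ^ i) * B)%N.
  rewrite big_ord_recl expn0 muln1; congr (_ + _)%N; rewrite big_distrl /=.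
  by apply: eq_bigr => i _; rewrite /bump /= add1n expnSr mulnA.
rewrite !E => e.
have B0 : (0 < B)%N by apply: leq_ltn_trans (mB ord0).
have e0 : m ord0 = m' ord0.
  have := congr1 (modn^~ B) e; rewrite /= ![(_ + _ * B)%N]addnC !modnMDl.
  by rewrite !modn_small.
move: e; rewrite e0 => /addnI /eqP; rewrite eqn_pmul2r // => /eqP e i.
case: (unliftP ord0 i) => [j ->|-> //].
exact: (IH (fun j => m (lift ord0 j)) (fun j => m' (lift ord0 j))).
Qed.

Lemma seq_argmax (T : eqType) (w : T -> nat) (s : seq T) x : x \in s ->
  exists2 y, y \in s & forall x', x' \in s -> (w x' <= w y)%N.
Proof.
elim: s x => // a [|b s] IH x _.
  by exists a; [rewrite inE|move=> x'; rewrite inE => /eqP->].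
have [y ys ymax] := IH b (mem_head _ _).
have [aw|/ltnW wa] := leqP (w a) (w y).
  by exists y; [rewrite inE ys orbT|move=> x'; rewrite inE => /orP[/eqP->|/ymax]].
exists a; first exact: mem_head.
by move=> x'; rewrite inE => /orP[/eqP->|/ymax xy] //; apply: leq_trans wa.
Qed.

Section Noether.
Variables (k : fieldType) (U : comNzRingType) (E : fieldType).
Variables (iU : {rmorphism k -> U}) (ev : {rmorphism U -> E}) (chi : {rmorphism U -> k}).

Let e0 : {rmorphism k -> E} := (ev \o iU)%FUN.

Definition alg_map n (z : 'I_n -> U) : {rmorphism {mpoly k[n]} -> E} :=
  mmap (ev \o iU)%FUN (ev \o z)%FUN.

Lemma integral_pow n (z : 'I_n -> U) u m :
  integralOver (alg_map z) u -> integralOver (alg_map z) (u ^+ m).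
Proof.
move=> iu; elim: m => [|m IH]; first exact: integral1.
by rewrite exprS; apply: integral_mul.
Qed.

(** The monomials of [p] acquire distinct degrees when the variables are replaced
    by polynomials of degrees 1, B, B^2 and so on, since the exponents are digits
    in base [B]. The largest degree comes from a single monomial. *)
Lemma relation_leading n (p : {mpoly k[n]}) (x : 'I_n -> {poly E}) (B : nat) :
  p != 0 -> (forall i, x i \is monic) -> (forall i : 'I_n, size (x i) = (B ^ i).+1) ->
  (forall m, m \in msupp p -> forall i, (m i < B)%N) ->
  exists2 c, c != 0 & (e0 c)%:P * mmap (polyC \o e0) x p \is monic.
Proof.
move=> p0 x_monic sx mB.
pose wt (m : 'X_{1..n}) := (\sum_i m i * B ^ i)%N.
have T m : (mmap1 x m \is monic) && (size (mmap1 x m) == (wt m).+1).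
  rewrite /mmap1 /wt; apply: (big_ind2 (fun (q : {poly E}) s => (q \is monic) && (size q == s.+1))).
  - by rewrite monic1 size_poly1.
  - move=> q1 s1 q2 s2 /andP[m1 /eqP z1] /andP[m2 /eqP z2].
    by rewrite monicMl // m2 size_monicM ?monic_neq0 // z1 z2 addSn addnS /= eqxx.
  - move=> i _; rewrite monic_exp //=; apply/eqP.
    have := size_exp (x i) (m i); rewrite sx /= mulnC => <-.
    by rewrite prednK // size_poly_gt0 monic_neq0 // monic_exp.
have [m0 m0p] : exists m0, m0 \in msupp p.
  case E1: (msupp p) => [|m0 l]; last by exists m0; rewrite inE eqxx.
  by move: p0; rewrite -msupp_eq0 E1.
have [m1 m1p m1max] := seq_argmax wt m0p.
have wt_lt m : m \in msupp p -> m != m1 -> (wt m < wt m1)%N.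
  move=> mp mm1; rewrite ltn_neqAle m1max // andbT; apply: contra mm1 => /eqP e.
  by apply/eqP/mnmP; apply: (base_expansion_inj (mB _ mp) (mB _ m1p)).
have pm1 : p@_m1 != 0 by rewrite -mcoeff_msupp.
have c0 : e0 p@_m1 != 0 by rewrite fmorph_eq0.
exists (p@_m1)^-1; first by rewrite invr_eq0.
rewrite fmorphV /mmap (bigD1_seq m1) ?msupp_uniq //= mulrDr mulrA -polyCM [_^-1 * _]mulVf // mul1r.
have /andP[t1 /eqP st1] := T m1.
rewrite monicE lead_coefDl ?(monicP t1) ?eqxx //.
rewrite st1 ltnS mulr_sumr; apply: (leq_trans (size_sum _ _ _)).
apply/bigmax_leqP_seq => m mp mm1.
rewrite mulrA -polyCM mul_polyC (leq_trans (size_scale_leq _ _)) //.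
by have /andP[_ /eqP ->] := T m; apply: wt_lt.
Qed.

Definition alg_independent n (z : 'I_n -> U) :=
  forall p, alg_map z p = 0 -> p = 0.

Lemma integral_coefs_mmap n (z : 'I_n -> U) m (x : 'I_m -> {poly E}) (p : {mpoly k[m]}) :
  (forall i j, integralOver (alg_map z) (x i)`_j) ->
  forall j, integralOver (alg_map z) (mmap (polyC \o e0) x p)`_j.
Proof.
pose IC (q : {poly E}) := forall j, integralOver (alg_map z) q`_j.
have I0 : integralOver (alg_map z) 0 by apply: integral0.
have ICM q1 q2 : IC q1 -> IC q2 -> IC (q1 * q2).
  move=> I1 I2 j; rewrite coefM; apply: (big_ind (integralOver (alg_map z))) => //.
    by move=> u v; apply: integral_add.
  by move=> i _; apply: integral_mul.
have IC1 : IC 1.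
  by move=> j; rewrite coef1; case: eqP => _; [apply: integral1|].
move=> ICx; rewrite /mmap; apply: (big_ind IC) => [j|q1 q2 I1 I2 j|mm _].
- by rewrite coef0.
- by rewrite coefD; apply: integral_add.
apply: (ICM) => [j|].
  rewrite coefC; case: eqP => _ //=.
  have -> : ev (iU p@_mm) = alg_map z (p@_mm)%:MP by rewrite /= mmapC.
  exact: integral_id.
apply: (big_ind IC) => [||i _]; [exact: IC1|exact: ICM|].
by elim: (mm i) => [|e IHe]; [rewrite expr0|rewrite exprS; apply: (ICM) => // j; apply: ICx].
Qed.

(** Nagata's proof. A relation between the [r i] is an integral equation for
    [r ord0] over the elements r_i - r_0^(B^i), by [relation_leading]. The
    parameters stay in the kernel of [chi], that is, the point given by [chi]
    lies above the origin. *)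
Theorem noether_normalization n (r : 'I_n -> U) : (forall i, chi (r i) = 0) ->
  exists d (z : 'I_d -> U), [/\ forall i, chi (z i) = 0, alg_independent z
    & forall i, integralOver (alg_map z) (ev (r i))].
Proof.
elim: n r => [|n IH] r r0.
  exists 0%N, r; split=> // [p|[]//]; rewrite (mpoly0_const p) /= mmapC.
  by move/eqP; rewrite fmorph_eq0 => /eqP->; rewrite mpolyC0.
have [indep|] := pselect (alg_independent r).
  exists n.+1, r; split=> // i.
  have -> : ev (r i) = alg_map r 'X_i by rewrite /= mmapX mmap1U.
  exact: integral_id.
move=> /existsNP[p /not_implyP[pr /eqP p0]].
pose B := msize p.
have B0 : (0 < B)%N by rewrite lt0n msize_poly_eq0.
pose r' i := r (lift ord0 i) - r ord0 ^+ (B ^ (lift ord0 i : 'I_n.+1)).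
have [|d [z [z0 zind zint]]] := IH r'.
  by move=> i; rewrite rmorphB rmorphXn !r0 expr0n gtn_eqF ?subr0 // expn_gt0 B0.
exists d, z; split=> //.
pose x (i : 'I_n.+1) : {poly E} :=
  'X^(B ^ i) + (if unlift ord0 i is Some j then ev (r' j) else 0)%:P.
have Bi i : (0 < B ^ i)%N by rewrite expn_gt0 B0.
have [|i|m mp i|c c0 H_monic] := @relation_leading _ p x B p0.
- by move=> i; apply: monicXnaddC.
- by apply: size_XnaddC.
- apply: leq_ltn_trans (msize_mdeg_lt mp); rewrite mdegE (bigD1 i) //=.
  exact: leq_addr.
have xr i : (x i).[ev (r ord0)] = ev (r i).
  rewrite hornerD hornerXn hornerC; case: unliftP => [j ->|->].
    by rewrite rmorphB rmorphXn addrC subrK.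
  by rewrite expn0 expr1 addr0.
have Hroot : root ((e0 c)%:P * mmap (polyC \o e0) x p) (ev (r ord0)).
  rewrite /root hornerM -[(mmap _ _ _).[_]]/(horner_eval (ev (r ord0)) _).
  rewrite rmorph_mmap (@eq_mmap _ _ _ _ e0 _ (ev \o r)%FUN) ?[mmap _ _ _]pr ?mulr0 //.
    by move=> a; rewrite /= /horner_eval hornerC.
have int_const a : integralOver (alg_map z) (e0 a).
  by have := integral_id (alg_map z) a%:MP; rewrite /= mmapC.
have int0 : integralOver (alg_map z) (ev (r ord0)).
  apply: integral_root_monic H_monic Hroot _; apply/integral_poly => j.
  rewrite coefCM; apply: integral_mul; first exact: int_const.
  apply: integral_coefs_mmap => {}i {}j; rewrite coefD coefXn; apply: integral_add.
    exact: integral_nat.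
  rewrite coefC; case: eqP => _; last exact: integral0.
  by case: unliftP => [l _|_]; [apply: zint|apply: integral0].
move=> i; case: (unliftP ord0 i) => [j ->|-> //].
have -> : ev (r (lift ord0 j)) = ev (r' j) + ev (r ord0) ^+ (B ^ (lift ord0 j : 'I_n.+1)).
  by rewrite rmorphB rmorphXn subrK.
by apply: integral_add => //; apply: integral_pow.
Qed.
End Noether.

(** * Cutting down to dimension one *)

Lemma rmorph_poly_ext (R S : comNzRingType) (f g : {rmorphism {poly R} -> S}) :
  (forall c, f c%:P = g c%:P) -> f 'X = g 'X -> f =1 g.
Proof.
move=> fgC fgX p; rewrite -[p]coefK poly_def !rmorph_sum; apply: eq_bigr => i _.
by rewrite -mul_polyC !rmorphM !rmorphXn fgC fgX.
Qed.

Section MpolyPoly.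
Variables (n : nat) (R : comNzRingType).

(** The polynomial variable is the first of the [n.+1] variables. *)
Definition mpoly_to_poly : {rmorphism {mpoly R[n.+1]} -> {poly {mpoly R[n]}}} :=
  mmap (polyC \o @mpolyC n R)%FUN
    (fun i => if unlift ord0 i is Some j then ('X_j)%:P else 'X).

Definition poly_to_mpoly : {rmorphism {poly {mpoly R[n]}} -> {mpoly R[n.+1]}} :=
  (horner_eval 'X_ord0 \o
   map_poly (mmap (@mpolyC n.+1 R) (fun j : 'I_n => 'X_(lift ord0 j))))%FUN.

Lemma poly_to_mpolyC p :
  poly_to_mpoly p%:P = mmap (@mpolyC n.+1 R) (fun j : 'I_n => 'X_(lift ord0 j)) p.
Proof. by rewrite /= /horner_eval map_polyC hornerC. Qed.
Lemma poly_to_mpolyX : poly_to_mpoly 'X = 'X_ord0.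
Proof. by rewrite /= /horner_eval map_polyX hornerX. Qed.
Lemma mpoly_to_polyX i :
  mpoly_to_poly 'X_i = if unlift ord0 i is Some j then ('X_j)%:P else 'X.
Proof. by rewrite /= mmapX mmap1U. Qed.
Lemma mpoly_to_polyC c : mpoly_to_poly c%:MP = c%:MP%:P.
Proof. by rewrite /= mmapC. Qed.

Lemma mpoly_to_polyK : cancel mpoly_to_poly poly_to_mpoly.
Proof.
move=> p; pose F : {rmorphism _ -> _} := (poly_to_mpoly \o mpoly_to_poly)%FUN.
apply: (rmorph_mpoly_ext (f := F) (g := idfun)) => [c|i] /=.
  by rewrite [mmap _ _ _]mpoly_to_polyC [horner_eval _ _]poly_to_mpolyC mmapC.
rewrite [mmap _ _ _]mpoly_to_polyX; case: unliftP => [j ->|->].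
  by rewrite [horner_eval _ _]poly_to_mpolyC mmapX mmap1U.
by rewrite [horner_eval _ _]poly_to_mpolyX.
Qed.

Lemma poly_to_mpolyK : cancel poly_to_mpoly mpoly_to_poly.
Proof.
move=> p; pose F : {rmorphism _ -> _} := (mpoly_to_poly \o poly_to_mpoly)%FUN.
apply: (rmorph_poly_ext (f := F) (g := idfun)) => [c|] /=; last first.
  by rewrite [horner_eval _ _]poly_to_mpolyX [mmap _ _ _]mpoly_to_polyX unlift_none.
rewrite [horner_eval _ _]poly_to_mpolyC.
pose F1 : {rmorphism {mpoly R[n]} -> {poly {mpoly R[n]}}} :=
  (mpoly_to_poly \o mmap (@mpolyC n.+1 R) (fun j : 'I_n => 'X_(lift ord0 j)))%FUN.
apply: (rmorph_mpoly_ext (f := F1) (g := polyC)) => [a|i] /=.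
  by rewrite mmapC [mmap _ _ _]mpoly_to_polyC.
by rewrite mmapX mmap1U [mmap _ _ _]mpoly_to_polyX liftK.
Qed.
End MpolyPoly.

Lemma completely_integrally_closed_mpoly n (k : fieldType) : completely_integrally_closed {mpoly k[n]}.
Proof.
elim: n => [|n IH].
  pose f : {rmorphism {mpoly k[0]} -> k} := mmap idfun (fun _ => 0).
  apply: (@completely_integrally_closed_retract _ _ f (@mpolyC 0 k)); last exact: field_completely_integrally_closed.
  by move=> p; rewrite [p in RHS](mpoly0_const p) (mpoly0_const p) /= mmapC mcoeffC eqxx mulr1.
exact: completely_integrally_closed_retract (@mpoly_to_polyK n k) (completely_integrally_closed_poly IH).
Qed.

Section NoDimensionTwo.
Variables (k : fieldType) (U : comNzRingType) (E : fieldType) (A : idomainType).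
Variables (ev : {rmorphism U -> E}) (chi : {rmorphism U -> k}).
Variables (zU : {rmorphism {poly A} -> U}).
Let zeta : {rmorphism {poly A} -> E} := (ev \o zU)%FUN.
Hypothesis zeta_inj : forall p, zeta p = 0 -> p = 0.
Hypothesis cA : completely_integrally_closed {poly A}.
Hypothesis ev_int : forall u, integralOver zeta (ev u).
Hypothesis ker_le : forall u, ev u = 0 -> chi u = 0.
Variable h : U.
Hypothesis evh : ev h != 0.

Local Notation "G ^z" := (map_poly zeta G) (at level 2, format "G ^z").

Let evalU (G : {poly {poly A}}) (u : U) : U := (map_poly zU G).[u].
Let ev_evalU G u : ev (evalU G u) = G^z.[ev u].
Proof. by rewrite /evalU -horner_map -map_poly_comp. Qed.

(** The multiple is the constant term of the minimal polynomial of [h]. *)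
Lemma nonzero_multiple : exists (H : {poly A}) u, H != 0 /\ ev (h * u) = zeta H.
Proof.
have [mu [mu_monic mu_root] mu_min] := integral_minpoly zeta_inj cA (ev_int h).
exists mu`_0, (- evalU (drop_poly 1 mu) h).
have muE : mu = drop_poly 1 mu * 'X + (mu`_0)%:P.
  rewrite -{1}(poly_take_drop 1 mu) expr1 addrC; congr (_ + _).
  by apply/polyP => i; rewrite coef_take_poly coefC; case: i.
have E0 : (drop_poly 1 mu)^z.[ev h] * ev h + zeta mu`_0 = 0.
  move/rootP: mu_root; rewrite {1}muE rmorphD rmorphM /= map_polyX map_polyC.
  by rewrite hornerD hornerM hornerX hornerC.
split; last first.
  by rewrite mulrN rmorphN rmorphM ev_evalU mulrC; apply/eqP; rewrite eq_sym -addr_eq0 addrC; apply/eqP.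
apply/eqP => mu0; move: E0; rewrite mu0 rmorph0 addr0 => /eqP.
rewrite mulf_eq0 (negbTE evh) orbF => d0.
have dn0 : drop_poly 1 mu != 0.
  apply/eqP => d00; move: muE; rewrite d00 mul0r mu0 polyC0 addr0 => mu00.
  by move: mu_monic; rewrite mu00 monicE lead_coef0 eq_sym oner_eq0.
have := mu_min _ dn0 d0; rewrite size_drop_poly leqNgt => /negP[].
by rewrite -subn_gt0 subKn // lt0n size_poly_eq0 monic_neq0.
Qed.

Hypothesis hmax : forall u, ev u != 0 ->
  exists v w i s, [/\ ev w = 0, chi s != 0 & u * v + w = h ^+ i * s].
Variable b : nat -> A.
Hypothesis b_inj : injective b.
Hypothesis chi_b : forall j, chi (zU ('X - (b j)%:P)) = 0.

(** The roots of this polynomial are those of [mu] multiplied by [a]. *)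
Let scale_roots (mu : {poly {poly A}}) (a : {poly A}) : {poly {poly A}} :=
  \poly_(l < size mu) (mu`_l * a ^+ ((size mu).-1 - l)).

Lemma scale_roots_monic mu a : mu \is monic -> scale_roots mu a \is monic /\ size (scale_roots mu a) = size mu.
Proof.
move=> mu_monic; have s0 : (0 < size mu)%N by rewrite lt0n size_poly_eq0 monic_neq0.
have lc : mu`_(size mu).-1 = 1 by move/monicP: mu_monic; rewrite /lead_coef.
have sE : size (scale_roots mu a) = size mu.
  rewrite /scale_roots; case: (size mu) s0 lc => // m _ /= lc.
  by rewrite size_poly_eq // lc subnn mulr1 oner_neq0.
split=> //; rewrite monicE /lead_coef sE coef_poly prednK // leqnn.
by rewrite lc subnn mulr1.
Qed.

Lemma scale_roots_root mu a s : root mu^z s -> root (scale_roots mu a)^z (zeta a * s).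
Proof.
move/rootP; rewrite (horner_coef_wide _ (size_poly _ _)) => e.
apply/rootP; rewrite (@horner_coef_wide _ (size mu)); last first.
  by rewrite (leq_trans (size_poly _ _)) // size_poly.
rewrite -[RHS](mulr0 (zeta a ^+ (size mu).-1)) -[in RHS]e mulr_sumr.
apply: eq_bigr => i _; rewrite !coef_map /scale_roots coef_poly ltn_ord. rewrite /= !rmorphM !rmorphXn exprMn.
have -> : ev (zU a) ^+ (size mu).-1 = ev (zU a) ^+ ((size mu).-1 - i) * ev (zU a) ^+ i.
  by rewrite -exprD subnK // -ltnS (leq_trans (ltn_ord i)) // leqSpred.
by ring.
Qed.

Lemma scale_roots_min (mu : {poly {poly A}}) (a : {poly A}) (s : E) : a != 0 ->
  (forall G : {poly {poly A}}, G != 0 -> root G^z s -> (size mu <= size G)%N) ->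
  forall G : {poly {poly A}}, G != 0 -> root G^z (zeta a * s) -> (size mu <= size G)%N.
Proof.
move=> a0 mu_min G G0 Gs.
have saX : size (a *: 'X : {poly {poly A}}) = 2%N by rewrite size_scale // size_polyX.
rewrite -(size_comp_poly2 G saX); apply: mu_min.
  by rewrite comp_poly2_eq0.
by rewrite /root map_comp_poly horner_comp map_polyZ map_polyX hornerZ hornerX.
Qed.

(** Going down for the hyperplanes [pi := 'X - b j], which pass through the origin.
    Some [b j] is not a root of the multiple [H] of [h]. By maximality, [pi]
    divides some [h ^+ i * s] with [chi s != 0], so that [a * s = pi * y] with [a]
    a power of [H], prime to [pi]. Then the minimal polynomials of [s] and [y]
    have the same degree r and their coefficients are related by
    a^i mu_(r-i) = pi^i nu_(r-i). Hence [pi] divides all the coefficients of [mu]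
    but the leading one, and [chi s] is nilpotent. *)
Lemma no_dimension_two : False.
Proof.
have [H [u [H0 uH]]] := nonzero_multiple.
have [j Hj] : exists j, H.[b j] != 0.
  apply: contrapT => nj.
  have rt : all (root H) [seq b j | j <- iota 0 (size H)].
    apply/allP => _ /mapP[j _ ->]; apply: contrapT => /negP rj.
    by apply: nj; exists j.
  have := max_poly_roots H0 rt; rewrite map_inj_uniq // iota_uniq => /(_ isT).
  by rewrite size_map size_iota ltnn.
pose pi := 'X - (b j)%:P.
have pi0 : pi != 0 by rewrite polyXsubC_eq0.
have zpi : ev (zU pi) != 0 by apply/eqP => /zeta_inj/eqP; apply/negP.
have [v [w [i [s [ew cs e]]]]] := hmax zpi.
pose S := ev s; pose y := ev (v * u ^+ i); pose a := H ^+ i.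
have a0 : a != 0 by apply: expf_neq0.
have aS : zeta a * S = zeta pi * y.
  rewrite /a rmorphXn -uH /S /y -rmorphXn -!rmorphM.
  have -> : (h * u) ^+ i * s = zU pi * (v * u ^+ i) + w * u ^+ i.
    by rewrite mulrA -mulrDl e exprMn; ring.
  by rewrite rmorphD [ev (w * _)]rmorphM ew mul0r addr0 rmorphM.
have [mu [mu_monic mu_root] mu_min] := integral_minpoly zeta_inj cA (ev_int s).
have [nu [nu_monic nu_root] nu_min] := integral_minpoly zeta_inj cA (ev_int (v * u ^+ i)).
have [M1 s1] := scale_roots_monic a mu_monic; have r1 := scale_roots_root a mu_root.
have [M2 s2] := scale_roots_monic pi nu_monic; have r2 := scale_roots_root pi nu_root.
rewrite -/S aS in r1.
have min1 := scale_roots_min a0 mu_min; rewrite -/S aS in min1.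
have min2 := scale_roots_min pi0 nu_min.
have smn : size mu = size nu.
  apply/eqP; rewrite eqn_leq -{2}s1 -{1}s2 min1 ?monic_neq0 //=.
  by rewrite min2 ?monic_neq0.
have D0 : scale_roots mu a = scale_roots nu pi.
  apply/eqP; rewrite -subr_eq0; apply: contraT => D0.
  have /min1 : root (scale_roots mu a - scale_roots nu pi)^z (zeta pi * y).
    by rewrite /root rmorphB /= hornerD hornerN (rootP r1) (rootP r2) subrr.
  move=> /(_ D0); rewrite leqNgt => /negP[].
  have s0 : (0 < size mu)%N by rewrite lt0n size_poly_eq0 monic_neq0.
  rewrite -(prednK s0) ltnS; apply/leq_sizeP => l; rewrite leq_eqVlt => /orP[/eqP<-|lt].
    rewrite coefB; apply/eqP; rewrite subr_eq0; apply/eqP.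
    move/monicP: M1; rewrite /lead_coef s1 => ->.
    by move/monicP: M2; rewrite /lead_coef s2 smn => ->.
  rewrite nth_default // (leq_trans (size_polyD _ _)) // size_polyN s1 s2 smn maxnn.
  by rewrite -smn -(prednK s0).
have mu_pi l : (l < (size mu).-1)%N -> exists q, mu`_l = q * pi.
  move=> ls; apply/factor_theorem; have := congr1 (fun p : {poly {poly A}} => p`_l) D0.
  have ls' : (l < size mu)%N by rewrite (leq_trans ls) // leq_pred.
  rewrite /= !coef_poly -smn ls' => /(congr1 (fun p => p.[b j])).
  have [m ->] : exists m, ((size mu).-1 - l)%N = m.+1.
    by exists ((size mu).-1 - l).-1; rewrite prednK // subn_gt0.
  rewrite !hornerM !horner_exp hornerXsubC subrr expr0n /= mulr0 => /eqP.
  by rewrite mulf_eq0 expf_eq0 (negbTE (expf_neq0 _ Hj)) orbF.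
move/rootP: mu_root; rewrite -ev_evalU => /ker_le; rewrite /evalU.
have smu : size (map_poly zU mu) = size mu.
  by rewrite size_map_poly_id0 // (monicP mu_monic) rmorph1 oner_neq0.
have s0 : (0 < size mu)%N by rewrite lt0n size_poly_eq0 monic_neq0.
rewrite horner_coef smu -(prednK s0) big_ord_recr /= rmorphD rmorph_sum big1 => [|l _].
  rewrite add0r coef_map /= [mu`__](monicP mu_monic) rmorph1 mul1r rmorphXn => /eqP.
  by rewrite expf_eq0 (negbTE cs) andbF.
have [q qE] := mu_pi l (ltn_ord l).
by rewrite coef_map /= qE !rmorphM chi_b mulr0 mul0r.
Qed.
End NoDimensionTwo.

(** * Lifting a point of an affine variety to a formal arc *)

Section FiniteSpan.
Variables (k : comNzRingType) (P : idomainType) (E : fieldType) (iP : {rmorphism k -> P})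
  (zeta : {rmorphism P -> E}).
Variables (N : nat) (x : 'I_N -> E).
Hypothesis x_int : forall i, integralOver zeta (x i).

Lemma integral_power_span y : integralOver zeta y -> exists M, forall M', (M <= M')%N ->
  forall n, exists c : 'I_M' -> P, y ^+ n = \sum_j zeta (c j) * y ^+ j.
Proof.
move=> [f f_monic fy]; exists (size f).-1 => M' MM' n.
pose rho := Pdiv.Ring.rmodp 'X^n f; exists (fun j => rho`_j).
have srho : (size rho <= M')%N.
  apply: leq_trans MM'; have := Pdiv.Ring.ltn_rmodpN0 'X^n (monic_neq0 f_monic).
  by rewrite -/rho; case: (size f).
have -> : y ^+ n = (map_poly zeta rho).[y].
  have := congr1 (fun p : {poly P} => (map_poly zeta p).[y])
    (Pdiv.RingMonic.rdivp_eq f_monic 'X^n).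
  rewrite /= map_polyXn hornerXn => ->; rewrite rmorphD rmorphM /= hornerD hornerM.
  by move/rootP: fy => ->; rewrite mulr0 add0r.
rewrite (@horner_coef_wide _ M'); last exact: leq_trans (size_poly _ _) srho.
by apply: eq_bigr => i _; rewrite coef_map.
Qed.

(** The monomials with bounded exponents span. *)
Lemma integral_span : exists n (g : 'I_n -> E), forall p : {mpoly k[N]},
  exists q : 'I_n -> P, mmap (zeta \o iP)%FUN x p = \sum_j zeta (q j) * g j.
Proof.
have [M0 M0P] := choice (fun i => integral_power_span (x_int i)).
pose M := \max_i M0 i.
have span i m := M0P i M (leq_bigmax i) m.
pose T := {ffun 'I_N -> 'I_M}.
pose G (f : T) := \prod_i x i ^+ f i.
suff H (p : {mpoly k[N]}) : exists q : T -> P,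
    mmap (zeta \o iP)%FUN x p = \sum_f zeta (q f) * G f.
  exists #|T|, (fun j => G (enum_val j)) => p; have [q ->] := H p.
  exists (fun j => q (enum_val j)); rewrite [RHS](reindex enum_rank) /=.
    by apply: eq_bigr => f _; rewrite enum_rankK.
  by exists enum_val => f _; [rewrite enum_rankK|rewrite enum_valK].
have Hm (m : 'X_{1..N}) : exists q : T -> P, mmap1 x m = \sum_f zeta (q f) * G f.
  have [c cE] := choice (fun i => span i (m i)).
  exists (fun f => \prod_i c i (f i)); rewrite /mmap1.
  rewrite (eq_bigr _ (fun i _ => cE i)) bigA_distr_bigA /=.
  by apply: eq_bigr => f _; rewrite big_split /= rmorph_prod.
have [c cE] := choice Hm.
exists (fun f => \sum_(m <- msupp p) iP p@_m * c m f); rewrite /mmap.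
under eq_bigr => m _ do rewrite cE mulr_sumr.
rewrite exchange_big /=; apply: eq_bigr => f _.
rewrite rmorph_sum mulr_suml; apply: eq_bigr => m _.
by rewrite rmorphM mulrA.
Qed.

(** Over a common denominator, the [n.+1] elements lie in a module generated by [n]
    elements. The matrix of coordinates, completed by a zero column, is singular. *)
Lemma integral_dependent :
  (forall y, exists u v : {mpoly k[N]}, mmap (zeta \o iP)%FUN x v != 0 /\
     y = mmap (zeta \o iP)%FUN x u / mmap (zeta \o iP)%FUN x v) ->
  exists n, forall a : 'I_n.+1 -> E, exists c : 'I_n.+1 -> P,
    (exists i, c i != 0) /\ \sum_i zeta (c i) * a i = 0.
Proof.
move=> frac; have [n [g gP]] := integral_span; exists n => a.
have [u uP] := choice (fun i => frac (a i)); have [v vP] := choice uP.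
set e := mmap (zeta \o iP)%FUN x in gP frac uP vP.
pose V := \prod_i v i.
have V0 : e V != 0.
  by rewrite /e rmorph_prod prodf_seq_neq0; apply/allP => i _; case: (vP i).
have aE i : exists q : 'I_n -> P, e V * a i = \sum_j zeta (q j) * g j.
  have [q qE] := gP (u i * \prod_(l | l != i) v l); exists q; rewrite -qE.
  have [vi ->] := vP i; rewrite /V (bigD1 i) //= /e !rmorphM /=.
  by rewrite [LHS]mulrC -mulrA mulKf.
have [q qE] := choice aE.
pose A : 'M[P]_n.+1 := \matrix_(i, j) if unlift ord0 j is Some l then q i l else 0.
have /det0P[w w0 wA] : \det A == 0.
  rewrite (expand_det_col _ ord0) big1 // => i _.
  by rewrite mxE unlift_none mul0r.
exists (fun i => w 0 i); split.
  apply: contrapT => nw; move/eqP: w0; apply; apply/rowP => i; rewrite mxE.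
  by apply/eqP; apply: contrapT => /negP wi; apply: nw; exists i.
apply: (mulfI V0); rewrite mulr0 mulr_sumr.
under eq_bigr => i _ do rewrite mulrCA qE mulr_sumr.
rewrite exchange_big /= big1 // => j _.
under eq_bigr => i _ do rewrite mulrA -rmorphM.
rewrite -mulr_suml -rmorph_sum.
have := congr1 (fun B : 'rV_n.+1 => B 0 (lift ord0 j)) wA; rewrite !mxE => E0.
rewrite [X in zeta X](_ : _ = 0) ?rmorph0 ?mul0r // -[RHS]E0.
by apply: eq_bigr => i _; rewrite mxE liftK.
Qed.
End FiniteSpan.

Section ArcLifting.
Variables (k : closedFieldType) (N : nat).
Local Notation U := {mpoly k[N]}.
Variable b : 'I_N -> k.
Let chi : {rmorphism U -> k} := meval b.

Section OverField.
Variables (E : fieldType) (ev : {rmorphism U -> E}).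
Hypothesis ker_le : forall u, ev u = 0 -> chi u = 0.
Hypothesis frac : forall x, exists u v, ev v != 0 /\ x = ev u / ev v.
Variable h : U.
Hypothesis evh : ev h != 0.
Hypothesis hmax : forall u, ev u != 0 ->
  exists v w i s, [/\ ev w = 0, chi s != 0 & u * v + w = h ^+ i * s].

Definition is_arc (x : 'I_N -> fps k) :=
  [/\ forall i, fps_eval0 (x i) = b i,
      forall p, ev p = 0 -> mmap (@fps_const k) x p = 0
    & mmap (@fps_const k) x h != 0].

Let iU : {rmorphism k -> U} := @mpolyC N k.

Lemma evE p : ev p = mmap (ev \o iU)%FUN (fun i => ev 'X_i) p.
Proof.
rewrite -[in LHS](mmap_self p) rmorph_mmap; exact: eq_mmap.
Qed.

Lemma integral_ev d (z : 'I_d -> U) :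
  (forall i, integralOver (alg_map iU ev z) (ev ('X_i - (b i)%:MP))) ->
  forall u, integralOver (alg_map iU ev z) (ev u).
Proof.
move=> zint; have ic c : integralOver (alg_map iU ev z) (ev c%:MP).
  by have := integral_id (alg_map iU ev z) c%:MP; rewrite /= mmapC.
have iX i : integralOver (alg_map iU ev z) (ev 'X_i).
  by rewrite -(subrK (b i)%:MP 'X_i) rmorphD; apply: integral_add.
move=> u; rewrite evE /mmap; apply: (big_ind (integralOver (alg_map iU ev z))).
- exact: integral0.
- by move=> *; apply: integral_add.
- move=> m _; apply: integral_mul; first exact: ic.
  apply: (big_ind (integralOver (alg_map iU ev z))).
  + exact: integral1.
  + by move=> *; apply: integral_mul.
  + by move=> i _; apply: integral_pow.
Qed.

(** A finite extension of an algebraically closed field is trivial, and the arc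
    is constant. *)
Lemma arc_dim0 (z : 'I_0 -> U) :
  integralOver (alg_map iU ev z) (ev h) -> is_arc (fun i => fps_const (b i)).
Proof.
have th p : mmap (@fps_const k) (fun i => fps_const (b i)) p = fps_const (chi p).
  have := @rmorph_mmap _ _ _ _ idfun b (@fps_const k) p.
  by rewrite /= -/(meval b) => ->; apply: eq_mmap.
move=> [f f_monic fh]; split=> [i|p /ker_le|] //; first by rewrite th => ->; rewrite rmorph0.
rewrite th; apply/eqP => /(congr1 (@fps_eval0 k)) /= chih.
pose psi : {rmorphism {mpoly k[0]} -> k} := mmap idfun (fun _ => 0).
have psiE p : p = (psi p)%:MP by rewrite {1 2}(mpoly0_const p) /= mmapC.
pose f' := map_poly psi f.
have f'E : map_poly (alg_map iU ev z) f = map_poly (ev \o iU)%FUN f'.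
  by apply/polyP => i; rewrite !coef_map {1}(psiE f`_i) /= mmapC.
have f'_monic : f' \is monic by apply: monic_map.
move: fh; have [rs rsE] := closed_field_poly_normal f'.
rewrite f'E rsE (monicP f'_monic) scale1r rmorph_prod /root horner_prod prodf_seq_eq0.
move=> /hasP[c _]; rewrite rmorphB /= map_polyX map_polyC hornerXsubC subr_eq0 => /eqP hc.
have evc : ev (h - c%:MP) = 0 by rewrite rmorphB hc subrr.
have := ker_le evc; rewrite rmorphB /= mevalC => /eqP; rewrite subr_eq0 => /eqP hcE.
by move/eqP: evh; apply; rewrite hc -hcE /= [meval _ _]chih mpolyC0 rmorph0.
Qed.

Lemma arc_dim1 (z : 'I_1 -> U) : (forall i, chi (z i) = 0) -> alg_independent iU ev z ->
  (forall u, integralOver (alg_map iU ev z) (ev u)) -> exists x, is_arc x.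
Proof.
move=> z0 zind zint; pose iota : {rmorphism k -> E} := (ev \o iU)%FUN.
pose t := ev (z ord0).
pose G0 : set (E * k) := [set v | exists u, v = (ev u, chi u)].
have hG0 : partial_hom G0.
  split.
  - by exists 1; rewrite !rmorph1.
  - by move=> _ _ [u ->] [v ->]; exists (u - v); rewrite !rmorphB.
  - by move=> _ _ [u ->] [v ->]; exists (u * v); rewrite !rmorphM.
  - by move=> c [u [ue ->]]; apply: ker_le.
have [|G hG G0G] := extend_to_place hG0.
  by move=> c; exists (iota c), c%:MP; rewrite /= mevalC.
have Gu u : G (ev u, chi u) by apply: G0G; exists u.
have Giota c : G (iota c, c) by have := Gu c%:MP; rewrite /= mevalC.
have Gt : G (t, 0) by have := Gu (z ord0); rewrite z0.
(* polynomials in one variable, through [{poly {mpoly k[0]}}] *)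
pose to_mp : {rmorphism {poly k} -> {mpoly k[1]}} :=
  (@poly_to_mpoly 0 k \o map_poly (@mpolyC 0 k))%FUN.
have to_mp_inj p : to_mp p = 0 -> p = 0.
  move=> e0; have e : map_poly (@mpolyC 0 k) p = 0.
    by rewrite -(@poly_to_mpolyK 0 k (map_poly _ p)) [poly_to_mpoly _ _ _]e0 rmorph0.
  apply: (map_inj_poly (f := @mpolyC 0 k)); rewrite ?mpolyC0 //.
    by move=> a c /eqP; rewrite mpolyC_eq => /eqP.
  by rewrite e rmorph0.
pose zeta : {rmorphism {poly k} -> E} := (horner_eval t \o map_poly iota)%FUN.
have zetaE p : zeta p = alg_map iU ev z (to_mp p).
  pose F : {rmorphism {poly k} -> E} := (alg_map iU ev z \o to_mp)%FUN.
  apply: (rmorph_poly_ext (f := zeta) (g := F)) => [c|].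
    by rewrite /= /horner_eval !map_polyC /= !hornerC !mmapC.
  by rewrite /= /horner_eval !map_polyX !hornerX mmapX mmap1U.
have t_trans p : (map_poly iota p).[t] = 0 -> p = 0.
  by move=> e; apply: to_mp_inj; apply: zind; rewrite -zetaE.
have zeta_int y : integralOver (alg_map iU ev z) y -> integralOver zeta y.
  move=> [f f_monic fy].
  pose psi : {rmorphism {mpoly k[0]} -> k} := mmap idfun (fun _ => 0).
  pose to_p : {rmorphism {mpoly k[1]} -> {poly k}} := (map_poly psi \o @mpoly_to_poly 0 k)%FUN.
  have to_mpK p : to_mp (to_p p) = p.
    rewrite -[RHS](@mpoly_to_polyK 0 k); congr (@poly_to_mpoly 0 k _).
    rewrite /= -map_poly_comp map_poly_id // => q _ /=.
    by rewrite {2}(mpoly0_const q) (mpoly0_const q) /= mmapC mcoeffC eqxx mulr1.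
  exists (map_poly to_p f); first exact: monic_map.
  suff -> : map_poly zeta (map_poly to_p f) = map_poly (alg_map iU ev z) f by [].
  by apply/polyP => i; rewrite !coef_map; rewrite [LHS]zetaE to_mpK.
have [|y|n dep] := @integral_dependent k {poly k} E polyC zeta N (fun i => ev 'X_i).
- by move=> i; apply: zeta_int.
- have [u [v [v0 yE]]] := frac y; exists u, v.
  have ee p : mmap (zeta \o polyC)%FUN (fun i => ev 'X_i) p = ev p.
    by rewrite evE; apply: eq_mmap => // c; rewrite /= /horner_eval map_polyC hornerC.
  by rewrite !ee.
have [th [th_iota thB thM th0 th_inj]] := place_expansion hG Giota Gt t_trans dep.
pose F (u : U) : fps k := th (ev u).
have FB : zmod_morphism F by move=> u v; rewrite /F rmorphB; apply: thB.
have FM : monoid_morphism F.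
  split; first by rewrite /F rmorph1 -(rmorph1 iota) th_iota.
  by move=> u v; rewrite /F rmorphM; apply: thM.
pose Fa := GRing.isZmodMorphism.Build _ _ F FB.
pose Fm := GRing.isMonoidMorphism.Build _ _ F FM.
pose FF : {rmorphism U -> fps k} := HB.pack F Fa Fm.
have FE p : mmap (@fps_const k) (fun i => F 'X_i) p = F p.
  rewrite -[in RHS](mmap_self p) -[F _]/(FF _) rmorph_mmap; apply: eq_mmap => // c.
  by rewrite /= /F -th_iota.
exists (fun i => F 'X_i); split=> [i|p p0|].
- by rewrite /F (th0 _ _ (Gu _)) /= mevalXU.
- by rewrite FE /F p0 -(rmorph0 iota) th_iota rmorph0.
- by rewrite FE; apply: contra evh => /eqP/(th_inj _ _ (Gu h))->.
Qed.

Lemma arc_dim2 d (z : 'I_d.+2 -> U) : (forall i, chi (z i) = 0) -> alg_independent iU ev z ->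
  (forall u, integralOver (alg_map iU ev z) (ev u)) -> False.
Proof.
move=> z0 zind zint.
pose zU : {rmorphism {poly {mpoly k[d.+1]}} -> U} :=
  (mmap iU z \o @poly_to_mpoly d.+1 k)%FUN.
have zUE p : ev (mmap iU z p) = alg_map iU ev z p by rewrite rmorph_mmap.
have pK := @poly_to_mpolyK d.+1 k.
(* the exponents are positive so that the hyperplanes pass through the origin *)
pose y j : {mpoly k[d.+1]} := 'X_ord0 ^+ j.+1.
apply: (@no_dimension_two k U E {mpoly k[d.+1]} ev chi zU _ _ _ ker_le h evh hmax y).
- move=> p /=; rewrite zUE => /zind e; rewrite -(pK p).
  by rewrite [poly_to_mpoly _ _ p]e rmorph0.
- exact: completely_integrally_closed_poly (@completely_integrally_closed_mpoly d.+1 k).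
- move=> u; have [f f_monic fu] := zint u.
  exists (map_poly (@mpoly_to_poly d.+1 k) f); first exact: monic_map.
  suff -> : map_poly (ev \o zU) (map_poly (@mpoly_to_poly d.+1 k) f) = map_poly (alg_map iU ev z) f by [].
  by apply/polyP => i; rewrite !coef_map /= zUE [horner_eval _ _]mpoly_to_polyK.
- move=> i j /eqP; rewrite /y !mpolyXn => /eqP /(congr1 (fun p : {mpoly k[d.+1]} => p@_(U_(ord0) *+ i.+1)%MM)).
  rewrite /= !mcoeffX eqxx; case: eqP => [/(congr1 (fun m : 'X_{1..d.+1} => m ord0))|_ /eqP].
    by rewrite !mulmnE mnm1E eqxx !mul1n => -[->].
  by rewrite oner_eq0.
- move=> j; rewrite rmorphB rmorphB.
  have -> : zU 'X = z ord0 by rewrite /= [horner_eval _ _]poly_to_mpolyX mmapX mmap1U.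
  have -> : zU (y j)%:P = z (lift ord0 ord0) ^+ j.+1.
    rewrite /= [horner_eval _ _]poly_to_mpolyC /y rmorphXn /= mmapX mmap1U rmorphXn /=.
    by rewrite mmapX mmap1U.
  by rewrite rmorphXn !z0 expr0n subrr.
Qed.
End OverField.

(** The kernel of [phi] is enlarged to an ideal maximal among those disjoint from
    the products [h ^+ i * s] where [s] does not vanish at [b]. It is prime, and
    defines a subvariety through [b], not contained in [h = 0] and minimal as
    such; its dimension is at most one by [no_dimension_two]. *)
Theorem arc_lifting (E0 : fieldType) (phi : {rmorphism U -> E0}) (h : U) :
  (forall p, phi p = 0 -> p.@[b] = 0) -> phi h != 0 ->
  exists x : 'I_N -> fps k, [/\ forall i, fps_eval0 (x i) = b i,
      forall p, phi p = 0 -> mmap (@fps_const k) x p = 0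
    & mmap (@fps_const k) x h != 0].
Proof.
move=> ker_le phih.
pose T : set U := [set t | exists i s, chi s != 0 /\ t = h ^+ i * s].
have TM s t : T s -> T t -> T (s * t).
  move=> [i [u [cu ->]]] [j [v [cv ->]]]; exists (i + j)%N, (u * v).
  by rewrite rmorphM mulf_neq0 // exprD mulrACA.
have T1 : T 1 by exists 0%N, 1; rewrite rmorph1 oner_neq0 mulr1.
pose I : set U := [set u | phi u = 0].
have hI : is_ideal I.
  split; first exact: rmorph0.
  - by move=> u v pu pv; change (phi (u - v) = 0); rewrite rmorphB pu pv subrr.
  - by move=> u v pv; change (phi (u * v) = 0); rewrite rmorphM pv mulr0.
have TI t : T t -> ~ I t.
  move=> [i [s [cs ->]]] It; have : phi (h ^+ i * s) = 0 by [].
  move=> /eqP; rewrite rmorphM rmorphXn.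
  rewrite mulf_eq0 (negbTE (expf_neq0 _ phih)) /= => /eqP /ker_le.
  by apply/eqP.
have [Q [hQ IQ TQ maxQ]] := maximal_ideal_avoiding hI T1 TM TI.
have Qprime := avoiding_prime hQ TM TQ maxQ.
have [E [ev [evQ frac]]] := prime_quotient_field hQ (TQ 1 T1) Qprime.
have kerQ u : ev u = 0 -> chi u = 0.
  move=> /evQ Qu; apply/eqP; apply: contraT => cu; case: (TQ u) => //.
  by exists 0%N, u; rewrite mul1r.
have evh : ev h != 0.
  apply/eqP => /evQ; apply: TQ; exists 1%N, 1; rewrite rmorph1 oner_neq0.
  by rewrite expr1 mulr1.
have hmax u : ev u != 0 ->
    exists v w i s, [/\ ev w = 0, chi s != 0 & u * v + w = h ^+ i * s].
  move=> /eqP uQ; have [|v [w [Qw [i [s [cs e]]]]]] := maxQ u.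
    by move=> /evQ.
  by exists v, w, i, s; split=> //; apply/evQ.
suff [x [xb xker xh]] : exists x, is_arc ev h x.
  by exists x; split=> // p /IQ/evQ/xker.
have [|d [z [z0 zind zint]]] :=
  @noether_normalization k U E (@mpolyC N k) ev chi N (fun i => 'X_i - (b i)%:MP).
  by move=> i; rewrite rmorphB /= mevalXU mevalC subrr.
have {}zint := integral_ev zint.
case: d z z0 zind zint => [|[|d]] z z0 zind zint.
- by exists (fun i => fps_const (b i)); apply: (arc_dim0 kerQ evh (zint h)).
- exact: (arc_dim1 kerQ frac evh z0 zind zint).
- by have := arc_dim2 kerQ evh hmax z0 zind zint.
Qed.
End ArcLifting.

(** * Structure constants and polynomial functions on an orbit *)

Lemma closed_field_nonroot (k : closedFieldType) (p : {poly k}) : p != 0 -> exists t, p.[t] != 0.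
Proof.
move=> p0; apply: contrapT => np.
have pz t : p.[t] = 0 by apply/eqP; apply: contrapT => /negP pt; apply: np; exists t.
have [s1|s1] := eqVneq (size (p + 1)) 1%N.
  move/eqP/size_poly1P: s1 => [c _ pc]; move/eqP: p0; apply.
  have pE : p = (c - 1)%:P by rewrite polyCB -pc addrK.
  by have := pz 0; rewrite pE hornerC => ->.
have /closed_rootP[t /rootP] := s1.
by rewrite hornerD hornerC pz add0r => /eqP; rewrite oner_eq0.
Qed.

(** The substitution of [relation_leading] reduces the statement to polynomials in
    one variable. *)
Lemma mpoly_eq0_eval (k : closedFieldType) n (p : {mpoly k[n]}) :
  (forall v, p.@[v] = 0) -> p = 0.
Proof.
move=> pz; apply/eqP; apply: contraT => p0.
pose B := msize p.
have B0 : (0 < B)%N by rewrite lt0n msize_poly_eq0.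
(* [p] evaluated at powers of a single unknown is a nonzero polynomial *)
have [i|i|m mp i|c c0 H_monic] := @relation_leading k k k idfun idfun n p (fun i => 'X^(B ^ i)) B p0.
- exact: monicXn.
- by rewrite size_polyXn.
- apply: leq_ltn_trans (msize_mdeg_lt mp); rewrite mdegE (bigD1 i) //=.
  exact: leq_addr.
have [t] := closed_field_nonroot (monic_neq0 H_monic).
rewrite hornerM -[(mmap _ _ _).[_]]/(horner_eval t _) rmorph_mmap.
rewrite (@eq_mmap _ _ _ _ idfun _ (fun i => t ^+ (B ^ i))) ?[mmap _ _ _]pz ?mulr0 ?eqxx //.
- by move=> a; rewrite /= /horner_eval hornerC.
- by move=> i; rewrite /= /horner_eval hornerXn.
Qed.

Section Consts.
Variables (n : nat) (delta : 'I_n -> int).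

(** [C a b c] is the coefficient of the basis vector [c] in the product of [a] and
    [b]. *)
Definition consts (R : Type) := 'I_n -> 'I_n -> 'I_n -> R.

Definition graded_mx (R : nzRingType) (g : 'M[R]_n) :=
  forall a b, delta a != delta b -> g a b = 0.

(** The rows of [g] are the images of the basis vectors under a morphism from the
    algebra [A] to the algebra [C]. *)
Definition intertwines (R : nzRingType) (A C : consts R) (g : 'M[R]_n) :=
  forall a b c, \sum_d A a b d * g d c = \sum_a' \sum_b' g a a' * g b b' * C a' b' c.

Definition consts_isom (R : comUnitRingType) (A C : consts R) :=
  exists g : 'M[R]_n, [/\ graded_mx g, g \in unitmx & intertwines A C g].

Definition map_consts (R S : Type) (f : R -> S) (A : consts R) : consts S :=
  fun a b c => f (A a b c).

(** Transport of structure: for invertible [g], the constants [C] such that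
    [intertwines A C g]. *)
Definition act (R : comUnitRingType) (g : 'M[R]_n) (A : consts R) : consts R :=
  fun a b c => \sum_a' \sum_b' \sum_d invmx g a a' * invmx g b b' * A a' b' d * g d c.

Lemma mx_delta_l (R : comUnitRingType) (g h : 'M[R]_n) (F : 'I_n -> R) a :
  g *m h = 1%:M -> \sum_x \sum_y g a x * h x y * F y = F a.
Proof.
move=> gh; rewrite exchange_big /= (bigD1 a) //= [X in _ + X]big1 ?addr0 => [|y ya].
  rewrite -mulr_suml; have := congr1 (fun M : 'M_n => M a a) gh.
  by rewrite !mxE eqxx => ->; rewrite mul1r.
rewrite -mulr_suml; have := congr1 (fun M : 'M_n => M a y) gh.
by rewrite !mxE eq_sym (negbTE ya) => ->; rewrite mul0r.
Qed.

Lemma intertwines_act (R : comUnitRingType) (A C : consts R) g : g \in unitmx ->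
  intertwines A C g -> forall a b c, act g A a b c = C a b c.
Proof.
move=> gu gAC a b c; rewrite /act.
transitivity (\sum_a' \sum_b' invmx g a a' * invmx g b b' *
   \sum_x \sum_y g a' x * g b' y * C x y c).
  apply: eq_bigr => a' _; apply: eq_bigr => b' _; rewrite -gAC mulr_sumr.
  by apply: eq_bigr => d _; rewrite !mulrA.
transitivity (\sum_a' \sum_x invmx g a a' * g a' x * \sum_b' \sum_y invmx g b b' * g b' y * C x y c).
  apply: eq_bigr => a' _; rewrite (eq_bigr (fun b' => \sum_x invmx g a a' * g a' x * \sum_y invmx g b b' * g b' y * C x y c)).
    by rewrite exchange_big /=; apply: eq_bigr => x _; rewrite mulr_sumr.
  move=> b' _; rewrite mulr_sumr; apply: eq_bigr => x _; rewrite !mulr_sumr.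
  by apply: eq_bigr => y _; ring.
rewrite (mx_delta_l (fun x => \sum_b' \sum_y invmx g b b' * g b' y * C x y c)) ?mulVmx //.
by rewrite (mx_delta_l (fun y => C a y c)) ?mulVmx.
Qed.

Lemma act_intertwines (R : comUnitRingType) (A : consts R) g : g \in unitmx ->
  intertwines A (act g A) g.
Proof.
move=> gu a b c; rewrite /act.
transitivity (\sum_x \sum_a' g a x * invmx g x a' * \sum_y \sum_b' g b y * invmx g y b' * \sum_d A a' b' d * g d c).
  rewrite (mx_delta_l (fun a' => \sum_y \sum_b' g b y * invmx g y b' * \sum_d A a' b' d * g d c)) ?mulmxV //.
  by rewrite (mx_delta_l (fun b' => \sum_d A a b' d * g d c)) ?mulmxV.
apply: eq_bigr => x _; rewrite (eq_bigr (fun a' => \sum_y g a x * g b y *  \sum_b' \sum_d invmx g x a' * invmx g y b' * A a' b' d * g d c)).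
  by rewrite exchange_big /=; apply: eq_bigr => y _; rewrite mulr_sumr.
move=> a' _; rewrite mulr_sumr; apply: eq_bigr => y _; rewrite !mulr_sumr.
apply: eq_bigr => b' _; rewrite !mulr_sumr; apply: eq_bigr => d _; ring.
Qed.

Definition const_index : finType := ('I_n * 'I_n * 'I_n)%type.
Definition const_vector (R : Type) (C : consts R) (j : 'I_#|const_index|) : R :=
  let: (a, b, c) := enum_val j in C a b c.

Local Notation ixM := {ab : 'I_n * 'I_n | delta ab.1 == delta ab.2}.
(** Only the entries which a graded matrix may have are kept as coordinates, so
    that every point gives a graded matrix. *)
Definition pattern_mx (R : nzRingType) (v : ixM -> R) : 'M[R]_n :=
  \matrix_(a, b) oapp v 0 (insub (a, b)).

Lemma pattern_mx_graded (R : nzRingType) (v : ixM -> R) : graded_mx (pattern_mx v).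
Proof.
move=> a b ab; rewrite mxE; case: insubP => //= u.
by rewrite (negbTE ab).
Qed.

Lemma pattern_mxK (R : nzRingType) (g : 'M[R]_n) : graded_mx g ->
  pattern_mx (fun i : ixM => g (val i).1 (val i).2) = g.
Proof.
move=> gg; apply/matrixP => a b; rewrite mxE; case: insubP => [u _ uE|].
  by rewrite [oapp _ _ _]/(g (val u).1 (val u).2) uE.
by move=> /gg->.
Qed.

Lemma map_pattern_mx (R S : nzRingType) (f : {rmorphism R -> S}) (v : ixM -> R) :
  map_mx f (pattern_mx v) = pattern_mx (f \o v).
Proof. by apply/matrixP => a b; rewrite !mxE; case: insubP => //= _; rewrite rmorph0. Qed.

Lemma graded_mx1 (R : nzRingType) : graded_mx (1%:M : 'M[R]_n).
Proof. by move=> a b ab; rewrite mxE; case: eqP => // e; rewrite e eqxx in ab. Qed.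
End Consts.

Section Closure.
Variables (n : nat) (delta : 'I_n -> int) (k : closedFieldType).
Local Notation consts := (consts n).
Local Notation isom := (consts_isom delta).
Local Notation ixM := {ab : 'I_n * 'I_n | delta ab.1 == delta ab.2}.

(** Zariski closure of the isomorphism class of [A], in terms of the structure
    constants. *)
Definition in_closure (A B : consts k) := forall p : {mpoly k[#|const_index n|]},
  (forall C, isom A C -> p.@[const_vector C] = 0) -> p.@[const_vector B] = 0.

Definition is_limit (A B : consts k) := exists C : consts (fps k),
  (forall a b c, fps_eval0 (C a b c) = B a b c) /\
  isom (map_consts (const_laurent k) A) (map_consts (fps_laurent k) C).

Local Notation RM := {mpoly k[#|{: ixM}|]}.
Definition generic_mx : 'M[RM]_n := pattern_mx (fun i : ixM => 'X_(enum_rank i)).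

Definition at_mx (L : fieldType) (iota : {rmorphism k -> L}) (g : 'M[L]_n) : {rmorphism RM -> L} :=
  mmap iota (fun j => let i := enum_val j in g (val i).1 (val i).2).

Lemma at_mx_generic (L : fieldType) (iota : {rmorphism k -> L}) (g : 'M[L]_n) : graded_mx delta g ->
  map_mx (at_mx iota g) generic_mx = g.
Proof.
move=> gg; rewrite map_pattern_mx -[RHS](pattern_mxK gg); apply/matrixP => a b; rewrite !mxE.
by case: insubP => //= u _ _; rewrite mmapX mmap1U enum_rankK.
Qed.

Lemma det_generic_neq0 : \det generic_mx != 0.
Proof.
apply/eqP => d0; have := congr1 (at_mx (idfun : {rmorphism k -> k}) 1%:M) d0.
rewrite -det_map_mx at_mx_generic ?det1 ?rmorph0; last exact: graded_mx1.
by move/eqP; rewrite oner_eq0.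
Qed.

(** The adjugate matrix clears the denominators of the action. The polynomial [q]
    does not depend on the field: it is evaluated at points, at the generic
    matrix and at matrices of Laurent series. *)
Lemma act_polynomial (A : consts k) (p : {mpoly k[#|const_index n|]}) : exists m (q : RM),
  forall (L : fieldType) (iota : {rmorphism k -> L}) (g : 'M[L]_n), graded_mx delta g -> \det g != 0 ->
    (\det g) ^+ m * mmap iota (const_vector (act g (map_consts iota A))) p = at_mx iota g q.
Proof.
pose Good (p : {mpoly k[#|const_index n|]}) := exists m (q : RM),
  forall (L : fieldType) (iota : {rmorphism k -> L}) (g : 'M[L]_n), graded_mx delta g -> \det g != 0 ->
    (\det g) ^+ m * mmap iota (const_vector (act g (map_consts iota A))) p = at_mx iota g q.
have detE (L : fieldType) (iota : {rmorphism k -> L}) (g : 'M[L]_n) : graded_mx delta g ->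
    at_mx iota g (\det generic_mx) = \det g.
  by move=> gg; rewrite -det_map_mx at_mx_generic.
have GC c : Good c%:MP.
  by exists 0%N, c%:MP => L iota g _ _; rewrite mul1r /= !mmapC.
have GX j : Good 'X_j.
  pose G := generic_mx; pose aG := \adj G.
  exists 2%N; pose F : RM := let: (a, b, c) := enum_val j in
    \sum_a' \sum_b' \sum_d aG a a' * aG b b' * (A a' b' d)%:MP * G d c.
  exists F => L iota g gg g0; rewrite mmapX mmap1U /F /const_vector.
  case: (enum_val j) => [[a b] c].
  have adjE x y : at_mx iota g (aG x y) = \det g * invmx g x y.
    have -> : at_mx iota g (aG x y) = (\adj g) x y.
      by rewrite -[in RHS](at_mx_generic iota gg) -map_mx_adj [RHS]mxE.
    by rewrite /invmx unitmxE unitfE g0 [in RHS]mxE mulrA mulfV ?mul1r.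
  have GE x y : at_mx iota g (G x y) = g x y.
    by rewrite -[in RHS](at_mx_generic iota gg) [RHS]mxE.
  rewrite /act mulr_sumr rmorph_sum; apply: eq_bigr => a' _.
  rewrite mulr_sumr rmorph_sum; apply: eq_bigr => b' _.
  rewrite mulr_sumr rmorph_sum; apply: eq_bigr => d _.
  rewrite !rmorphM !adjE GE [at_mx _ _ _%:MP]mmapC /map_consts; ring.
have GD p1 p2 : Good p1 -> Good p2 -> Good (p1 + p2).
  move=> [m1 [q1 H1]] [m2 [q2 H2]]; exists (m1 + m2)%N.
  exists (\det generic_mx ^+ m2 * q1 + \det generic_mx ^+ m1 * q2) => L iota g gg g0.
  rewrite [RHS]rmorphD !(rmorphM (at_mx iota g)) !(rmorphXn (at_mx iota g)) detE //.
  by rewrite -H1 // -H2 // mmapD exprD; ring.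
have GM p1 p2 : Good p1 -> Good p2 -> Good (p1 * p2).
  move=> [m1 [q1 H1]] [m2 [q2 H2]]; exists (m1 + m2)%N.
  exists (q1 * q2) => L iota g gg g0.
  by rewrite [RHS]rmorphM -H1 // -H2 // rmorphM /= exprD; ring.
rewrite -[p]mmap_self /mmap; apply: (big_ind Good) => [|//|m _].
  by rewrite -mpolyC0; apply: GC.
apply: (GM) => //; rewrite /mmap1; apply: (big_ind Good) => [|//|i _].
  by rewrite -mpolyC1; apply: GC.
by elim: (m i) => [|e IHe]; [rewrite expr0 -mpolyC1; apply: GC|rewrite exprS; apply: GM].
Qed.

Lemma limit_in_closure A B : is_limit A B -> in_closure A B.
Proof.
move=> [C [C0 [g [gg gu gAC]]]] p pA.
have [m [q qP]] := act_polynomial A p.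
have q0 : q = 0.
  suff : q * \det generic_mx = 0.
    by move/eqP; rewrite mulf_eq0 (negbTE det_generic_neq0) orbF => /eqP.
  apply: mpoly_eq0_eval => v; rewrite mevalM.
  pose g0 := pattern_mx (fun i : ixM => v (enum_rank i)).
  have vE q' : q'.@[v] = at_mx idfun g0 q'.
    apply: eq_mmap => // j /=; rewrite mxE -surjective_pairing valK /=.
    by rewrite enum_valK.
  have g0g : graded_mx delta g0 by apply: pattern_mx_graded.
  have detE : (\det generic_mx).@[v] = \det g0.
    by rewrite vE -det_map_mx at_mx_generic.
  have [d0|d0] := eqVneq (\det g0) 0; first by rewrite detE d0 mulr0.
  rewrite vE -qP //.
  have -> : mmap idfun (const_vector (act g0 (map_consts idfun A))) p = 0.
    apply: pA; exists g0; split=> //; first by rewrite unitmxE unitfE.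
    by apply: act_intertwines; rewrite unitmxE unitfE.
  by rewrite mulr0 mul0r.
have g0 : \det g != 0 by move: gu; rewrite unitmxE unitfE.
have := qP _ (const_laurent k) g gg g0; rewrite q0 rmorph0 => /eqP.
rewrite mulf_eq0 (negbTE (expf_neq0 _ g0)) /= => /eqP pz.
have {}pz : mmap (@fps_const k) (const_vector C) p = 0.
  have : fps_laurent k (mmap (@fps_const k) (const_vector C) p) = 0.
    rewrite rmorph_mmap -[RHS]pz; apply: eq_mmap => // j; rewrite /= /const_vector.
    case: (enum_val j) => [[a b] c]; rewrite (intertwines_act gu gAC) //.
  by move/eqP; rewrite tofrac_eq0 => /eqP.
have := congr1 (@fps_eval0 k) pz; rewrite rmorph_mmap rmorph0 => <-.
apply: eq_mmap => // j; rewrite /= /const_vector.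
by case: (enum_val j) => [[a b] c]; rewrite C0.
Qed.
End Closure.

(** * A formal curve through a point of the closure *)

Section PlaceMore.
Variables (K : fieldType) (k : closedFieldType) (G : set (K * k)).
Hypothesis hG : is_place G.
Let pG : partial_hom G := hG.

Lemma place_mmap (iota : {rmorphism k -> K}) n (x : 'I_n -> K) (b : 'I_n -> k) :
  (forall c, G (iota c, c)) -> (forall i, G (x i, b i)) ->
  forall p : {mpoly k[n]}, G (mmap iota x p, p.@[b]).
Proof.
move=> Gi Gx p; pose F : 'X_{1..n} -> K * k := fun m => (iota p@_m, p@_m) * \prod_i (x i, b i) ^+ m i.
have -> : (mmap iota x p, p.@[b]) = \sum_(m <- msupp p) F m.
  have H i e : (x i, b i) ^+ e = (x i ^+ e, b i ^+ e).
    by elim: e => // e IH; rewrite !exprS IH.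
  have HP (m : 'X_{1..n}) : \prod_i (x i, b i) ^+ m i = (mmap1 x m, mmap1 b m).
    rewrite /mmap1; apply: (big_rec3 (fun u v w => w = (u, v))) => // i u v _ _ ->.
    by rewrite H.
  rewrite /meval /mmap; elim: (msupp p) => [|m s IH]; first by rewrite !big_nil.
  by rewrite !big_cons -IH /F HP.
apply: (phom_sum pG) => m _; apply: (phomM pG) => //.
apply: (big_ind (fun v => G v)) => [|u v|i _]; [exact: phom1|exact: phomM|].
exact: phomX.
Qed.

(** Homogeneous coordinates at a place: dividing by a coordinate of largest
    absolute value makes all of them finite. *)
Lemma place_chart (T : finType) (x : T -> K) (t0 : T) : x t0 != 0 ->
  exists2 j, x j != 0 & forall i, exists c, G (x i / x j, c).
Proof.
move=> x0; have : exists2 j, x j != 0 & forall i, i \in enum T -> exists c, G (x i / x j, c).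
  elim: (enum T) => [|i s [j xj IH]]; first by exists t0.
  have [[c Gc]|Gc] := place_total hG (x i / x j).
    by exists j => // i'; rewrite inE => /orP[/eqP->|/IH//]; exists c.
  have [xi|xi] := eqVneq (x i) 0.
    exists j => // i'; rewrite inE => /orP[/eqP->|/IH//].
    by rewrite xi mul0r; exists 0; apply: phom0.
  exists i => // i'; rewrite inE => /orP[/eqP->|/IH[c Gc']].
    by rewrite divff //; exists 1; apply: (phom1 pG).
  (* the value of [x i' / x i] is 0, in the form in which [phomM] provides it *)
  exists (c * 0); have := phomM pG Gc' Gc.
  have -> // : (x i' / x j, c) * ((x i / x j)^-1, 0) = (x i' / x i, c * 0).
  by congr pair; rewrite /= invf_div mulrA divfK.
by move=> [j xj H]; exists j => // i; apply: H; rewrite mem_enum.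
Qed.
End PlaceMore.

Section ClosureLimit.
Variables (n : nat) (delta : 'I_n -> int) (k : closedFieldType).
Local Notation consts := (consts n).
Local Notation ixM := {ab : 'I_n * 'I_n | delta ab.1 == delta ab.2}.
Local Notation RM := {mpoly k[#|{: ixM}|]}.

(** Isomorphisms between algebras are not stable under scaling; the factor [W]
    makes up for it. *)
Lemma intertwines_fraction (A : consts k) (C : consts (fps k)) (W : fps k) (Y : 'M[fps k]_n) :
  W != 0 ->
  (forall a b c, W * (\sum_d fps_const (A a b d) * Y d c) =
     \sum_a' \sum_b' Y a a' * Y b b' * C a' b' c) ->
  intertwines (map_consts (const_laurent k) A) (map_consts (fps_laurent k) C)
    ((fps_laurent k W)^-1 *: map_mx (fps_laurent k) Y).
Proof.
move=> W0 rel a b c; pose w := fps_laurent k W.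
have w0 : w != 0 by rewrite tofrac_eq0.
apply: (mulfI (expf_neq0 2 w0)).
transitivity (fps_laurent k (W * \sum_d fps_const (A a b d) * Y d c)).
  rewrite rmorphM rmorph_sum expr2 -mulrA; congr (_ * _); rewrite mulr_sumr.
  by apply: eq_bigr => d _; rewrite rmorphM !mxE mulrCA mulVKf.
rewrite rel rmorph_sum mulr_sumr; apply: eq_bigr => a' _.
rewrite rmorph_sum mulr_sumr; apply: eq_bigr => b' _.
rewrite !rmorphM !mxE /map_consts -/w expr2.
rewrite -!mulrA [w * (w^-1 * _)]mulVKf // [_ * (w^-1 * _)]mulrCA mulVKf //.
Qed.

(** [f] is the generic point of the orbit. The hypothesis on [f] says that f |-> B
    is a specialization; it extends to a place, at which the coordinates of the
    generic matrix and 1 are finite after division by one of them, [x j]. These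
    quotients and [f] generate the ring to which [arc_lifting] applies. *)
Lemma generic_specialization_limit (A B : consts k) (K : fieldType)
    (iota : {rmorphism k -> K}) (x0 : ixM -> K) (Gm := pattern_mx x0)
    (f := act Gm (map_consts iota A)) :
  \det Gm != 0 -> (forall p, mmap iota (const_vector f) p = 0 -> p.@[const_vector B] = 0) ->
  is_limit delta A B.
Proof.
move=> Gdet fB; have Gu : Gm \in unitmx by rewrite unitmxE unitfE.
pose G0 : set (K * k) := [set v | exists p, v = (mmap iota (const_vector f) p, p.@[const_vector B])].
have hG0 : partial_hom G0.
  split.
  - by exists 1; rewrite !rmorph1.
  - by move=> _ _ [u ->] [v ->]; exists (u - v); rewrite !rmorphB.
  - by move=> _ _ [u ->] [v ->]; exists (u * v); rewrite !rmorphM.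
  - by move=> c [u [ue ->]]; apply: fB.
have [|G hG G0G] := extend_to_place hG0.
  by move=> c; exists (iota c), c%:MP; rewrite mmapC mevalC.
have Giota c : G (iota c, c) by apply: G0G; exists c%:MP; rewrite mmapC mevalC.
have Gf a b c : G (f a b c, B a b c).
  apply: G0G; exists 'X_(enum_rank (a, b, c)).
  by rewrite mmapX mmap1U mevalXU /const_vector enum_rankK.
(* the value [None] stands for the coordinate 1 *)
pose x (o : option ixM) : K := if o is Some i then x0 i else 1.
have [|j xj] := @place_chart _ _ G hG _ x None; first exact: oner_neq0.
move=> /choice[y0 Gy].
pose T : finType := (const_index n + option ixM)%type.
pose val (t : 'I_#|T|) : K := match enum_val t with
  | inl (a, b, c) => f a b c | inr o => x o / x j end.
pose pt (t : 'I_#|T|) : k := match enum_val t with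
  | inl (a, b, c) => B a b c | inr o => y0 o end.
have Gval t : G (val t, pt t) by rewrite /val /pt; case: (enum_val t) => [[[a b] c]|o].
pose U := {mpoly k[#|T|]}.
pose var (t : T) : U := 'X_(enum_rank t).
pose Yv : 'M[U]_n := pattern_mx (fun i : ixM => var (inr (Some i))).
pose Wv : U := var (inr None).
pose Cv a b c : U := var (inl (a, b, c)).
pose h := \det Yv * Wv.
pose phi : {rmorphism U -> K} := mmap iota val.
have phi_var t : phi (var t) = match t with
    | inl (a, b, c) => f a b c | inr o => x o / x j end.
  by rewrite /= mmapX mmap1U /val enum_rankK.
have phiY : map_mx phi Yv = (x j)^-1 *: Gm.
  rewrite map_pattern_mx; apply/matrixP => a b; rewrite !mxE.
  case: insubP => [u _ _|_] /=; last by rewrite mulr0.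
  by rewrite [mmap _ _ _]phi_var mulrC.
have phiYE a b : phi (Yv a b) = (x j)^-1 * Gm a b.
  by have := congr1 (fun M : 'M[K]_n => M a b) phiY; rewrite mxE => ->; rewrite mxE.
have phih : phi h != 0.
  rewrite rmorphM -det_map_mx phiY detZ [phi Wv]phi_var mul1r !mulf_neq0 ?invr_eq0 //.
  by rewrite expf_neq0 ?invr_eq0.
have ker p : phi p = 0 -> p.@[pt] = 0.
  move=> p0; apply: (phomF hG); rewrite -p0; exact: place_mmap.
have [X [Xpt Xker Xh]] := arc_lifting ker phih.
pose th : {rmorphism U -> fps k} := mmap (@fps_const k) X.
have th_var t : th (var t) = X (enum_rank t) by rewrite /= mmapX mmap1U.
pose C : consts (fps k) := fun a b c => th (Cv a b c).
exists C; split.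
  by move=> a b c; rewrite /C th_var Xpt /pt enum_rankK.
have : th h != 0 by [].
rewrite rmorphM mulf_eq0 negb_or => /andP[thY0 thW0].
rewrite -det_map_mx in thY0.
exists ((fps_laurent k (th Wv))^-1 *: map_mx (fps_laurent k) (map_mx th Yv)).
split.
- move=> a b ab; rewrite !mxE; case: insubP => [u|_] /=; first by rewrite (negbTE ab).
  by rewrite [mmap _ _ 0]rmorph0 rmorph0 mulr0.
- by rewrite unitmxE unitfE detZ det_map_mx mulf_neq0 ?tofrac_eq0 // expf_neq0 ?invr_eq0 ?tofrac_eq0.
apply: intertwines_fraction => // a b c.
pose rel : U := Wv * (\sum_d (A a b d)%:MP * Yv d c) -
  \sum_a' \sum_b' Yv a a' * Yv b b' * Cv a' b' c.
have relE (S : comNzRingType) (F : {rmorphism U -> S}) : F rel =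
    F Wv * (\sum_d F (A a b d)%:MP * F (Yv d c)) -
    \sum_a' \sum_b' F (Yv a a') * F (Yv b b') * F (Cv a' b' c).
  rewrite rmorphB rmorphM !rmorph_sum; congr (_ * _ - _).
    by apply: eq_bigr => d _; rewrite rmorphM.
  apply: eq_bigr => a' _; rewrite rmorph_sum; apply: eq_bigr => b' _.
  by rewrite !rmorphM.
have phi_rel : phi rel = 0.
  rewrite relE [phi Wv]phi_var mul1r.
  apply/eqP; rewrite subr_eq0; apply/eqP.
  transitivity ((x j)^-1 ^+ 2 * \sum_d map_consts iota A a b d * Gm d c).
    rewrite expr2 -mulrA; congr (_ * _); rewrite mulr_sumr; apply: eq_bigr => d _.
    by rewrite phiYE [phi _%:MP]mmapC mulrCA.
  rewrite (act_intertwines (map_consts iota A) Gu a b c) mulr_sumr.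
  apply: eq_bigr => a' _; rewrite mulr_sumr; apply: eq_bigr => b' _.
  by rewrite !phiYE [phi (Cv _ _ _)]phi_var -/f; ring.
have := Xker _ phi_rel; rewrite -/(th rel) relE => /eqP.
rewrite subr_eq0 => /eqP th_rel.
transitivity (th Wv * (\sum_d th (A a b d)%:MP * th (Yv d c))).
  by congr (_ * _); apply: eq_bigr => d _; rewrite mxE [th _%:MP]mmapC.
by rewrite th_rel; apply: eq_bigr => a' _; apply: eq_bigr => b' _; rewrite !mxE.
Qed.

Lemma in_closure_limit (A B : consts k) : in_closure delta A B -> is_limit delta A B.
Proof.
move=> clAB; pose K : fieldType := {fraction RM}.
pose iota : {rmorphism k -> K} := (@tofrac RM \o @mpolyC _ k)%FUN.
pose Gm : 'M[K]_n := pattern_mx (fun i : ixM => tofrac 'X_(enum_rank i)).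
have GmE : map_mx (@tofrac RM) (generic_mx delta k) = Gm by apply: map_pattern_mx.
have Gg : graded_mx delta Gm by apply: pattern_mx_graded.
have Gdet : \det Gm != 0 by rewrite -GmE det_map_mx tofrac_eq0 det_generic_neq0.
have Gu : Gm \in unitmx by rewrite unitmxE unitfE.
pose f := act Gm (map_consts iota A).
have at_Gm q : at_mx delta iota Gm q = tofrac q.
  apply: (rmorph_mpoly_ext (f := at_mx delta iota Gm) (g := @tofrac RM)) => [c|j].
    by rewrite /= mmapC.
  rewrite /= mmapX mmap1U mxE -surjective_pairing valK /=.
  by rewrite enum_valK.
have fB p : mmap iota (const_vector f) p = 0 -> p.@[const_vector B] = 0.
  move=> pf; apply: clAB => C [g [gg gu gAC]].
  have [m [q qP]] := act_polynomial delta A p.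
  have q0 : q = 0.
    have := qP _ iota Gm Gg Gdet; rewrite [mmap _ _ _]pf mulr0 at_Gm.
    by move/esym/eqP; rewrite tofrac_eq0 => /eqP.
  have g0 : \det g != 0 by move: gu; rewrite unitmxE unitfE.
  have := qP _ idfun g gg g0; rewrite q0 rmorph0 => /eqP.
  rewrite mulf_eq0 (negbTE (expf_neq0 _ g0)) /= => /eqP <-.
  apply: eq_mmap => // j; rewrite /const_vector; case: (enum_val j) => [[a b] c].
  by rewrite (intertwines_act gu (A := map_consts idfun A) gAC).
exact: (generic_specialization_limit Gdet fB).
Qed.
End ClosureLimit.

(** * Homogeneous bases of graded algebras *)

Lemma sum_delta_scale (R : nzRingType) (M : lmodType R) n (e : 'I_n -> M) a :
  \sum_b (b == a)%:R *: e b = e a.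
Proof.
rewrite (bigD1 a) //= eqxx scale1r big1 ?addr0 // => b /negbTE->.
by rewrite scale0r.
Qed.

Section HomogeneousBasis.
Variables (n : nat) (delta : 'I_n -> int).

(** A basis of homogeneous elements, with the degrees prescribed by [delta], and
    the structure constants [C] in this basis. *)
Record hbasis (R : comNzRingType) (X : gralg R) (e : 'I_n -> X) (C : consts n R) : Prop := HBasis {
  hbasis_homog : forall a, gralg_deg (delta a) (e a);
  hbasis_span : forall x, exists u : 'I_n -> R, x = \sum_a u a *: e a;
  hbasis_free : forall u : 'I_n -> R, \sum_a u a *: e a = 0 -> forall a, u a = 0;
  hbasis_mul : forall a b, gralg_mul (e a) (e b) = \sum_c C a b c *: e c }.

Section Theory.
Variables (R : comNzRingType) (X : gralg R).

Lemma gralg_mulDl (y : X) : {morph (gralg_mul (g:=X))^~ y : x x' / x + x'}.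
Proof. by move=> x x'; have := gralg_linl y 1 x x'; rewrite !scale1r. Qed.
Lemma gralg_mulDr (x : X) : {morph gralg_mul x : y y' / y + y'}.
Proof. by move=> y y'; have := gralg_linr x 1 y y'; rewrite !scale1r. Qed.
Lemma gralg_mul0l (y : X) : gralg_mul 0 y = 0.
Proof. by apply: (addIr (gralg_mul 0 y)); rewrite -gralg_mulDl !add0r. Qed.
Lemma gralg_mul0r (x : X) : gralg_mul x 0 = 0.
Proof. by apply: (addIr (gralg_mul x 0)); rewrite -gralg_mulDr !add0r. Qed.
Lemma gralg_mulZl r (x y : X) : gralg_mul (r *: x) y = r *: gralg_mul x y.
Proof. by have := gralg_linl y r x 0; rewrite gralg_mul0l !addr0. Qed.
Lemma gralg_mulZr r (x y : X) : gralg_mul x (r *: y) = r *: gralg_mul x y.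
Proof. by have := gralg_linr x r y 0; rewrite gralg_mul0r !addr0. Qed.
Lemma gralg_deg_sum I (r : seq I) (P : pred I) (F : I -> X) i :
  (forall j, P j -> gralg_deg i (F j)) -> gralg_deg i (\sum_(j <- r | P j) F j).
Proof.
move=> dF; apply: big_ind => //; first exact: (grading0 (gralg_degP X)).
by move=> x y dx dy; rewrite -(scale1r x); apply: (gradingZD (gralg_degP X)).
Qed.
Lemma gralg_degZ i r (x : X) : gralg_deg i x -> gralg_deg i (r *: x).
Proof.
move=> dx; rewrite -[r *: x]addr0; apply: (gradingZD (gralg_degP X)) => //.
exact: (grading0 (gralg_degP X)).
Qed.

Lemma gralg_mul_sum (e f : 'I_n -> X) (u v : 'I_n -> R) :
  gralg_mul (\sum_a u a *: e a) (\sum_b v b *: f b) =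
  \sum_a \sum_b (u a * v b) *: gralg_mul (e a) (f b).
Proof.
rewrite (big_morph _ (gralg_mulDl _) (gralg_mul0l _)); apply: eq_bigr => a _.
rewrite (big_morph _ (gralg_mulDr _) (gralg_mul0r _)); apply: eq_bigr => b _.
by rewrite gralg_mulZl gralg_mulZr scalerA.
Qed.

Variables (e : 'I_n -> X) (C : consts n R).
Hypothesis hb : hbasis e C.

Lemma hbasis_inj (u v : 'I_n -> R) :
  \sum_a u a *: e a = \sum_a v a *: e a -> u =1 v.
Proof.
move=> uv a; apply/eqP; rewrite -subr_eq0; apply/eqP.
apply: (hbasis_free hb (u := fun a => u a - v a)).
by under eq_bigr do rewrite scalerBl; rewrite sumrB uv subrr.
Qed.

Lemma hbasis_deg (u : 'I_n -> R) i : gralg_deg i (\sum_a u a *: e a) ->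
  forall a, delta a != i -> u a = 0.
Proof.
move=> du a ai; have [p [_ plin phom]] := grading_proj (gralg_degP X).
have pD : {morph p^~ (delta a) : x y / x + y}.
  by move=> x y; have := plin (delta a) 1 x y; rewrite !scale1r.
have p0 : p 0 (delta a) = 0 by apply: (addIr (p 0 (delta a))); rewrite -pD !add0r.
have := phom _ (delta a) _ du; rewrite (negbTE ai) (big_morph _ pD p0) => e0.
have := @hbasis_free _ _ _ _ hb (fun b => if delta b == delta a then u b else 0) _ a.
rewrite eqxx; apply; rewrite -[RHS]e0; apply: eq_bigr => b _.
have := plin (delta a) (u b) (e b) 0; rewrite addr0 => ->; rewrite p0 addr0.
rewrite (phom _ _ _ (hbasis_homog hb b)) eq_sym.
by case: ifP => _; rewrite ?scale0r ?scaler0.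
Qed.

Lemma hbasis_degE (u : 'I_n -> R) i : (forall a, delta a != i -> u a = 0) ->
  gralg_deg i (\sum_a u a *: e a).
Proof.
move=> u0; apply: gralg_deg_sum => a _.
have [<-|/u0->] := eqVneq (delta a) i; first exact/gralg_degZ/(hbasis_homog hb).
by rewrite scale0r; apply: (grading0 (gralg_degP X)).
Qed.

Lemma hbasis_consts_deg a b c : delta a + delta b != delta c -> C a b c = 0.
Proof.
move=> abc; have := gralg_mul_deg (hbasis_homog hb a) (hbasis_homog hb b).
by rewrite (hbasis_mul hb) => /hbasis_deg; apply; rewrite eq_sym.
Qed.

Lemma hbasis_assoc a b c d :
  \sum_x C a b x * C x c d = \sum_x C b c x * C a x d.
Proof.
have := gralg_mulA (e a) (e b) (e c); rewrite !(hbasis_mul hb).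
rewrite -{1}(sum_delta_scale e a) -(sum_delta_scale e c) !gralg_mul_sum => E.
have E1 : \sum_d (\sum_x C b c x * C a x d) *: e d = \sum_d (\sum_x C a b x * C x c d) *: e d.
  under eq_bigr do rewrite scaler_suml; under [RHS]eq_bigr do rewrite scaler_suml.
  rewrite exchange_big /= [RHS]exchange_big /=; move: E.
  rewrite (bigD1 a) //= [X in _ + X]big1 ?addr0 => [|y /negbTE ya]; last first.
    by rewrite big1 // => z _; rewrite ya mul0r scale0r.
  move=> E; transitivity (\sum_b0 ((a == a)%:R * C b c b0) *: gralg_mul (e a) (e b0)).
    apply: eq_bigr => x _; rewrite eqxx mul1r (hbasis_mul hb) scaler_sumr.
    by apply: eq_bigr => y _; rewrite scalerA.
  rewrite E; apply: eq_bigr => x _; rewrite (bigD1 c) //= big1 ?addr0 => [|y /negbTE yc].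
    rewrite eqxx mulr1 (hbasis_mul hb) scaler_sumr.
    by apply: eq_bigr => y _; rewrite scalerA.
  by rewrite yc mulr0 scale0r.
by have := hbasis_inj E1 d.
Qed.

Lemma hbasis_coord : exists crd : X -> 'I_n -> R,
  (forall x, x = \sum_a crd x a *: e a) /\ (forall u, crd (\sum_a u a *: e a) =1 u).
Proof.
have [crd crdP] := choice (hbasis_span hb); exists crd; split=> // u.
by apply: hbasis_inj; rewrite -crdP.
Qed.
End Theory.

Lemma hbasis_isom (R : comNzRingType) (X Y : gralg R) (e : 'I_n -> X) (e' : 'I_n -> Y) C :
  hbasis e C -> hbasis e' C -> exists2 f : X -> Y, gralg_isom f & forall a, f (e a) = e' a.
Proof.
move=> hX hY; have [cx [xE cxE]] := hbasis_coord hX; have [cy [yE cyE]] := hbasis_coord hY.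
pose f x := \sum_a cx x a *: e' a; pose f' y := \sum_a cy y a *: e a.
have crdZD r x y : cx (r *: x + y) =1 (fun a => r * cx x a + cx y a).
  move=> a; rewrite -[RHS](cxE (fun a => r * cx x a + cx y a)); congr cx.
  rewrite {1}(xE x) {1}(xE y) scaler_sumr -big_split /=; apply: eq_bigr => b _.
  by rewrite scalerDl scalerA.
exists f; last first.
  move=> a; rewrite /f -(sum_delta_scale e a) -[RHS](sum_delta_scale e' a).
  by apply: eq_bigr => b _; rewrite cxE.
split.
- move=> r x y; rewrite /f scaler_sumr -big_split /=; apply: eq_bigr => a _.
  by rewrite crdZD scalerDl scalerA.
- exists f'; first by move=> x; rewrite /f /f' [RHS]xE; apply: eq_bigr => a _; rewrite cyE.
  by move=> y; rewrite /f /f' [RHS]yE; apply: eq_bigr => a _; rewrite cxE.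
- move=> x y; rewrite {1}(xE x) {1}(xE y) gralg_mul_sum /f gralg_mul_sum.
  pose w c := \sum_a \sum_b cx x a * cx y b * C a b c.
  have wE (Z : gralg R) (eZ : 'I_n -> Z) : hbasis eZ C ->
     \sum_a \sum_b (cx x a * cx y b) *: gralg_mul (eZ a) (eZ b) = \sum_c w c *: eZ c.
    move=> hZ; under [RHS]eq_bigr do rewrite scaler_suml.
    rewrite [RHS]exchange_big /=; apply: eq_bigr => a _.
    under [RHS]eq_bigr do rewrite scaler_suml.
    rewrite [RHS]exchange_big /=; apply: eq_bigr => b _.
    by rewrite (hbasis_mul hZ) scaler_sumr; apply: eq_bigr => c _; rewrite scalerA.
  by rewrite !wE //; apply: eq_bigr => c _; rewrite cxE.
- move=> i x dx; apply: (hbasis_degE hY) => a ai.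
  by apply: (hbasis_deg hX _ ai); rewrite -xE.
Qed.

(** A matrix is graded when it commutes with the projections onto the homogeneous
    components, and then so does its inverse. *)
Lemma graded_mx_inv (R : comUnitRingType) (g : 'M[R]_n) :
  g \in unitmx -> graded_mx delta g -> graded_mx delta (invmx g).
Proof.
(* the projection onto the component of degree [delta a] *)
move=> gu gg a b ab; pose D : 'M[R]_n := diag_mx (\row_c (delta c == delta a)%:R).
have gD : g *m D = D *m g.
  apply/matrixP => x y; rewrite mul_mx_diag mul_diag_mx !mxE.
  have [<-|/gg->] := eqVneq (delta x) (delta y); last by rewrite mul0r mulr0.
  by rewrite mulrC.
have iD : invmx g *m D = D *m invmx g.
  rewrite -[LHS]mulmx1 -(mulmxV gu) mulmxA -[_ *m D *m g]mulmxA -gD.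
  by rewrite !mulmxA mulVmx // mul1mx.
have := congr1 (fun M : 'M_n => M a b) iD.
by rewrite /= mul_mx_diag mul_diag_mx !mxE eqxx mul1r eq_sym (negbTE ab) mulr0 => <-.
Qed.

Lemma hbasis_change (R : comUnitRingType) (X : gralg R) (e : 'I_n -> X) C C' (g : 'M[R]_n) :
  hbasis e C -> graded_mx delta g -> g \in unitmx -> intertwines C C' g ->
  hbasis (fun a => \sum_b invmx g a b *: e b) C'.
Proof.
move=> hX gg gu gC.
have key (u : 'I_n -> R) (h : 'M[R]_n) : \sum_a u a *: (\sum_b h a b *: e b) =
    \sum_b (\sum_a u a * h a b) *: e b.
  under [RHS]eq_bigr do rewrite scaler_suml.
  rewrite [RHS]exchange_big /=; apply: eq_bigr => a _; rewrite scaler_sumr.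
  by apply: eq_bigr => b _; rewrite scalerA.
split.
- move=> a; apply: (hbasis_degE hX) => b ba.
  by apply: graded_mx_inv => //; rewrite eq_sym.
- move=> x; have [u ->] := hbasis_span hX x.
  exists (fun a => \sum_c u c * g c a); rewrite key; apply: eq_bigr => b _; congr (_ *: _).
  pose v := \row_c u c; have : v *m g *m invmx g = v by rewrite -mulmxA mulmxV // mulmx1.
  move=> /(congr1 (fun w : 'rV_n => w 0 b)); rewrite !mxE => {1}<-.
  by apply: eq_bigr => a _; rewrite mxE; congr (_ * _); apply: eq_bigr => c _; rewrite mxE.
- move=> u; rewrite key => /(hbasis_free hX) u0 a.
  pose v := \row_c u c; have v0 : v *m invmx g = 0.
    apply/rowP => b; rewrite !mxE -[RHS](u0 b); apply: eq_bigr => c _; by rewrite mxE.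
  have : v *m invmx g *m g = v by rewrite -mulmxA mulVmx // mulmx1.
  by rewrite v0 mul0mx => /(congr1 (fun w : 'rV_n => w 0 a)); rewrite !mxE.
- move=> a b; rewrite gralg_mul_sum key.
  under eq_bigr => x _ do under eq_bigr => y _ do rewrite (hbasis_mul hX) scaler_sumr.
  transitivity (\sum_d (\sum_x \sum_y invmx g a x * invmx g b y * C x y d) *: e d).
    under [RHS]eq_bigr do rewrite scaler_suml; rewrite [RHS]exchange_big /=.
    apply: eq_bigr => x _.
    under [RHS]eq_bigr do rewrite scaler_suml; rewrite [RHS]exchange_big /=.
    by apply: eq_bigr => y _; apply: eq_bigr => d _; rewrite scalerA.
  apply: eq_bigr => d _; congr (_ *: _).
  under [RHS]eq_bigr => c _ do rewrite -(intertwines_act gu gC) /act mulr_suml.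
  rewrite [RHS]exchange_big /=; apply: eq_bigr => x _.
  under [RHS]eq_bigr => c _ do rewrite mulr_suml.
  rewrite [RHS]exchange_big /=; apply: eq_bigr => y _.
  under [RHS]eq_bigr => c _ do rewrite mulr_suml.
  rewrite [RHS]exchange_big /=; rewrite [RHS](bigD1 d) //= -[LHS]addr0; congr (_ + _).
    under [RHS]eq_bigr => c _ do rewrite -(mulrA _ (g d c)).
    rewrite -mulr_sumr; have := congr1 (fun M : 'M_n => M d d) (mulmxV gu).
    by rewrite !mxE eqxx => ->; rewrite mulr1.
  rewrite big1 // => d' d'd; under eq_bigr => c _ do rewrite -(mulrA _ (g d' c)).
  rewrite -mulr_sumr; have := congr1 (fun M : 'M_n => M d' d) (mulmxV gu).
  by rewrite !mxE (negbTE d'd) => ->; rewrite mulr0.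
Qed.

Lemma hbasis_isom_consts (R : comUnitRingType) (X Y : gralg R) (e : 'I_n -> X) (e' : 'I_n -> Y) C C' :
  hbasis e C -> hbasis e' C' -> gralg_isomorphic X Y <-> consts_isom delta C C'.
Proof.
move=> hX hY; split=> [[f [flin [f' fK f'K] fM fdeg]]|[g [gg gu gC]]]; last first.
  by have [f ff _] := hbasis_isom (hbasis_change hX gg gu gC) hY; exists f.
have [cy [yE cyE]] := hbasis_coord hY; have [cx [xE cxE]] := hbasis_coord hX.
have fD : {morph f : x y / x + y} by move=> x y; have := flin 1 x y; rewrite !scale1r.
have f0 : f 0 = 0 by apply: (addIr (f 0)); rewrite -fD !add0r.
have fZ r x : f (r *: x) = r *: f x by have := flin r x 0; rewrite f0 !addr0.
have fS (u : 'I_n -> R) : f (\sum_a u a *: e a) = \sum_a u a *: f (e a).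
  by rewrite (big_morph f fD f0); apply: eq_bigr => a _.
pose g : 'M[R]_n := \matrix_(a, b) cy (f (e a)) b.
have fe a : f (e a) = \sum_b g a b *: e' b.
  by rewrite [LHS]yE; apply: eq_bigr => b _; rewrite mxE.
have fSg (u : 'I_n -> R) : f (\sum_a u a *: e a) = \sum_b (\sum_a u a * g a b) *: e' b.
  rewrite fS; under [RHS]eq_bigr do rewrite scaler_suml.
  rewrite [RHS]exchange_big /=; apply: eq_bigr => a _; rewrite fe scaler_sumr.
  by apply: eq_bigr => b _; rewrite scalerA.
exists g; split.
- move=> a b ab; apply: (hbasis_deg hY (u := g a) (i := delta a)).
    by rewrite -fe; apply: fdeg; apply: (hbasis_homog hX).
  by rewrite eq_sym.
- pose h : 'M[R]_n := \matrix_(b, a) cx (f' (e' b)) a.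
  suff hg : h *m g = 1%:M by have [] := mulmx1_unit hg.
  apply/matrixP => b c; rewrite !mxE.
  have e1 : \sum_c (\sum_a h b a * g a c) *: e' c = \sum_c (c == b)%:R *: e' c.
    rewrite sum_delta_scale -fSg -[RHS]f'K; congr f; rewrite [RHS]xE.
    by apply: eq_bigr => a _; rewrite mxE.
  by rewrite (hbasis_inj hY e1) eq_sym.
- move=> a b c.
  have e1 : \sum_c (\sum_d C a b d * g d c) *: e' c =
      \sum_c (\sum_a' \sum_b' g a a' * g b b' * C' a' b' c) *: e' c.
    rewrite -fSg -(hbasis_mul hX) fM !fe gralg_mul_sum.
    under [RHS]eq_bigr do rewrite scaler_suml; rewrite [RHS]exchange_big /=.
    apply: eq_bigr => x _.
    under [RHS]eq_bigr do rewrite scaler_suml; rewrite [RHS]exchange_big /=.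
    apply: eq_bigr => y _; rewrite (hbasis_mul hY) scaler_sumr.
    by apply: eq_bigr => d _; rewrite scalerA.
  exact: (hbasis_inj hY e1).
Qed.

(** Independence is checked by extending the coordinate functions to the tensor
    product. *)
Lemma hbasis_base_change (R S : comNzRingType) (f : {rmorphism R -> S}) (X : gralg R) (e : 'I_n -> X) C :
  hbasis e C -> hbasis (X := base_change f X) (fun a => tens f (e a) 1) (map_consts f C).
Proof.
move=> hX; have [cx [xE cxE]] := hbasis_coord hX.
have tD s : {morph (fun x : X => tens f x s) : x y / x + y} by move=> x y; rewrite tensDl.
have tsum (u : 'I_n -> R) s : tens f (\sum_a u a *: e a) s = \sum_a (f (u a) * s) *: tens f (e a) 1.
  rewrite (big_morph _ (tD s) (tens0l f _ s)); apply: eq_bigr => a _.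
  by rewrite tensZ tens_scale mulr1.
split.
- by move=> a; apply: tensor_deg_tens; apply: (hbasis_homog hX).
- move=> t; elim/tensor_ind: t => [x s|t t' [u ->] [v ->]].
    by exists (fun a => f (cx x a) * s); rewrite {1}(xE x) tsum.
  exists (fun a => u a + v a); rewrite -big_split /=; apply: eq_bigr => a _.
  by rewrite scalerDl.
- move=> u u0 a; pose b x s := f (cx x a) * s.
  have cD : {morph cx^~ a : x y / x + y}.
    move=> x y; rewrite -[RHS](cxE (fun a => cx x a + cx y a)); congr cx.
    by rewrite {1}(xE x) {1}(xE y) -big_split /=; apply: eq_bigr => c _; rewrite scalerDl.
  have cZ r x : cx (r *: x) a = r * cx x a.
    rewrite -[RHS](cxE (fun a => r * cx x a)); congr cx.
    by rewrite {1}(xE x) scaler_sumr; apply: eq_bigr => c _; rewrite scalerA.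
  have bDl s : {morph b^~ s : x y / x + y} by move=> x y; rewrite /b cD rmorphD mulrDl.
  have bDr x : {morph b x : s s' / s + s'} by move=> s s'; rewrite /b mulrDr.
  have bZ r x s : b (r *: x) s = b x (f r * s) by rewrite /b cZ rmorphM -mulrA mulrCA.
  have := congr1 (tensor_lift b) u0; rewrite (tensor_lift0 bDl bDr bZ) => <-.
  rewrite (tensor_lift_sum bDl bDr bZ) (bigD1 a) //= big1 ?addr0 => [|c ca].
    rewrite tens_scale (tensor_lift_tens bDl bDr bZ) /b mulr1.
    by rewrite -(sum_delta_scale e a) cxE eqxx rmorph1 mul1r.
  rewrite tens_scale (tensor_lift_tens bDl bDr bZ) /b.
  by rewrite -(sum_delta_scale e c) cxE eq_sym (negbTE ca) rmorph0 mul0r.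
- move=> a b; rewrite [LHS]tensor_mul_tens mulr1 (hbasis_mul hX) tsum.
  by apply: eq_bigr => c _; rewrite mulr1.
Qed.
End HomogeneousBasis.

(** * Deformations of an algebra with a homogeneous basis *)

Section FreeModel.
Variables (n : nat) (delta : 'I_n -> int) (R : comNzRingType) (C : consts n R).
Hypothesis C_assoc : forall a b c d,
  \sum_x C a b x * C x c d = \sum_x C b c x * C a x d.
Hypothesis C_deg : forall a b c, delta a + delta b != delta c -> C a b c = 0.

Local Notation M := 'rV[R]_n.

Definition free_mul (u v : M) : M := \row_c \sum_a \sum_b u 0 a * v 0 b * C a b c.
Definition free_deg (i : int) : set M := [set v | forall a, delta a != i -> v 0 a = 0].

Fact free_linl v : linear (free_mul^~ v).
Proof.
move=> r x y; apply/rowP => c; rewrite !mxE mulr_sumr -big_split /=; apply: eq_bigr => a _.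
rewrite mulr_sumr -big_split /=; apply: eq_bigr => b _; rewrite !mxE; ring.
Qed.
Fact free_linr u : linear (free_mul u).
Proof.
move=> r x y; apply/rowP => c; rewrite !mxE mulr_sumr -big_split /=; apply: eq_bigr => a _.
rewrite mulr_sumr -big_split /=; apply: eq_bigr => b _; rewrite !mxE; ring.
Qed.

Fact free_mulA : associative free_mul.
Proof.
move=> u v w; apply/rowP => d; rewrite !mxE.
transitivity (\sum_a \sum_b \sum_c u 0 a * v 0 b * w 0 c * \sum_x C b c x * C a x d).
  apply: eq_bigr => a _; transitivity (\sum_x \sum_b \sum_c u 0 a * v 0 b * w 0 c * (C b c x * C a x d)).
    apply: eq_bigr => x _; rewrite mxE mulr_sumr mulr_suml; apply: eq_bigr => b _.
    by rewrite mulr_sumr mulr_suml; apply: eq_bigr => c _; ring.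
  rewrite exchange_big; apply: eq_bigr => b _; rewrite exchange_big; apply: eq_bigr => c _.
  by rewrite mulr_sumr.
under eq_bigr => a _ do under eq_bigr => b _ do under eq_bigr => c _ do rewrite -C_assoc mulr_sumr.
transitivity (\sum_x \sum_c \sum_a \sum_b u 0 a * v 0 b * w 0 c * (C a b x * C x c d)); last first.
  apply: eq_bigr => x _; apply: eq_bigr => c _; rewrite mxE !mulr_suml.
  by apply: eq_bigr => a _; rewrite !mulr_suml; apply: eq_bigr => b _; ring.
under [RHS]eq_bigr => x _ do rewrite exchange_big /=.
rewrite [RHS]exchange_big; apply: eq_bigr => a _ /=.
under [RHS]eq_bigr => x _ do rewrite exchange_big /=.
rewrite [RHS]exchange_big; apply: eq_bigr => b _ /=.
by rewrite exchange_big.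
Qed.

Fact free_grading : grading free_deg.
Proof.
split=> [i a _|i r x y dx dy a ai|x]; first by rewrite mxE.
  by rewrite !mxE dx // dy // mulr0 addr0.
pose c (i : int) : M := \row_a (if delta a == i then x 0 a else 0).
exists c; split.
  split=> [i a ai|]; first by rewrite mxE (negbTE ai).
  exists (undup [seq delta a | a <- enum 'I_n]); split; first exact: undup_uniq.
    move=> i; rewrite mem_undup => /negP ni; apply/rowP => a; rewrite !mxE.
    by case: eqP => // ai; case: ni; apply/mapP; exists a; rewrite ?mem_enum.
  apply/rowP => a; rewrite summxE (bigD1_seq (delta a)) ?undup_uniq //=; last first.
    by rewrite mem_undup; apply/mapP; exists a; rewrite ?mem_enum.
  rewrite mxE eqxx big1 ?addr0 // => i ia; by rewrite mxE eq_sym (negbTE ia).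
move=> c' [dc' [s [us s0 xE]]]; apply/funext => i; apply/rowP => a; rewrite mxE xE summxE.
case: eqP => [<-|/eqP ai]; last by rewrite dc'.
have [ins|nins] := boolP (delta a \in s).
  rewrite (bigD1_seq (delta a)) //= big1 ?addr0 // => j ja.
  by rewrite dc' // eq_sym.
rewrite s0 // mxE big1_seq // => j /andP[_ js].
by rewrite dc' //; apply: contraNneq nins => ->.
Qed.

Fact free_mul_deg i j x y : free_deg i x -> free_deg j y -> free_deg (i + j) (free_mul x y).
Proof.
move=> dx dy c cij; rewrite mxE big1 // => a _; rewrite big1 // => b _.
have [ai|/dx->] := eqVneq (delta a) i; last by rewrite !mul0r.
have [bj|/dy->] := eqVneq (delta b) j; last by rewrite mulr0 mul0r.
by rewrite C_deg ?mulr0 // ai bj eq_sym.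
Qed.

Definition free_gralg : gralg R :=
  GrAlg free_linl free_linr free_mulA free_grading free_mul_deg.

Lemma free_hbasis : hbasis delta (X := free_gralg) (fun a => delta_mx 0 a) C.
Proof.
have sumE (u : 'I_n -> R) : \sum_a u a *: delta_mx 0 a = \row_a u a.
  by rewrite [RHS]row_sum_delta; apply: eq_bigr => a _; rewrite mxE.
split.
- move=> a b ba; rewrite mxE eqxx /=; case: eqP => // e; by rewrite e eqxx in ba.
- by move=> x; exists (fun a => x 0 a); apply: row_sum_delta.
- move=> u; rewrite [LHS]sumE => u0 a.
  by have := congr1 (fun w : 'rV_n => w 0 a) u0; rewrite !mxE.
- move=> a b; rewrite [RHS]sumE; apply/rowP => c; rewrite !mxE.
  rewrite (bigD1 a) //= (bigD1 b) //= !mxE !eqxx !mul1r.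
  rewrite [X in _ + X + _]big1 ?addr0 => [|b' b'b].
    by rewrite big1 ?addr0 // => a' a'a; rewrite big1 // => b' _; rewrite mxE (negbTE a'a) !mul0r.
  by rewrite !mxE (negbTE b'b) mulr0 mul0r.
Qed.
End FreeModel.

Section TAdic.
Variable k : fieldType.
Local Notation t := (fps_t k).

Lemma fps_coef_t (b : fps k) j : fps_coef (t * b) j = if j is j'.+1 then fps_coef b j' else 0.
Proof.
case: j => [|j]; first by rewrite [LHS]big_ord1 /= mul0r.
rewrite [LHS]big_ord_recl /= mul0r add0r big_ord_recl /= mul1r [X in _ + X]big1 ?addr0.
  by rewrite /bump /= addn0 subSS subn0.
by move=> i _; rewrite /= mul0r.
Qed.

Lemma fps_coef_tX (a : fps k) m j : fps_coef (t ^+ m * a) j = if (j < m)%N then 0 else fps_coef a (j - m).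
Proof.
elim: m j => [|m IH] j; first by rewrite expr0 mul1r subn0.
by rewrite exprS -mulrA fps_coef_t; case: j => [|j] //; rewrite IH.
Qed.

Lemma fps_t_neq0 : t != 0.
Proof.
by apply/eqP => /(congr1 (fun a => fps_coef a 1)) /= /eqP; rewrite oner_eq0.
Qed.

Lemma fps_divisible (a : fps k) m : (forall j, (j < m)%N -> fps_coef a j = 0) ->
  a = t ^+ m * Fps (fun j => fps_coef a (j + m)).
Proof.
move=> a0; apply: fpsP => j; rewrite fps_coef_tX; case: ltnP => [/a0//|mj].
by rewrite /= subnK.
Qed.

Lemma row_t_complete n : t_complete 'rV[fps k]_n.
Proof.
split=> [x xdiv|u udiv].
  apply/rowP => a; rewrite mxE; apply: fpsP => j.
  by have [y ->] := xdiv j.+1; rewrite mxE fps_coef_tX ltnSn.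
pose x : 'rV[fps k]_n := \row_a Fps (fun j => fps_coef (u j.+1 0 a) j).
have stable m j a : (j < m)%N -> fps_coef (u m 0 a) j = fps_coef (u j.+1 0 a) j.
  move=> jm; rewrite -(subnKC jm); elim: (m - j.+1)%N => [|d IH]; first by rewrite addn0.
  rewrite addnS -IH; have [y yE] := udiv (j.+1 + d)%N.
  have -> : u (j.+1 + d).+1 = u (j.+1 + d)%N + t ^+ (j.+1 + d) *: y by rewrite -yE addrC subrK.
  by rewrite !mxE /= [X in _ + X]fps_coef_tX ltn_addr // addr0.
exists x => m; exists (\row_a Fps (fun j => fps_coef ((x - u m) 0 a) (j + m))).
apply/rowP => a; rewrite [RHS]mxE [X in _ * X]mxE; apply: fps_divisible => j jm.
by rewrite !mxE /= (stable m j) // subrr.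
Qed.

Lemma row_torsion_free n : torsion_free 'rV[fps k]_n.
Proof.
move=> a x ax0; have [->|a0] := eqVneq a 0; [by left|right].
apply/rowP => i; rewrite mxE; apply: (mulfI a0); rewrite mulr0.
by have := congr1 (fun w : 'rV_n => w 0 i) ax0; rewrite !mxE.
Qed.

Section Kernel.
Local Open Scope quotient_scope.
Variable M : lmodType (fps k).

Definition tdivb : {pred M} := fun x => `[< exists y, x = t *: y >].
Fact tdivb_zmod : zmod_closed tdivb.
Proof.
split=> [|x y /asboolP[x' ->] /asboolP[y' ->]]; apply/asboolP.
  by exists 0; rewrite scaler0.
by exists (x' - y'); rewrite scalerBr.
Qed.
HB.instance Definition _ := GRing.isZmodClosed.Build M tdivb tdivb_zmod.

(** The map which sends [x (x) s] to the class of [s x] modulo [t] is well defined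
    on the tensor product. *)
Lemma tens_eval0_eq0 (x : M) : tens (@fps_eval0 k) x 1 = 0 -> exists y, x = t *: y.
Proof.
pose Q := (Quotient.quot tdivb : zmodType).
pose pi (x : M) : Q := \pi x.
have piD : {morph pi : x y / x + y} by move=> u v; rewrite /pi !piE.
have pi_t y : pi (t *: y) = 0.
  have pi0 : pi 0 = 0 by apply: (addIr (pi 0)); rewrite -piD !add0r.
  rewrite -pi0; apply/eqP; rewrite -Quotient.idealrBE subr0; apply/asboolP.
  by exists y.
pose b (x : M) (s : k) : Q := pi (fps_const s *: x).
have bDl s : {morph b^~ s : x y / x + y} by move=> u v; rewrite /b scalerDr piD.
have bDr u : {morph b u : s s' / s + s'} by move=> s s'; rewrite /b rmorphD scalerDl piD.
have bZ r u s : b (r *: u) s = b u (fps_eval0 r * s).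
  rewrite /b scalerA.
  have -> : fps_const s * r = fps_const (fps_eval0 r * s) + t * (fps_const s * Fps (fun j => fps_coef r j.+1)).
    have cM (a : fps k) j : fps_coef (fps_const s * a) j = s * fps_coef a j.
      exact: fps_constM.
    apply: fpsP => j; transitivity (fps_coef (fps_const (fps_eval0 r * s)) j +
        fps_coef (t * (fps_const s * Fps (fun j => fps_coef r j.+1))) j); last by [].
    rewrite fps_coef_t cM; case: j => [|j]; first by rewrite addr0 mulrC.
    by rewrite cM add0r.
  by rewrite scalerDl piD -scalerA pi_t addr0.
move=> /(congr1 (tensor_lift b)); rewrite (tensor_lift_tens bDl bDr bZ) (tensor_lift0 bDl bDr bZ).
rewrite /b rmorph1 scale1r => /eqP.
have -> : 0 = pi 0 by apply: (addIr (pi 0)); rewrite -piD !add0r.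
by rewrite -Quotient.idealrBE subr0 => /asboolP.
Qed.
End Kernel.
End TAdic.

(** The image of a decomposition into homogeneous components is again one, so the
    inverse of an isomorphism also preserves degrees. *)
Lemma gralg_isom_deg_inv (R : comNzRingType) (X Y : gralg R) (f : X -> Y) :
  gralg_isom f -> forall i y, gralg_deg i y -> exists2 x, gralg_deg i x & f x = y.
Proof.
move=> [flin [f' fK f'K] _ fdeg] i y dy; exists (f' y) => //.
have fD : {morph f : x y / x + y} by move=> x z; have := flin 1 x z; rewrite !scale1r.
have f0 : f 0 = 0 by apply: (addIr (f 0)); rewrite -fD !add0r.
have [c [[dc [s [us s0 xE]]] _]] := grading_decomp (gralg_degP X) (f' y).
have yE : decomposition (gralg_deg (g:=Y)) y (f \o c).
  split=> [j|]; first exact: fdeg.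
  exists s; split=> // [j /s0 /= ->//|]; rewrite -[y]f'K xE.
  exact: (big_morph f fD f0).
have [c' [_ c'u]] := grading_decomp (gralg_degP Y) y.
have e1 := c'u _ yE; have e2 := c'u _ (decomposition_hom (gralg_degP Y) dy).
have -> : f' y = c i; last exact: dc.
rewrite -[RHS]fK; congr f'; have := congr1 (fun h => h i) (etrans (esym e1) e2).
by rewrite eqxx => <-.
Qed.

Section LiftBasis.
Variables (n : nat) (delta : 'I_n -> int) (k : fieldType) (X : gralg (fps k)) (B : gralg k).
Hypotheses (X_complete : t_complete X) (X_tf : torsion_free X).
Variables (Phi : base_change (@fps_eval0 k) X -> B) (e : 'I_n -> B) (CB : consts n k).
Hypotheses (PhiP : gralg_isom Phi) (hB : hbasis delta e CB).
Local Notation t := (fps_t k).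
Local Notation red x := (tens (@fps_eval0 k) x 1).

Lemma tens_red (x : X) s : tens (@fps_eval0 k) x s = red (fps_const s *: x).
Proof. by rewrite tensZ mulr1. Qed.

Lemma lift_homogeneous i (T : base_change (@fps_eval0 k) X) : gralg_deg i T ->
  exists2 x : X, gralg_deg i x & T = red x.
Proof.
move=> [u du ->]; exists (\sum_(p <- u) fps_const p.2 *: p.1).
  rewrite big_seq; apply: gralg_deg_sum => p pu; apply: gralg_degZ; exact: du.
have rD : {morph (fun x : X => red x) : x y / x + y} by move=> x y; apply: tensDl.
rewrite (big_morph _ rD (tens0l _ _ 1)); apply: eq_bigr => p _; exact: tens_red.
Qed.

(** Lift the basis of [B] to homogeneous elements [x a]. An element of [X] is a
    combination of them modulo [t]; iterating yields coefficients in the power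
    series and a remainder divisible by every power of [t], hence zero. A
    nontrivial relation, divided by a power of [t], would reduce to a nontrivial
    relation in [B]. *)
Lemma lift_hbasis : exists (x : 'I_n -> X) (C : consts n (fps k)),
  hbasis delta x C /\ forall a b c, fps_eval0 (C a b c) = CB a b c.
Proof.
have [Plin [Psi PsiK PhiK] PM _] := PhiP.
have lift a : exists x : X, gralg_deg (delta a) x /\ Phi (red x) = e a.
  have [T dT TE] := gralg_isom_deg_inv PhiP (hbasis_homog hB a).
  by have [x dx Tx] := lift_homogeneous dT; exists x; rewrite -Tx.
have [x xP] := choice lift.
have rD : {morph (fun x : X => red x) : x y / x + y} by move=> u v; apply: tensDl.
have PD : {morph Phi : x y / x + y} by move=> u v; have := Plin 1 u v; rewrite !scale1r.
have P0 : Phi 0 = 0 by apply: (addIr (Phi 0)); rewrite -PD !add0r.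
have PZ r u : Phi (r *: u) = r *: Phi u by have := Plin r u 0; rewrite P0 !addr0.
pose rho (y : X) := Phi (red y).
have rhoD : {morph rho : x y / x + y} by move=> u v; rewrite /rho rD PD.
have rho0 : rho 0 = 0 by rewrite /rho tens0l P0.
have rhoZ a y : rho (a *: y) = fps_eval0 a *: rho y.
  by rewrite /rho tensZ -[X in tens _ _ X]/(_ * 1) -tens_scale PZ.
have rhox a : rho (x a) = e a by case: (xP a).
have rhoM y z : rho (gralg_mul y z) = gralg_mul (rho y) (rho z).
  by rewrite /rho -PM [X in _ = Phi X]tensor_mul_tens mulr1.
have rho_sum (u : 'I_n -> fps k) : rho (\sum_a u a *: x a) = \sum_a fps_eval0 (u a) *: e a.
  by rewrite (big_morph rho rhoD rho0); apply: eq_bigr => a _; rewrite rhoZ rhox.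
have rho_eq0 y : rho y = 0 -> exists z, y = t *: z.
  move=> r0; apply: tens_eval0_eq0.
  by rewrite -[LHS]PsiK [Phi _]r0 -P0 PsiK.
have step y : exists uz : ('I_n -> k) * X, y = \sum_a fps_const (uz.1 a) *: x a + t *: uz.2.
  have [u uE] := hbasis_span hB (rho y).
  have [|z zE] := rho_eq0 (y - \sum_a fps_const (u a) *: x a).
    have -> : y - \sum_a fps_const (u a) *: x a = y + (-1) *: \sum_a fps_const (u a) *: x a.
      by rewrite scaleN1r.
    rewrite rhoD rhoZ rho_sum uE rmorphN1 scaleN1r; apply/eqP; rewrite subr_eq0; apply/eqP.
    by apply: eq_bigr.
  by exists (u, z); rewrite /= -zE addrC subrK.
have [nxt nxtP] := choice step.
have span y : exists u : 'I_n -> fps k, y = \sum_a u a *: x a.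
  pose z m := iter m (fun y => (nxt y).2) y.
  pose u a : fps k := Fps (fun m => (nxt (z m)).1 a).
  exists u; apply/eqP; rewrite -subr_eq0; apply/eqP; apply: X_complete.1 => m.
  pose u' a m : fps k := Fps (fun j => fps_coef (u a) (j + m)).
  have zE m' : y - \sum_a u a *: x a = t ^+ m' *: (z m' - \sum_a u' a m' *: x a).
    elim: m' => [|m' IH].
      rewrite scale1r; congr (_ - _); apply: eq_bigr => a _; congr (_ *: _).
      by apply: fpsP => j; rewrite /= addn0.
    rewrite IH exprSr -scalerA; congr (_ *: _).
    rewrite {1}(nxtP (z m')) -/(z m'.+1) scalerBr scaler_sumr addrAC addrC.
    congr (_ + _); rewrite -sumrB -sumrN; apply: eq_bigr => a _.
    rewrite -scalerBl scalerA -scaleNr; congr (_ *: _).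
    apply: fpsP => j; transitivity (- fps_coef (t * u' a m'.+1) j); last by [].
    rewrite fps_coef_t; case: j => [|j] /=; first by rewrite add0n subrr oppr0.
    by rewrite sub0r addnS.
  by exists (z m - \sum_a u' a m *: x a).
have free (u : 'I_n -> fps k) : \sum_a u a *: x a = 0 -> forall a, u a = 0.
  move=> u0 a; apply: fpsP => j.
  elim/ltn_ind: j a => j IHj a.
  pose v b : fps k := Fps (fun i => fps_coef (u b) (i + j)).
  have uv b : u b = t ^+ j * v b by apply: fps_divisible => i ij; apply: IHj.
  have tj : t ^+ j *: \sum_a v a *: x a = 0.
    by rewrite -[RHS]u0 scaler_sumr; apply: eq_bigr => b _; rewrite scalerA -uv.
  have [|v0] := X_tf tj; first by move/eqP; rewrite (negbTE (expf_neq0 _ (fps_t_neq0 k))).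
  have := congr1 rho v0; rewrite rho_sum rho0 => /(hbasis_free hB)/(_ a).
  by [].
have [C CP] := choice (fun ab : 'I_n * 'I_n => span (gralg_mul (x ab.1) (x ab.2))).
exists x, (fun a b => C (a, b)); split.
  by split=> // [a|a b]; [case: (xP a)|rewrite -(CP (a, b))].
move=> a b; apply: (hbasis_inj hB).
by rewrite -(hbasis_mul hB) -!rhox -rhoM (CP (a, b)) rho_sum.
Qed.
End LiftBasis.

(** * The variety of graded structures in coordinates *)

Lemma meval_linear_subst (R : comNzRingType) m n (L : 'I_m -> 'I_n -> R) (p : {mpoly R[n]}) :
  exists q : {mpoly R[m]}, forall x : 'I_m -> R,
    q.@[x] = p.@[fun j => \sum_i x i * L i j].
Proof.
exists (mmap (@mpolyC m R) (fun j => \sum_i L i j *: 'X_i) p) => x.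
rewrite [LHS]rmorph_mmap; apply: eq_mmap => [c|j] /=; first by rewrite mevalC.
by rewrite raddf_sum; apply: eq_bigr => i _; rewrite /= mevalZ mevalXU mulrC.
Qed.

Section ClosureStable.
Variables (n : nat) (delta : 'I_n -> int) (k : closedFieldType).
Local Notation consts := (consts n).

Lemma consts_isom_trans (R : comUnitRingType) (A C D : consts R) :
  consts_isom delta A C -> consts_isom delta C D -> consts_isom delta A D.
Proof.
move=> [g [gg gu gAC]] [h [hg hu hCD]]; exists (g *m h); split.
- move=> a b ab; rewrite mxE big1 // => c _.
  have [ac|/gg->] := eqVneq (delta a) (delta c); last by rewrite mul0r.
  by rewrite hg ?mulr0 // -ac.
- by rewrite unitmx_mul gu hu.
move=> a b c.
transitivity (\sum_x (\sum_d A a b d * g d x) * h x c).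
  under [RHS]eq_bigr do rewrite mulr_suml; rewrite [RHS]exchange_big /=.
  by apply: eq_bigr => d _; rewrite mxE mulr_sumr; apply: eq_bigr => x _; rewrite mulrA.
transitivity (\sum_a' \sum_b' g a a' * g b b' * \sum_x C a' b' x * h x c).
  under eq_bigr do rewrite gAC mulr_suml; rewrite exchange_big /=; apply: eq_bigr => a' _.
  under eq_bigr do rewrite mulr_suml; rewrite exchange_big /=; apply: eq_bigr => b' _.
  by rewrite mulr_sumr; apply: eq_bigr => x _; rewrite mulrA.
transitivity (\sum_a' \sum_b' \sum_x \sum_y g a a' * h a' x * (g b b' * h b' y) * D x y c).
  apply: eq_bigr => a' _; apply: eq_bigr => b' _; rewrite hCD mulr_sumr.
  apply: eq_bigr => x _; rewrite mulr_sumr; apply: eq_bigr => y _; ring.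
under [RHS]eq_bigr do under eq_bigr do rewrite !mxE mulr_suml mulr_suml.
under [RHS]eq_bigr do rewrite exchange_big /=.
rewrite [RHS]exchange_big /=; apply: eq_bigr => a' _.
under [RHS]eq_bigr do under eq_bigr do rewrite mulr_sumr mulr_suml.
rewrite exchange_big /=; under eq_bigr do rewrite exchange_big /=.
by apply: eq_bigr => x _; apply: eq_bigr => y _; apply: eq_bigr => b' _.
Qed.

(** The closure is stable because transport of structure is linear in the structure
    constants, and polynomials can be composed with it. *)
Lemma in_closure_isom (A B B' : consts k) :
  consts_isom delta B B' -> in_closure delta A B -> in_closure delta A B'.
Proof.
move=> [h [hg hu hBB']] clB p pA.
(* the matrix of the linear map [act h] *)
pose L (i j : 'I_#|const_index n|) := let: (a', b', d) := enum_val i in let: (a, b, c) := enum_val j in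
  invmx h a a' * invmx h b b' * h d c.
have LE (C : consts k) j : \sum_i const_vector C i * L i j = const_vector (act h C) j.
  rewrite /L /const_vector; case: (enum_val j) => [[a b] c]; rewrite /act.
  rewrite (reindex (@enum_rank (const_index n))) /=; last first.
    by exists enum_val => x _; [rewrite enum_rankK|rewrite enum_valK].
  under eq_bigr => x _ do rewrite enum_rankK.
  rewrite pair_big /= pair_big /=; apply: eq_bigr => -[[a' b'] d] _ /=; ring.
have [q qE] := meval_linear_subst L p.
have {}qE (C : consts k) : q.@[const_vector C] = p.@[const_vector (act h C)].
  by rewrite qE; apply: eq_mmap => // j; rewrite LE.
have -> : p.@[const_vector B'] = q.@[const_vector B].
  rewrite qE; apply: eq_mmap => // j; rewrite /const_vector; case: (enum_val j) => [[a b] c].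
  by rewrite (intertwines_act hu hBB').
apply: clB => C isoC; rewrite qE; apply: pA; apply: consts_isom_trans isoC _.
by exists h; split=> //; apply: act_intertwines.
Qed.
End ClosureStable.

Section HomogeneousBasisOfV.
Variables (k : fieldType) (V : vectType k) (V_ : int -> {vspace V}).
Hypothesis hV : grading (vs_deg V_).

Lemma free_subfamily (s : seq V) : exists s' : seq V,
  [/\ free s', {subset s' <= s} & forall x, x \in s -> x \in <<s'>>%VS].
Proof.
elim: s => [|x s [s' [fs' ss' sp]]]; first by exists [::]; split=> //; apply: nil_free.
have [xs|xs] := boolP (x \in <<s'>>%VS).
  exists s'; split=> // y; first by move/ss'; rewrite inE orbC => ->.
  by rewrite inE => /orP[/eqP->|/sp].
exists (x :: s'); split; first by rewrite free_cons xs.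
  by move=> y; rewrite !inE => /orP[->//|/ss' ->]; rewrite orbT.
move=> y; rewrite inE => /orP[/eqP->|/sp ys]; first by apply: memv_span; rewrite inE eqxx.
by rewrite span_cons; apply: subvP ys; apply: addvSr.
Qed.

Lemma homogeneous_family (l : seq V) : exists H : seq V,
  (forall h, h \in H -> exists i, h \in V_ i) /\ forall x, x \in l -> x \in <<H>>%VS.
Proof.
elim: l => [|x l [H [hH sp]]]; first by exists [::].
have [c [[dc [s [us s0 xE]]] _]] := grading_decomp hV x.
exists ([seq c i | i <- s] ++ H); split=> [h|y].
  rewrite mem_cat => /orP[/mapP[i _ ->]|/hH//]; exists i; exact: dc.
rewrite span_cat inE => /orP[/eqP->|/sp yH]; last by apply: subvP yH; apply: addvSr.
apply: (subvP (addvSl _ _)); rewrite xE big_seq; apply: memv_suml => i is_.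
by apply: memv_span; apply: map_f.
Qed.

(** The components of the vectors of any basis span [V], and a basis can be
    extracted from them. *)
Lemma homogeneous_basis : exists n (delta : 'I_n -> int) (e : 'I_n -> V),
  [/\ forall a, e a \in V_ (delta a),
      forall x, exists u : 'I_n -> k, x = \sum_a u a *: e a
    & forall u : 'I_n -> k, \sum_a u a *: e a = 0 -> forall a, u a = 0].
Proof.
have [H [hH spH]] := homogeneous_family (vbasis {:V}).
have [s [fs ss sp]] := free_subfamily H.
have deg (a : 'I_(size s)) : exists i, (in_tuple s)`_a \in V_ i.
  by apply: hH; apply: ss; apply: mem_nth.
have [delta dP] := choice deg.
have full x : x \in <<in_tuple s>>%VS.
  have : ({:V} <= <<s>>)%VS.
    rewrite -(span_basis (vbasisP {:V})); apply/span_subvP => y /spH.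
    by apply: subvP; apply/span_subvP => z /sp.
  by move/subvP; apply; rewrite memvf.
exists (size s), delta, (fun a => (in_tuple s)`_a); split=> //.
- by move=> x; exists (fun a => coord (in_tuple s) a x); apply: coord_span.
- exact/(freeP (X := in_tuple s)).
Qed.
End HomogeneousBasisOfV.

Section Variety.
Variables (k : closedFieldType) (V : vectType k) (V_ : int -> {vspace V}).
Hypothesis hV : grading (vs_deg V_).
Implicit Types A B D : grAss V_.

Lemma GL0_inv (g : 'End(V)) i x : GL0 V_ g -> x \in V_ i -> (g^-1)%VF x \in V_ i.
Proof.
move=> [kg gV] xi.
have gi : (g @: V_ i)%VS = V_ i.
  have e0 : \dim (g @: V_ i) = \dim (V_ i) by apply: limg_dim_eq; rewrite (eqP kg) capv0.
  by apply/eqP; rewrite eqEdim gV e0 leqnn.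
by move: xi; rewrite -{1}gi => /memv_imgP[y yi ->]; rewrite lker0_lfunK.
Qed.

Lemma transport_grAss (g : 'End(V)) A : GL0 V_ g ->
  exists D, D = transport g A :> 'Hom(V, 'Hom(V, V)).
Proof.
move=> gGL; have [kg gV] := gGL.
have mA x y z : transport g A x (transport g A y z) = transport g A (transport g A x y) z.
  by rewrite !transportE !lker0_lfunK // grAss_mulA.
have dg i j x y : x \in V_ i -> y \in V_ j -> transport g A x y \in V_ (i + j).
  move=> xi yj; rewrite transportE; apply: (subvP (gV _)); apply: memv_img.
  by apply: grAss_deg; apply: GL0_inv.
by exists (GrAss mA dg).
Qed.

Lemma orbit_isomorphic A D : Defs.orbit A D <-> gralg_isomorphic (grAss_alg hV A) (grAss_alg hV D).
Proof.
split=> [[g [kg gV] DE]|[f [flin [f' fK f'K] fM fdeg]]].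
  have gK : cancel g (g^-1)%VF := lker0_lfunK kg.
  have gVK : cancel (g^-1)%VF g := lker0_lfunVK kg.
  exists (g : V -> V); split.
  - by move=> a x y; rewrite linearP.
  - by exists (g^-1)%VF.
  - by move=> x y; rewrite /= DE transportE !gK.
  - by move=> i x xi; apply: (subvP (gV i)); apply: memv_img.
pose fl := GRing.isLinear.Build _ _ _ _ _ flin.
pose F : {linear V -> V} := HB.pack (f : V -> V) fl.
pose g : 'End(V) := linfun F.
have gE x : g x = f x by rewrite lfunE.
have kg : lker g == 0%VS by apply/lker0P => x y; rewrite !gE; apply: (can_inj fK).
exists g.
  split=> // i; apply/subvP => _ /memv_imgP[x xi ->]; rewrite gE; exact: fdeg.
apply/lfunP => x; apply/lfunP => y; rewrite transportE.
rewrite -[x]f'K -[y]f'K -!gE !lker0_lfunK // !gE; exact/esym/fM.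
Qed.

Variables (n : nat) (delta : 'I_n -> int) (e : 'I_n -> V).
Hypotheses (e_homog : forall a, e a \in V_ (delta a))
  (e_span : forall x, exists u : 'I_n -> k, x = \sum_a u a *: e a)
  (e_free : forall u : 'I_n -> k, \sum_a u a *: e a = 0 -> forall a, u a = 0).

Local Notation abasis A := (hbasis delta (X := grAss_alg hV A)).

Lemma grAss_hbasis A : exists C, abasis A e C.
Proof.
have [C CP] := choice (fun ab : 'I_n * 'I_n => e_span (A (e ab.1) (e ab.2))).
by exists (fun a b => C (a, b)); split=> // a b; apply: (CP (a, b)).
Qed.

(** A degree 0 automorphism of [V] moving the basis in which [A] has the constants
    [C'] to the basis [e] transports [A] to the required point. *)
Lemma orbit_realization A C C' : abasis A e C -> consts_isom delta C C' ->
  exists2 D, Defs.orbit A D & abasis D e C'.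
Proof.
move=> hA [g [gg gu gC]]; have hA' := hbasis_change hA gg gu gC.
set e' := (fun a => _) in hA'.
have z0 x y : (0 : 'Hom(V, 'Hom(V, V))) x y = 0 by rewrite !zero_lfunE.
have Z0A x y z : (0 : 'Hom(V, 'Hom(V, V))) x ((0 : 'Hom(V, 'Hom(V, V))) y z) =
    (0 : 'Hom(V, 'Hom(V, V))) ((0 : 'Hom(V, 'Hom(V, V))) x y) z by rewrite !z0.
have Z0d i j x y : x \in V_ i -> y \in V_ j -> (0 : 'Hom(V, 'Hom(V, V))) x y \in V_ (i + j).
  by move=> _ _; rewrite z0 mem0v.
(* the zero product, which has the same constants in all bases *)
pose Z := GrAss Z0A Z0d.
have hZ (f : 'I_n -> V) E : abasis A f E -> abasis Z f (fun _ _ _ => 0).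
  move=> [h1 h2 h3 _]; split=> // a b; rewrite [LHS]z0 big1 // => c _.
  by rewrite scale0r.
have [f [flin [f' fK f'K] _ fdeg] fe] := hbasis_isom (hZ _ _ hA') (hZ _ _ hA).
pose fl := GRing.isLinear.Build _ _ _ _ _ flin.
pose F : {linear V -> V} := HB.pack (f : V -> V) fl.
pose g' : 'End(V) := linfun F.
have gE x : g' x = f x by rewrite lfunE.
have kg : lker g' == 0%VS by apply/lker0P => x y; rewrite !gE; apply: (can_inj fK).
have gGL : GL0 V_ g'.
  split=> // i; apply/subvP => _ /memv_imgP[x xi ->]; rewrite gE; exact: fdeg.
have [D DE] := transport_grAss A gGL; exists D; first by exists g'.
have ge a : g' (e' a) = e a by rewrite gE fe.
split=> // a b; have -> : gralg_mul (g := grAss_alg hV D) (e a) (e b) = g' (A (e' a) (e' b)).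
  by rewrite [LHS]/= DE transportE -!ge !lker0_lfunK.
rewrite [A _ _](hbasis_mul hA') linear_sum; apply: eq_bigr => c _.
by rewrite linearZ /= ge.
Qed.

Local Notation H := 'Hom(V, 'Hom(V, V)).
Local Notation hcoord i A := (coord (vbasis {: H}) i A).

Lemma linear_coord : exists crd : V -> 'I_n -> k,
  [/\ forall x, x = \sum_a crd x a *: e a, forall u, crd (\sum_a u a *: e a) =1 u
    & forall r x y c, crd (r *: x + y) c = r * crd x c + crd y c].
Proof.
have [crd crdE] := choice e_span.
have crdK (u : 'I_n -> k) : crd (\sum_a u a *: e a) =1 u.
  move=> a; apply/eqP; rewrite -subr_eq0; apply/eqP.
  apply: (e_free (u := fun a => crd (\sum_a u a *: e a) a - u a)).
  by under eq_bigr do rewrite scalerBl; rewrite sumrB -crdE subrr.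
exists crd; split=> // r x y c.
rewrite -[RHS](crdK (fun c => r * crd x c + crd y c)); congr crd.
rewrite {1}(crdE x) {1}(crdE y) scaler_sumr -big_split /=; apply: eq_bigr => b _.
by rewrite scalerDl scalerA.
Qed.

Lemma linear_consts : exists L : 'I_(\dim {: H}) -> 'I_#|const_index n| -> k, forall A C,
  abasis A e C -> forall j, const_vector C j = \sum_i hcoord i A * L i j.
Proof.
have [crd [crdE crdK crdZD]] := linear_coord.
exists (fun (i : 'I_(\dim {: H})) (j : 'I_#|const_index n|) => let: (a, b, c) := enum_val j in crd (((vbasis {: H})`_i : H) (e a) (e b)) c).
move=> A C hA j; rewrite /const_vector; case: (enum_val j) => [[a b] c].
have -> : C a b c = crd (A (e a) (e b)) c.
  by rewrite [A _ _](hbasis_mul hA) crdK.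
rewrite {1}(coord_vbasis (memvf (A : H))) sum_lfunE sum_lfunE.
have crd0 : crd 0 c = 0.
  by have := crdZD (-1) 0 0 c; rewrite scaler0 addr0 mulN1r addNr.
have crdD : {morph crd^~ c : x y / x + y}.
  by move=> x y; have := crdZD 1 x y c; rewrite scale1r mul1r.
rewrite (big_morph (crd^~ c) crdD crd0); apply: eq_bigr => i _.
by rewrite scale_lfunE scale_lfunE -[_ *: _]addr0 crdZD crd0 addr0.
Qed.

Lemma consts_linear : exists L : 'I_#|const_index n| -> 'I_(\dim {: H}) -> k, forall A C,
  abasis A e C -> forall i, hcoord i A = \sum_j const_vector C j * L j i.
Proof.
have [crd [crdE crdK crdZD]] := linear_coord.
pose l (A : H) : 'rV[k]_#|const_index n| :=
  \row_j let: (a, b, c) := enum_val j in crd (A (e a) (e b)) c.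
have llin : linear l.
  move=> r A B; apply/rowP => j; rewrite !mxE; case: (enum_val j) => [[a b] c].
  by rewrite !add_lfunE !scale_lfunE crdZD.
pose ll := GRing.isLinear.Build _ _ _ _ _ llin.
pose lF : {linear H -> 'rV[k]_#|const_index n|} := HB.pack l ll.
pose lf := linfun lF.
have klf : lker lf == 0%VS.
  apply/lker0P => A B; rewrite !lfunE /= => lAB.
  have AB a b : A (e a) (e b) = B (e a) (e b).
    rewrite [LHS]crdE [RHS]crdE; apply: eq_bigr => c _; congr (_ *: _).
    have := congr1 (fun w : 'rV_#|const_index n| => w 0 (enum_rank (a, b, c))) lAB.
    by rewrite !mxE enum_rankK.
  apply/lfunP => x; apply/lfunP => y; have [u ->] := e_span x; have [v ->] := e_span y.
  have bil (F : H) : F (\sum_a u a *: e a) (\sum_a v a *: e a) =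
      \sum_a u a *: \sum_b v b *: F (e a) (e b).
    have FS : F (\sum_a u a *: e a) = \sum_a u a *: F (e a).
      by rewrite linear_sum; apply: eq_bigr => a _; rewrite linearZ.
    rewrite FS sum_lfunE; apply: eq_bigr => a _.
    rewrite scale_lfunE linear_sum; congr (_ *: _).
    by apply: eq_bigr => b _; rewrite linearZ.
  by rewrite !bil; apply: eq_bigr => a _; congr (_ *: _); apply: eq_bigr => b _; rewrite AB.
exists (fun j i => hcoord i ((lf^-1)%VF (delta_mx 0 j))) => A C hA i.
have lA : lf A = \sum_j const_vector C j *: delta_mx 0 j.
  rewrite lfunE [LHS]row_sum_delta; apply: eq_bigr => j _; congr (_ *: _).
  rewrite mxE /const_vector; case: (enum_val j) => [[a b] c].
  by rewrite [A _ _](hbasis_mul hA) crdK.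
rewrite -{1}(lker0_lfunK klf A) lA !linear_sum; apply: eq_bigr => j _.
by rewrite !linearZ.
Qed.

(** Polynomials in the coordinates of the product and polynomials in the structure
    constants correspond by linear substitutions, so both define the same closure. *)
Lemma graded_degeneration_in_closure A B CA CB : abasis A e CA -> abasis B e CB ->
  graded_degeneration B A <-> in_closure delta CA CB.
Proof.
move=> hA hB; split=> [deg p pA|cl B' BB' Z [[P ->] OA] p Pp].
  have [L LE] := linear_consts; have [q qE] := meval_linear_subst L p.
  have {}qE D CD : abasis D e CD -> grAss_eval q D = p.@[const_vector CD].
    by move=> hD; rewrite [LHS]qE; apply: eq_mmap => // j; rewrite (LE _ _ hD).
  rewrite -(qE _ _ hB).
  have BB : Defs.orbit B B.
    by apply/orbit_isomorphic; exists id; split=> //; exists id.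
  have /(_ [set D | grAss_eval q D = 0]) := deg _ BB; apply; split.
    by exists [set q]; apply/seteqP; split=> D /= => [qD p' ->|]; [|apply].
  move=> D /orbit_isomorphic AD; have [CD hD] := grAss_hbasis D.
  by rewrite /= (qE _ _ hD); apply: pA; apply/(hbasis_isom_consts hA hD).
have [CB' hB'] := grAss_hbasis B'.
have [L LE] := consts_linear; have [q qE] := meval_linear_subst L p.
have {}qE D CD : abasis D e CD -> q.@[const_vector CD] = grAss_eval p D.
  by move=> hD; rewrite qE; apply: eq_mmap => // i; rewrite (LE _ _ hD).
rewrite -(qE _ _ hB').
have BB'C : consts_isom delta CB CB'.
  by apply/(hbasis_isom_consts hB hB'); apply/orbit_isomorphic.
apply: (in_closure_isom BB'C cl) => C isoC.
have [D AD hD] := orbit_realization hA isoC.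
by rewrite (qE _ _ hD); apply: OA.
Qed.

(** The associativity of the free algebra over the power series is inherited from
    [A] over the Laurent series. *)
Lemma deformation_limit A B CA CB : abasis A e CA -> abasis B e CB ->
  (exists X : graded_deformation (grAss_alg hV B),
    gralg_isomorphic (base_change (fps_laurent k) X)
                     (base_change (const_laurent k) (grAss_alg hV A))) <->
  is_limit delta CA CB.
Proof.
move=> hA hB; have hAl := hbasis_base_change (const_laurent k) hA.
split=> [[X isoX]|[C [C0 [g [gg gu gC]]]]].
  have [x [C [hX C0]]] := lift_hbasis (gdef_complete X) (gdef_torsion_free (g := X)) (gdef_isom X) hB.
  exists C; split=> //.
  have hXl := hbasis_base_change (fps_laurent k) hX.
  have [g [gg gu gC]] := (hbasis_isom_consts hXl hAl).1 isoX.
  have [f ff _] := hbasis_isom hAl (hbasis_change hXl gg gu gC).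
  by apply: (hbasis_isom_consts hAl hXl).1; exists f.
have hAC := hbasis_change hAl gg gu gC.
have C_assoc a b c d : \sum_x C a b x * C x c d = \sum_x C b c x * C a x d.
  apply/eqP; rewrite -tofrac_eq !rmorph_sum; apply/eqP.
  have := hbasis_assoc hAC a b c d; rewrite /map_consts => E.
  transitivity (\sum_x fps_laurent k (C a b x) * fps_laurent k (C x c d)).
    by apply: eq_bigr => y _; rewrite rmorphM.
  by rewrite E; apply: eq_bigr => y _; rewrite rmorphM.
have C_deg a b c : delta a + delta b != delta c -> C a b c = 0.
  move=> abc; apply/eqP; rewrite -tofrac_eq0; apply/eqP.
  exact: (hbasis_consts_deg hAC abc).
pose X0 := free_gralg C_assoc C_deg.
have hX0 : hbasis delta (X := X0) _ C := free_hbasis C_assoc C_deg.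
have CBE : map_consts (@fps_eval0 k) C = CB.
  by apply/funext => a; apply/funext => b; apply/funext => c; apply: C0.
have hX00 := hbasis_base_change (@fps_eval0 k) hX0; rewrite CBE in hX00.
have [Phi PhiP _] := hbasis_isom hX00 hB.
have X0_complete : t_complete X0 by exact: row_t_complete.
have X0_tf : torsion_free X0 by exact: row_torsion_free.
exists (@GradedDeformation k (grAss_alg hV B) X0 X0_complete X0_tf Phi PhiP).
have [f ff _] := hbasis_isom (hbasis_base_change (fps_laurent k) hX0) hAC.
by exists f.
Qed.
End Variety.

Theorem theorem4p3 (k : closedFieldType) (V : vectType k)
    (V_ : int -> {vspace V}) (hV : grading (vs_deg V_)) (A B : grAss V_) :
  graded_degeneration B A <->
  exists X : graded_deformation (grAss_alg hV B),
    gralg_isomorphic (base_change (fps_laurent k) X)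
                     (base_change (const_laurent k) (grAss_alg hV A)).
Proof.
have [n [delta [e [e_homog e_span e_free]]]] := homogeneous_basis hV.
have [CA hA] := grAss_hbasis hV e_homog e_span e_free A.
have [CB hB] := grAss_hbasis hV e_homog e_span e_free B.
rewrite (deformation_limit hA hB).
rewrite (graded_degeneration_in_closure e_homog e_span e_free hA hB).
by split; [apply: in_closure_limit|apply: limit_in_closure].
Qed.
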